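(* Let $s\geq 1/2$, let $g\in S^s_s(\mathbb{R}^d)$ be a non-zero window function, and set $\Phi=W(g,g)$. Let $\sigma\in C^\infty(\mathbb{R}^{2d})$ define an element of $(S^s_s)'(\mathbb{R}^{2d})$. Then the following properties are equivalent: (i) There exists $\epsilon>0$ such that $\sigma\in M^{\infty}_{1\otimes w_{s,\epsilon},\Phi}(\mathbb{R}^{2d})$. (ii) There exist constants $C>0$ and $C'>0$ such that $$|\partial^\alpha\sigma(z)|\leq C'\, C^{|\alpha|}(\alpha!)^s\qquad\text{for all } z\in\mathbb{R}^{2d},\ \alpha\in\mathbb{N}^{2d}.$$ (iii) There exist $\epsilon>0$ and a constant $C''>0$ such that $$|\langle\sigma^w\pi(z)g,\pi(w)g\rangle|\leq C''\, e^{-\epsilon|w-z|^{1/s}}\qquad\text{for all } z,w\in\mathbb{R}^{2d}.$$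
   Context: Notation: $|\cdot|$ is the Euclidean norm; $\mathbb{N}=\{0,1,2,\dots\}$; $\alpha!=\alpha_1!\cdots\alpha_n!$ and $|\alpha|=\alpha_1+\dots+\alpha_n$ for a multi-index $\alpha\in\mathbb{N}^n$. The bracket $\langle f,h\rangle=\int f\,\overline{h}$ (linear in the first, conjugate-linear in the second argument) also denotes its extension to dual pairs of (ultra-)distribution and test function spaces. Gelfand-Shilov spaces: for $s\ge 1/2$, $S^s_s(\mathbb{R}^n)$ is the space of Schwartz functions $f$ on $\mathbb{R}^n$ for which there exist constants $A,B,K>0$ with $|x^\alpha\partial^\beta f(x)|\leq K A^{|\alpha|}B^{|\beta|}(\alpha!)^s(\beta!)^s$ for all $x\in\mathbb{R}^n$, $\alpha,\beta\in\mathbb{N}^n$. $\Sigma^1_1(\mathbb{R}^n)$ is the space of Schwartz functions $f$ such that for every $A>0$, $B>0$ there is $K>0$ with $|x^\alpha\partial^\beta f(x)|\leq K A^{|\alpha|}B^{|\beta|}\alpha!\beta!$ for all $x,\alpha,\beta$. Their (topological) duals, with respect to the standard topologies, are $(S^s_s)'(\mathbb{R}^n)$ and $(\Sigma^1_1)'(\mathbb{R}^n)$. A function $\sigma\in C^\infty(\mathbb{R}^n)$ is said to define an element of $(S^s_s)'$ (resp. $(\Sigma^1_1)'$) if $\sigma\overline{\varphi}$ is integrable for every $\varphi$ in $S^s_s$ (resp. $\Sigma^1_1$) and $\varphi\mapsto\langle\sigma,\varphi\rangle=\int\sigma\overline\varphi$ is a continuous conjugate-linear functional there. Time-frequency shifts: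 for $z=(x,\xi)\in\mathbb{R}^{2d}$, $(\pi(z)f)(t)=e^{2\pi i\xi\cdot t}f(t-x)$. Cross-Wigner distribution: $W(f,h)(x,\xi)=\int_{\mathbb{R}^d}f(x+\tfrac t2)\overline{h(x-\tfrac t2)}e^{-2\pi i t\cdot\xi}\,dt$. If $f,h\in S^s_s(\mathbb{R}^d)$ with $s\ge1/2$ then $W(f,h)\in S^s_s(\mathbb{R}^{2d})$. Weyl operator: $\sigma^w f(x)=\int_{\mathbb{R}^{2d}}\sigma\left(\frac{x+y}{2},\eta\right)e^{2\pi i(x-y)\cdot\eta}f(y)\,dy\,d\eta$ formally; rigorously, $\langle\sigma^w f,h\rangle=\langle\sigma,W(h,f)\rangle$ for $f,h\in S^s_s(\mathbb{R}^d)$. Short-time Fourier transform on $\mathbb{R}^{2d}$: $V_\Phi\sigma(u,v)=\int_{\mathbb{R}^{2d}}\sigma(t)\overline{\Phi(t-u)}e^{-2\pi i v\cdot t}\,dt$ for $u,v\in\mathbb{R}^{2d}$. Weights and (ultra-)modulation space: $w_{s,\epsilon}(v)=e^{\epsilon|v|^{1/s}}$ for $v\in\mathbb{R}^{2d}$, and $(1\otimes w_{s,\epsilon})(u,v)=w_{s,\epsilon}(v)$. For such $\sigma$, $\sigma\in M^\infty_{1\otimes w_{s,\epsilon},\Phi}(\mathbb{R}^{2d})$ means that $\sigma$ defines an element of $(\Sigma^1_1)'(\mathbb{R}^{2d})$ and $\operatorname{ess\,sup}_{u,v\in\mathbb{R}^{2d}}|V_\Phi\sigma(u,v)|\,e^{\epsilon|v|^{1/s}}<\infty$.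 *)

(* Defs.v *)
From HB Require Import structures.
From mathcomp Require Import all_boot all_order all_algebra.
From mathcomp Require Import all_classical all_reals all_analysis.
From mathcomp Require Import ess_sup_inf complex.

Set Implicit Arguments.
Unset Strict Implicit.
Unset Printing Implicit Defensive.

Import Order.TTheory GRing.Theory Num.Theory.
Import numFieldNormedType.Exports.

Local Open Scope classical_set_scope.
Local Open Scope ring_scope.
Local Open Scope complex_scope.

(* The R-valued modulus; the generic norm of R[i] takes its values in R[i]. *)
Notation cmod := ComplexField.Normc.normc.

Section LebesgueMeasure.
Context {R : realType}.

Definition tuple_cons n (p : n.-tuple (measurableTypeR R) * measurableTypeR R) :
  n.+1.-tuple (measurableTypeR R) := [tuple of p.2 :: p.1].

Lemma measurable_tuple_cons n : measurable_fun setT (@tuple_cons n).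
Proof. exact: measurable_cons. Qed.

Section step.
Variables (n : nat)
  (mu : {measure set (n.-tuple (measurableTypeR R)) -> \bar R}).

Definition lebesgue_step : set (n.+1.-tuple (measurableTypeR R)) -> \bar R :=
  pushforward (mu \x (@lebesgue_measure R))%E (@tuple_cons n).

Let step0 : lebesgue_step set0 = 0%E.
Proof. by rewrite /lebesgue_step /pushforward preimage_set0 measure0. Qed.

Let step_ge0 A : (0 <= lebesgue_step A)%E.
Proof. by rewrite /lebesgue_step /pushforward measure_ge0. Qed.

Let step_sigma_additive : semi_sigma_additive lebesgue_step.
Proof.
rewrite /lebesgue_step; apply: measure_semi_sigma_additive.
exact: measurable_tuple_cons.
Qed.

HB.instance Definition _ := isMeasure.Build _ _ _ lebesgue_step
  step0 step_ge0 step_sigma_additive.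

End step.

(* n-dimensional Lebesgue measure on the Borel sets of R^n (as tuples): the
   n-fold product of the one-dimensional Lebesgue measure. *)
Fixpoint lebesgue_Rn n : {measure set (n.-tuple (measurableTypeR R)) -> \bar R} :=
  match n with
  | 0 => dirac [tuple]
  | m.+1 => lebesgue_step (lebesgue_Rn m)
  end.

(* Identification of the measure-theoretic copy of R^n (tuples) with the
   normed space 'rV[R]_n. *)
Definition vec n (t : n.-tuple (measurableTypeR R)) : 'rV[R]_n :=
  \row_i tnth t i.

Definition cintegrable n (F : 'rV[R]_n -> R[i]) : Prop :=
  (lebesgue_Rn n).-integrable setT (fun t => (complex.Re (F (vec t)))%:E) /\
  (lebesgue_Rn n).-integrable setT (fun t => (complex.Im (F (vec t)))%:E).

Definition cintegral n (F : 'rV[R]_n -> R[i]) : R[i] :=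
  (\int[lebesgue_Rn n]_t complex.Re (F (vec t))) +i*
  (\int[lebesgue_Rn n]_t complex.Im (F (vec t))).

End LebesgueMeasure.

Section Derivatives.
Context {R : realType} {n : nat}.
Implicit Types (f : 'rV[R]_n -> R[i]) (x : 'rV[R]_n) (a : 'I_n -> nat).

Definition pderiv (i : 'I_n) f : 'rV[R]_n -> R[i] := fun x =>
  ('D_(delta_mx 0 i) (fun y => complex.Re (f y)) x) +i*
  ('D_(delta_mx 0 i) (fun y => complex.Im (f y)) x).

(* C^oo: every iterated partial derivative, in any order of differentiation,
   is continuous and has all its first-order partial derivatives. *)
Definition smooth f : Prop := forall s : seq 'I_n,
  let h := foldr pderiv f s in
  [/\ continuous (fun x => complex.Re (h x)), continuous (fun x => complex.Im (h x)) &
      forall i x, derivable (fun y => complex.Re (h y)) x (delta_mx 0 i) /\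
                  derivable (fun y => complex.Im (h y)) x (delta_mx 0 i)].

Definition mlen a : nat := \sum_i a i.

Definition mfact a : R := (\prod_i (a i)`!)%:R.

Definition mpow x a : R := \prod_i x 0 i ^+ a i.

Definition mderiv a f : 'rV[R]_n -> R[i] :=
  foldr (fun i h => iter (a i) (pderiv i) h) f (enum 'I_n).

Definition dotp x (y : 'rV[R]_n) : R := \sum_i x 0 i * y 0 i.

(* Euclidean norm; the library norm on 'rV[R]_n is the sup norm. *)
Definition enorm x : R := Num.sqrt (dotp x x).

End Derivatives.

Section GelfandShilov.
Context {R : realType} {n : nat}.
Local Notation fspace := ('rV[R]_n -> R[i]).
Implicit Types (f g : fspace) (s A B K : R) (u : fspace -> R[i]).

Definition schwartz f : Prop := smooth f /\
  forall a b : 'I_n -> nat, exists K, forall x,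
    cmod ((mpow x a)%:C * mderiv b f x) <= K.

Definition gs_bound s A B K f : Prop :=
  forall (x : 'rV[R]_n) (a b : 'I_n -> nat),
    cmod ((mpow x a)%:C * mderiv b f x) <=
      K * A ^+ mlen a * B ^+ mlen b * mfact a `^ s * mfact b `^ s.

(* S^s_s(R^n) *)
Definition GS s : set fspace := [set f | schwartz f /\
  exists A B K, [/\ 0 < A, 0 < B, 0 < K & gs_bound s A B K f]].

(* Sigma^1_1(R^n) *)
Definition GSigma : set fspace := [set f | schwartz f /\
  forall A B, 0 < A -> 0 < B -> exists2 K, 0 < K & gs_bound 1 A B K f].

Definition fcomb (a b : R[i]) f g : fspace := fun x => a * f x + b * g x.

Definition absconvex (V : set fspace) : Prop := forall f g (a b : R[i]),
  V f -> V g -> cmod a + cmod b <= 1 -> V (fcomb a b f g).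

(* Neighbourhoods of 0 for the standard topologies.
   - S^s_s is the locally convex inductive limit over A, B > 0 of the Banach
     spaces normed by the best constant K in gs_bound s A B K: a base of
     neighbourhoods of 0 is given by the absolutely convex sets which contain a
     ball around 0 of each of these Banach spaces;
   - Sigma^1_1 is the projective limit (intersection), over A, B > 0, of the
     same Banach spaces with s = 1. *)
Definition GS_nbhs0 s : set (set fspace) := [set U | exists V : set fspace,
  [/\ V `<=` GS s, V `<=` U, absconvex V &
      forall A B, 0 < A -> 0 < B -> exists2 r, 0 < r &
        [set f | schwartz f /\ gs_bound s A B r f] `<=` V]].

Definition GSigma_nbhs0 : set (set fspace) := [set U | exists A B r,
  [/\ 0 < A, 0 < B, 0 < r & [set f | GSigma f /\ gs_bound 1 A B r f] `<=` U]].

Definition conj_linear_on (E : set fspace) u : Prop :=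
  forall f g (a b : R[i]), E f -> E g ->
    u (fcomb a b f g) = a^* * u f + b^* * u g.

(* Continuity on E for the translation-invariant topology whose neighbourhoods
   of 0 are given by N. *)
Definition continuous_on (E : set fspace) (N : set (set fspace)) u : Prop :=
  forall f, E f -> forall e : R, 0 < e -> exists2 U, N U &
    forall g, E g -> U (fcomb 1 (-1) g f) -> cmod (u g - u f) < e.

Definition pairing (sigma phi : fspace) : R[i] :=
  cintegral (fun x => sigma x * (phi x)^*).

Definition defines_element (E : set fspace) (N : set (set fspace))
    (sigma : fspace) : Prop :=
  [/\ forall phi, E phi -> cintegrable (fun x => sigma x * (phi x)^*),
      conj_linear_on E (pairing sigma) &
      continuous_on E N (pairing sigma)].

Definition defines_GS_dual s := defines_element (GS s) (GS_nbhs0 s).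

Definition defines_GSigma_dual := defines_element GSigma GSigma_nbhs0.

End GelfandShilov.

Section TimeFrequency.
Context {R : realType}.

Definition cis (theta : R) : R[i] := cos theta +i* sin theta.

(* A point z = (x, xi) of R^{2d} is a row vector of length d + d, with
   x = lsubmx z and xi = rsubmx z. *)
Definition tfshift d (z : 'rV[R]_(d + d)) (f : 'rV[R]_d -> R[i]) :
    'rV[R]_d -> R[i] := fun t =>
  cis (2 * pi * dotp (rsubmx z) t) * f (t - lsubmx z).

Definition wigner d (f h : 'rV[R]_d -> R[i]) : 'rV[R]_(d + d) -> R[i] :=
  fun z => let x := lsubmx z in let xi := rsubmx z in
  cintegral (fun t : 'rV[R]_d =>
    f (x + 2^-1 *: t) * (h (x - 2^-1 *: t))^* * cis (- (2 * pi * dotp t xi))).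

(* sigma^w f, as the conjugate-linear functional h |-> <sigma^w f, h>. *)
Definition weyl d (sigma : 'rV[R]_(d + d) -> R[i]) (f : 'rV[R]_d -> R[i]) :
    ('rV[R]_d -> R[i]) -> R[i] := fun h => pairing sigma (wigner h f).

Definition stft n (Phi sigma : 'rV[R]_n -> R[i]) (u v : 'rV[R]_n) : R[i] :=
  cintegral (fun t : 'rV[R]_n =>
    sigma t * (Phi (t - u))^* * cis (- (2 * pi * dotp v t))).

Definition expweight n (s eps : R) (v : 'rV[R]_n) : R :=
  expR (eps * enorm v `^ s^-1).

(* sigma \in M^oo_{1 (x) w_{s,eps}, Phi}(R^n); the essential supremum over
   (u, v) is taken with respect to the Lebesgue measure of R^{n + n}. *)
Definition modulation_infty n (s eps : R) (Phi sigma : 'rV[R]_n -> R[i]) : Prop :=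
  defines_GSigma_dual sigma /\
  (ess_sup (lebesgue_Rn (n + n)) (fun p =>
     let u := lsubmx (vec p) in let v := rsubmx (vec p) in
     (cmod (stft Phi sigma u v) * expweight s eps v)%:E) < +oo)%E.

End TimeFrequency.

(* Main.v *)
From HB Require Import structures.
Require Import Defs.
From mathcomp Require Import all_boot all_order all_algebra.
From mathcomp Require Import all_classical all_reals all_analysis.
From mathcomp Require Import measurable_realfun ess_sup_inf complex.
From mathcomp Require Import ring lra zify.
Set Implicit Arguments.
Unset Strict Implicit.
Unset Printing Implicit Defensive.
Import Order.TTheory GRing.Theory Num.Theory.
Import numFieldNormedType.Exports.
Local Open Scope classical_set_scope.
Local Open Scope ring_scope.
Local Open Scope complex_scope.


(** Write Phi = W(g,g) and V for the short-time Fourier transform of sigma with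
    window Phi. The covariance of the Wigner distribution under time-frequency
    shifts (wigner_tfshift, weyl_stft) gives
      |<sigma^w pi(z) g, pi(w) g>| = |V((w + z)/2, J(w - z))|
    with the standard symplectic matrix J, an isometry. Hence (iii) says that
    |V(u,v)| <= C exp(- eps |v|^(1/s)) for all u and v, and (i) says the same for
    almost all (u,v), together with the fact that sigma acts on Sigma^1_1. It
    remains to compare this decay in v with the growth of the derivatives of sigma,
    for a window Phi that is itself in the Gelfand-Shilov space (wigner_rapid) and
    not identically zero (wigner_neq0).

    From derivatives to decay (stft_decay). V(u,.) is the Fourier transform of
    H_u = sigma conj(Phi(. - u)). By Leibniz, a derivative of H_u of order N is
    bounded by a constant times C^N (N!)^s times an integrable weight centred at u,
    so |v_i|^N |V(u,v)| <= A C^N (N!)^s uniformly in u. Summing these bounds as an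
    exponential series in |v|^(1/s) gives the exponential decay (decay_of_moments).

    From decay to derivatives (deriv_of_stft_decay). Decay for almost all (u,v)
    means that, for almost every u, it holds for almost every v (ae_section). For
    such a u the function V(u,.) is integrable against all monomials, so Fourier
    inversion (fourier_inversion) recovers H_u, and differentiation under the
    integral sign bounds its derivatives by A C^N (N!)^s uniformly in t and u
    (deriv_inverse_fourier). Multiplying by Phi(. - u), the derivatives of
    sigma |Phi(. - u)|^2 have such bounds with an integrable weight in t - u.
    Integrate over u: the integral over u of D(sigma |Phi(. - u)|^2)(t) is
    D sigma(t) times the integral of |Phi|^2, because each term of the Leibniz
    expansion with a derivative on |Phi|^2 integrates to zero
    (cint_deriv_translates). Dividing by the integral of |Phi|^2, which is not zero
    (cint_sqr_neq0), gives (ii). In particular sigma is then bounded, so that it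
    acts on Sigma^1_1 (defines_GSigma_bounded); this closes the circle from (iii)
    to (i).

    All bounds of the form C^N (N!)^s are handled through words: finite sequences
    of letters, each of which is the multiplication by a coordinate or a partial
    derivative. A function is in S^s_s if and only if words of length N change it
    into a function bounded by K C^N (N!)^s (GS_rapid, rapid_GS; this equivalence
    uses s >= 1/2), and bound_family then replaces every Leibniz formula: one
    letter produces two terms, so a word of length N costs a factor 2^N. *)

(** * Complex numbers and complex-valued integrals *)

Section ComplexBasics.
Context {R : realType}.
Implicit Types (z w : R[i]) (t : R).

Lemma cmod_ge0 z : 0 <= cmod z.
Proof. by case: z => a b; apply: sqrtr_ge0. Qed.

Lemma cmodM z w : cmod (z * w) = cmod z * cmod w.
Proof. exact: ComplexField.Normc.normcM. Qed.

Lemma conjcE z : Num.conj z = conjc z.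
Proof. by []. Qed.

Lemma cmodJ z : cmod (conjc z) = cmod z.
Proof. by case: z => a b /=; rewrite sqrrN. Qed.

Lemma cmod_real t : cmod t%:C = `|t|.
Proof. by rewrite /= expr0n addr0 sqrtr_sqr. Qed.

Lemma Re_le_cmod z : `|complex.Re z| <= cmod z.
Proof.
by case: z => a b /=; rewrite -[leLHS]sqrtr_sqr ler_wsqrtr// lerDl sqr_ge0.
Qed.

Lemma Im_le_cmod z : `|complex.Im z| <= cmod z.
Proof.
by case: z => a b /=; rewrite -[leLHS]sqrtr_sqr ler_wsqrtr// lerDr sqr_ge0.
Qed.

(** With the two previous bounds, real and imaginary parts control the modulus up
    to a factor 2; all complex integrals are estimated through them. *)
Lemma cmod_le_ReIm z : cmod z <= `|complex.Re z| + `|complex.Im z|.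
Proof.
rewrite {1}(complexE z); apply: (le_trans (le_normcD _ _)).
rewrite cmodM cmod_real lerD// cmod_real /=.
by rewrite expr0n expr1n add0r sqrtr1 mul1r.
Qed.

Lemma cmod_eq0 z : cmod z = 0 -> z = 0.
Proof. exact: ComplexField.Normc.eq0_normc. Qed.

Lemma cmod0 : cmod (0 : R[i]) = 0.
Proof. exact: ComplexField.Normc.normc0. Qed.

Lemma cmod_sqr z : z * conjc z = (cmod z ^+ 2)%:C.
Proof.
case: z => a b /=; rewrite sqr_sqrtr ?addr_ge0 ?sqr_ge0//.
by simpc; congr (_ +i* _); ring.
Qed.

Lemma cis0 : cis (0 : R) = 1.
Proof. by rewrite /cis cos0 sin0. Qed.

Lemma cisD s t : cis (s + t) = cis s * cis t.
Proof. by rewrite /cis cosD sinD; simpc; congr (_ +i* _); ring. Qed.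

Lemma cmod_cis t : cmod (cis t) = 1.
Proof. by rewrite /cis /= cos2Dsin2 sqrtr1. Qed.

Lemma cisJ t : conjc (cis t) = cis (- t).
Proof. by rewrite /cis /= cosN sinN. Qed.

Lemma conjcM z w : conjc (z * w) = conjc z * conjc w.
Proof. by rewrite -!conjcE rmorphM. Qed.

Lemma conjcD z w : conjc (z + w) = conjc z + conjc w.
Proof. by rewrite -!conjcE rmorphD. Qed.

Lemma cmod_i : cmod ('i : R[i]) = 1.
Proof. by rewrite /= expr0n expr1n add0r sqrtr1. Qed.

Lemma cmodN z : cmod (- z) = cmod z.
Proof. by rewrite -mulN1r cmodM -(rmorphN1 (real_complex R)) cmod_real normrN1 mul1r. Qed.

Lemma eq_lerW (x y : R) : x = y -> x <= y.
Proof. by move=> ->. Qed.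

End ComplexBasics.

Section ComplexIntegral.
Context {d} {T : measurableType d} {R : realType}.
Variable mu : {measure set T -> \bar R}.
Implicit Types (F G : T -> R[i]) (h : T -> R).

Definition cmeas F := measurable_fun setT (fun t => complex.Re (F t)) /\
  measurable_fun setT (fun t => complex.Im (F t)).

Definition cintg F := mu.-integrable setT (fun t => (complex.Re (F t))%:E) /\
  mu.-integrable setT (fun t => (complex.Im (F t))%:E).

Definition cint F : R[i] :=
  (\int[mu]_t complex.Re (F t)) +i* (\int[mu]_t complex.Im (F t)).

Lemma cmeas_cmod F : cmeas F -> measurable_fun setT (fun t => cmod (F t)).
Proof.
move=> [mr mi].
rewrite (_ : (fun _ => _) = (fun t => Num.sqrt (complex.Re (F t) ^+ 2 + complex.Im (F t) ^+ 2))).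
  apply: (measurableT_comp (f := @Num.sqrt R)).
    exact: continuous_measurable_fun (@sqrt_continuous R).
  by apply: measurable_funD; exact: measurable_funX.
by apply/funext => t; case: (F t).
Qed.

Lemma cmeasM F G : cmeas F -> cmeas G -> cmeas (fun t => F t * G t).
Proof.
move=> [fr fi] [gr gi]; split.
  rewrite (_ : (fun _ => _) = (fun t => complex.Re (F t) * complex.Re (G t)
     - complex.Im (F t) * complex.Im (G t))).
    by apply: measurable_funB; exact: measurable_funM.
  by apply/funext => t; case: (F t) (G t) => a b [].
rewrite (_ : (fun _ => _) = (fun t => complex.Re (F t) * complex.Im (G t)
     + complex.Im (F t) * complex.Re (G t))).
  by apply: measurable_funD; exact: measurable_funM.
by apply/funext => t; case: (F t) (G t) => a b [].
Qed.

Lemma cmeasD F G : cmeas F -> cmeas G -> cmeas (fun t => F t + G t).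
Proof.
move=> [fr fi] [gr gi]; split.
  rewrite (_ : (fun _ => _) = (fun t => complex.Re (F t) + complex.Re (G t))).
    exact: measurable_funD.
  by apply/funext => t; case: (F t) (G t) => a b [].
rewrite (_ : (fun _ => _) = (fun t => complex.Im (F t) + complex.Im (G t))).
  exact: measurable_funD.
by apply/funext => t; case: (F t) (G t) => a b [].
Qed.

Lemma cmeas_cst z : cmeas (fun=> z).
Proof. by split; exact: measurable_cst. Qed.

Lemma cmeas_real h : measurable_fun setT h -> cmeas (fun t => (h t)%:C).
Proof. by move=> mh; split => //=; exact: measurable_cst. Qed.

Lemma cmeas_cis h : measurable_fun setT h -> cmeas (fun t => cis (h t)).
Proof.
move=> mh; split.
  exact: (measurableT_comp (continuous_measurable_fun (@continuous_cos R))).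
exact: (measurableT_comp (continuous_measurable_fun (@continuous_sin R))).
Qed.

Lemma cintg_meas F : cintg F -> cmeas F.
Proof.
by move=> [/integrableP[/measurable_EFinP ? _] /integrableP[/measurable_EFinP ? _]].
Qed.

Lemma le_integrableR h (G : T -> R) : measurable_fun setT h ->
  (forall x, `|h x| <= G x) -> mu.-integrable setT (EFin \o G) ->
  mu.-integrable setT (EFin \o h).
Proof.
move=> mh hG iG; apply: le_integrable iG => //.
  exact/measurable_EFinP.
by move=> x _ /=; rewrite lee_fin (le_trans (hG x))// ler_norm.
Qed.

Lemma integrable_scale (c : R) h : mu.-integrable setT (EFin \o h) ->
  mu.-integrable setT (EFin \o (fun t => c * h t)).
Proof. by move=> ih; have := integrableZl measurableT c ih. Qed.

Lemma integrable_add h1 h2 : mu.-integrable setT (EFin \o h1) ->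
  mu.-integrable setT (EFin \o h2) ->
  mu.-integrable setT (EFin \o (fun t => h1 t + h2 t)).
Proof. by move=> i1 i2; have := integrableD measurableT i1 i2. Qed.

Lemma cintg_dom F (G : T -> R) : cmeas F -> (forall x, cmod (F x) <= G x) ->
  mu.-integrable setT (EFin \o G) -> cintg F.
Proof.
move=> [fr fi] FG iG; split; apply: (le_integrableR (G := G)) => // x.
  exact: le_trans (Re_le_cmod _) _.
exact: le_trans (Im_le_cmod _) _.
Qed.

Lemma cintg_cmod F : cintg F -> mu.-integrable setT (EFin \o (fun t => cmod (F t))).
Proof.
move=> iF; have [ir ii] := iF.
have := integrableD measurableT (integrable_norm ir) (integrable_norm ii).
apply: (le_integrableR (G := fun t => `|complex.Re (F t)| + `|complex.Im (F t)|)).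
  exact/cmeas_cmod/cintg_meas.
by move=> x; rewrite ger0_norm ?cmod_ge0// cmod_le_ReIm.
Qed.

Lemma cintgD F G : cintg F -> cintg G -> cintg (fun t => F t + G t).
Proof.
move=> iF iG; apply: (cintg_dom (G := fun t => cmod (F t) + cmod (G t))).
- by apply: cmeasD; exact: cintg_meas.
- by move=> x; exact: le_normcD.
- exact: (integrableD measurableT (cintg_cmod iF) (cintg_cmod iG)).
Qed.

Lemma cintgMl z F : cintg F -> cintg (fun t => z * F t).
Proof.
move=> iF; apply: (cintg_dom (G := fun t => cmod z * cmod (F t))).
- by apply: cmeasM; [exact: cmeas_cst|exact: cintg_meas].
- by move=> x; rewrite cmodM.
- exact: (integrableZl measurableT (cmod z) (cintg_cmod iF)).
Qed.

Lemma cintD F G : cintg F -> cintg G ->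
  cint (fun t => F t + G t) = cint F + cint G.
Proof.
move=> [fr fi] [gr gi]; rewrite /cint; simpc; congr (_ +i* _).
  rewrite -RintegralD//; apply: eq_Rintegral => t _.
  by case: (F t) (G t) => ? ? [].
rewrite -RintegralD//; apply: eq_Rintegral => t _.
by case: (F t) (G t) => ? ? [].
Qed.

Lemma cintMl z F : cintg F -> cint (fun t => z * F t) = z * cint F.
Proof.
move=> [fr fi]; case: z => a b; rewrite /cint; simpc; congr (_ +i* _).
  rewrite -!RintegralZl// -RintegralB//; try exact: integrable_scale.
  by apply: eq_Rintegral => t _; case: (F t) => ? ?.
rewrite -!RintegralZl// -RintegralD//; try exact: integrable_scale.
by apply: eq_Rintegral => t _; case: (F t) => ? ?.
Qed.

Lemma eq_cint F G : F =1 G -> cint F = cint G.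
Proof. by move=> /funext ->. Qed.

Lemma cint0 : cint (fun=> 0) = 0.
Proof. by rewrite /cint /= !Rintegral_cst// mul0r. Qed.

(** The factor 2 replaces the sharp constant 1: only the order of magnitude of
    integrals matters for the theorem, and with a factor 2 the real and imaginary
    parts can be estimated separately. *)
Lemma cint_le_ae F (G : T -> R) : cintg F -> (forall x, 0 <= G x) ->
  mu.-integrable setT (EFin \o G) ->
  {ae mu, forall x, cmod (F x) <= G x} ->
  cmod (cint F) <= 2 * \int[mu]_x G x.
Proof.
move=> iF G0 iG FG; have [fr fi] := iF.
suff key (h : T -> R) : mu.-integrable setT (EFin \o h) ->
    {ae mu, forall x, `|h x| <= G x} -> `|\int[mu]_x h x| <= \int[mu]_x G x.
  rewrite mulr_natl mulr2n; apply: le_trans (cmod_le_ReIm _) _.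
  apply: lerD; apply: key => //; apply: filterS FG => x.
    exact/le_trans/Re_le_cmod.
  exact/le_trans/Im_le_cmod.
move=> ih hG; apply: le_trans (le_normr_Rintegral measurableT ih) _.
rewrite /Rintegral fine_le//.
- exact/integrable_fin_num/integrable_norm.
- exact: integrable_fin_num.
- have /integrableP[mh _] := integrable_norm ih.
  have /integrableP[mG _] := iG.
  apply: ae_ge0_le_integral => //.
  + by move=> x _; rewrite lee_fin.
  + by apply: filterS hG => x hx _; rewrite lee_fin.
Qed.

Lemma cint_le F (G : T -> R) : cmeas F -> (forall x, cmod (F x) <= G x) ->
  mu.-integrable setT (EFin \o G) -> cmod (cint F) <= 2 * \int[mu]_x G x.
Proof.
move=> mF FG iG; apply: cint_le_ae => //; first exact: cintg_dom iG.
- by move=> x; apply: le_trans (FG x); exact: cmod_ge0.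
- exact: aeW.
Qed.

End ComplexIntegral.

(** * Lebesgue measure on R^n *)

Section LebesgueRn.
Context {R : realType}.
Local Notation T n := (n.-tuple (measurableTypeR R)).

Definition cube n (k : nat) : set (T n) := [set t | forall j, `|tnth t j : R| < k%:R].
Arguments cube : clear implicits.

Lemma measurable_tnthR n (i : 'I_n) : measurable_fun setT (fun t : T n => tnth t i : R).
Proof. exact: measurable_tnth. Qed.

Lemma measurable_cube n k : measurable (cube n k).
Proof.
rewrite (_ : cube n k = \bigcap_(j in [set: 'I_n]) [set t : T n | `|tnth t j : R| < k%:R]).
  apply: fin_bigcap_measurable => // j _.
  have := measurable_tnthR j => /(_ measurableT (ball 0 k%:R)).
  rewrite setTI => h; have := h (measurable_ball _ _).
  congr measurable; apply/seteqP; split => t /=; rewrite /ball/= sub0r normrN//.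
by apply/seteqP; split => [t h j _|t h j]; [exact: h|exact: (h j)].
Qed.

Lemma lebesgue_cube_lty n k : (lebesgue_Rn n (cube n k) < +oo)%E.
Proof.
elim: n => [|n IH].
  by rewrite /= diracE ltry.
have -> : lebesgue_Rn n.+1 (cube n.+1 k) =
   (lebesgue_Rn n \x @lebesgue_measure R)%E (cube n k `*` ball 0 k%:R).
  rewrite [LHS]/=/lebesgue_step /pushforward; congr (product_measure1 _ _ _).
  apply/seteqP; split => -[t x] /=.
    move=> h; split=> [j|]; first by have := h (lift ord0 j); rewrite tnthS.
    by have := h ord0; rewrite tnth0 /ball /= sub0r normrN.
  rewrite /ball /= sub0r normrN => -[h1 h2] j.
  by case: (unliftP ord0 j) => [j' ->|->]; rewrite ?tnthS ?tnth0//; exact: h1.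
rewrite product_measure1E//; [|exact: measurable_cube|exact: measurable_ball].
rewrite lte_mul_pinfty//.
  by rewrite fin_num_abs gee0_abs.
by apply: (le_lt_trans (y := lebesgue_measure (ball (0:R) k%:R))) => //; rewrite lebesgue_measure_ball ?ltry.
Qed.

(** The theorems of Tonelli and Fubini need an explicit exhaustion; open cubes of
    half side k provide one. *)
Lemma lebesgue_Rn_sigma_finite n : sigma_finite setT (lebesgue_Rn (R := R) n).
Proof.
exists (cube n); last by move=> k; split; [exact: measurable_cube|exact: lebesgue_cube_lty].
apply/seteqP; split => // t _.
pose M := \sum_j `|tnth t j : R|.
have M0 : 0 <= M by apply: sumr_ge0 => *; exact: normr_ge0.
exists (Num.truncn M).+1 => //= j.
apply: (le_lt_trans (y := M)); last exact: truncnS_gt.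
by rewrite /M (bigD1 j)//= lerDl sumr_ge0.
Qed.

(** An opaque synonym of the Lebesgue measure: it carries the sigma-finite
    structure, and unification never unfolds the recursion on the dimension. *)
Definition Lb n : set (T n) -> \bar R := lebesgue_Rn n.
Arguments Lb : clear implicits.

HB.instance Definition _ n := Measure.on (Lb n).
HB.instance Definition _ n := Measure_isSigmaFinite.Build _ _ _ (Lb n) (@lebesgue_Rn_sigma_finite n).

Lemma ge0_integral_Rn0 (f : T 0 -> \bar R) : measurable_fun setT f ->
  (\int[Lb 0]_t f t = f [tuple])%E.
Proof. by move=> mf; rewrite /Lb/= integral_dirac// diracT mul1e. Qed.

Lemma ge0_integral_RnS n (f : T n.+1 -> \bar R) : measurable_fun setT f ->
  (forall t, 0 <= f t)%E ->
  (\int[Lb n.+1]_t f t = \int[Lb n]_t \int[@lebesgue_measure R]_x f (tuple_cons (t, x)))%E.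
Proof.
move=> mf f0.
rewrite -(fubini_tonelli1 (fun z => f (tuple_cons z)))//; last first.
  by apply: (measurableT_comp mf); exact: measurable_tuple_cons.
rewrite [LHS](_ : _ = \int[pushforward (Lb n \x @lebesgue_measure R) (@tuple_cons R n)]_t f t)%E//.
by rewrite (ge0_integral_pushforward (@measurable_tuple_cons R n)).
Qed.

Lemma cintegralE n (F : 'rV[R]_n -> R[i]) : cintegral F = cint (Lb n) (F \o @vec R n).
Proof. by []. Qed.

Lemma cintegrableE n (F : 'rV[R]_n -> R[i]) :
  cintegrable F = cintg (Lb n) (F \o @vec R n).
Proof. by []. Qed.

Lemma ess_sup_Lb n (f : T n -> \bar R) : ess_sup (lebesgue_Rn n) f = ess_sup (Lb n) f.
Proof. by []. Qed.

Opaque Lb.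

Definition unvec n (x : 'rV[R]_n) : T n := [tuple x 0 i | i < n].

Lemma vecE n (t : T n) i : vec t 0 i = tnth t i.
Proof. by rewrite mxE. Qed.

Lemma vecK n : cancel (@vec R n) (@unvec n).
Proof. by move=> t; apply: eq_from_tnth => i; rewrite tnth_mktuple vecE. Qed.

Lemma unvecK n : cancel (@unvec n) (@vec R n).
Proof. by move=> x; apply/rowP => i; rewrite vecE tnth_mktuple. Qed.

Lemma measurable_unvec d (S : measurableType d) n (h : S -> 'rV[R]_n) :
  (forall i, measurable_fun setT (fun s => h s 0 i)) ->
  measurable_fun setT (fun s => unvec (h s)).
Proof.
move=> mh; apply/measurable_fun_tnthP => i.
by apply: eq_measurable_fun (mh i) => s _ /=; rewrite tnth_mktuple.
Qed.

Lemma measurable_entry n i : measurable_fun setT (fun t : T n => vec t 0 i).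
Proof. by apply: eq_measurable_fun (measurable_tnthR i) => t _ /=; rewrite vecE. Qed.

(** Continuity in terms of coordinates, which is the form needed on tuples. *)
Lemma continuousP_entry n (f : 'rV[R]_n -> R) (x : 'rV[R]_n) :
  {for x, continuous f} <->
  (forall e : R, 0 < e -> exists2 d : R, 0 < d &
     forall y : 'rV[R]_n, (forall i, `|y 0 i - x 0 i| < d) -> `|f y - f x| < e).
Proof.
split=> [/cvgrPdist_lt cf e e0|h].
  have /nbhs_ballP[d /= d0 hd] := cf _ e0; exists d => // y hy.
  rewrite distrC; apply: hd; split => // i j.
  by rewrite /ball /= (ord1 i) distrC.
move=> A /nbhs_ballP[e /= e0 he]; have [d d0 hd] := h _ e0.
apply/nbhs_ballP; exists d => //= y [_ hy]; apply: he.
rewrite /ball /= distrC; apply: hd => i.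
by have := hy 0 i; rewrite /ball /= distrC.
Qed.

(** A continuous function on R^n is the pointwise limit of its values at grid
    points of mesh 1/(k+1), and those take only countably many values on
    measurable cells; this bypasses any comparison of the Borel sets of R^n with
    the product sigma-algebra. *)
Lemma continuous_measurable_vec n (f : 'rV[R]_n -> R) : continuous f ->
  measurable_fun setT (fun t : T n => f (vec t)).
Proof.
move=> cf.
pose h k (t : T n) := f (\row_i ((Num.floor (tnth t i * k.+1%:R))%:~R / k.+1%:R)).
have mh k : measurable_fun setT (h k).
  move=> _ Y mY; rewrite setTI.
  rewrite (_ : h k @^-1` Y = \bigcup_(q : 'rV[int]_n)
     if `[< Y (f (\row_i ((q 0 i)%:~R / k.+1%:R))) >]
     then \bigcap_(i in [set: 'I_n]) [set t : T n | Num.floor (tnth t i * k.+1%:R) = q 0 i]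
     else set0).
    apply: countable_bigcupT_measurable => [|q]; first exact: countableP.
    case: ifPn => // _; apply: fin_bigcap_measurable => // i _.
    rewrite (_ : [set _ | _] = (fun t : T n => tnth t i * k.+1%:R) @^-1`
        `[(q 0 i)%:~R, (q 0 i + 1)%:~R[%classic).
      rewrite -[X in measurable X]setTI; apply: (measurable_funM (measurable_tnthR i)) => //.
    apply/seteqP; split => t /=.
      by move=> <-; rewrite in_itv /= floor_le_tmp floorD1_gt.
    by rewrite in_itv /= => h12; apply: floor_def.
  apply/seteqP; split => t /=.
    move=> Yt; exists (\row_i Num.floor (tnth t i * k.+1%:R)) => //.
    case: asboolP => [_ i _ /=|]; first by rewrite mxE.
    case; move: Yt; rewrite /h.
    by congr (Y (f _)); apply/rowP => i; rewrite !mxE.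
  move=> [q _]; case: asboolP => // Yq hq.
  rewrite /h; move: Yq; congr (Y (f _)).
  by apply/rowP => i; rewrite !mxE hq.
apply: (measurable_fun_cvg (h := h)) => // t _.
apply/cvgrPdist_lt => e e0.
have /continuousP_entry/(_ _ e0)[d d0 hd] := cf (vec t).
near=> k; rewrite distrC; apply: hd => i; rewrite !mxE.
have k0 : 0 < k.+1%:R :> R by rewrite ltr0n.
rewrite -[X in _ - X](mulfK (lt0r_neq0 k0)) -mulrBl normrM (ger0_norm (x := _^-1)) ?invr_ge0 ?ltW//.
rewrite ltr_pdivrMr//.
have h1 := floor_le_tmp (tnth t i * k.+1%:R).
have h2 := floorD1_gt (tnth t i * k.+1%:R).
rewrite intrD in h2.
apply: (@le_lt_trans _ _ 1).
  rewrite ler_norml; apply/andP; split; lra.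
rewrite -ltr_pdivrMl// mulr1.
near: k.
exists (Num.truncn d^-1) => // m /= dm.
by apply: (lt_le_trans (truncnS_gt _)); rewrite ler_nat ltnS.
Unshelve. all: by end_near. Qed.

Local Open Scope ereal_scope.

Lemma ge0_integral_line_aff (f : R -> \bar R) (eps c : R) : (eps = 1 \/ eps = -1)%R ->
  measurable_fun setT f -> (forall x, 0 <= f x) ->
  \int[@lebesgue_measure R]_x f (eps * x + c)%R = \int[@lebesgue_measure R]_x f x.
Proof.
move=> e1 mf f0.
pose phi (x : measurableTypeR R) : measurableTypeR R := (eps * x + c)%R.
have mphi : measurable_fun setT phi.
  by apply: measurable_funD; [exact: measurable_funM|exact: measurable_cst].
rewrite [RHS](_ : _ = \int[pushforward (@lebesgue_measure R) phi]_x f x).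
  by rewrite (ge0_integral_pushforward mphi).
apply: eq_measure_integral => A mA _.
rewrite /=; apply: lebesgue_measure_unique => // _ [[a b]] _ <-.
rewrite /= /pushforward.
case: e1 => e1.
  rewrite (_ : phi @^-1` _ = `]a - c, b - c]%classic)%R; last first.
    by apply/seteqP; split => x /=; rewrite !in_itv /= /phi e1 mul1r; lra.
  rewrite !lebesgue_measure_itv /= !lte_fin ltrD2r; case: ifP => //.
  by rewrite -!EFinD => _; congr EFin; lra.
rewrite (_ : phi @^-1` _ = `[c - b, c - a[%classic)%R; last first.
  by apply/seteqP; split => x /=; rewrite !in_itv /= /phi e1 mulN1r; lra.
rewrite !lebesgue_measure_itv /= !lte_fin ltrD2l ltrN2; case: ifP => //.
by rewrite -!EFinD => _; congr EFin; lra.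
Qed.

Lemma vec_cons0 n (t : T n) (x : R) : vec (tuple_cons (t, x)) 0%R ord0 = x.
Proof. by rewrite vecE tnth0. Qed.

Lemma vec_consS n (t : T n) (x : R) i :
  vec (tuple_cons (t, x)) 0%R (lift ord0 i) = vec t 0%R i.
Proof. by rewrite !vecE tnthS. Qed.

Lemma unvec_row n (x : R) (y : 'rV[R]_n) (z : 'rV[R]_n.+1) :
  z 0%R ord0 = x -> (forall i, z 0%R (lift ord0 i) = y 0%R i) ->
  unvec z = tuple_cons (unvec y, x).
Proof.
move=> zx zy; apply: (can_inj (@vecK _)); rewrite unvecK; apply/rowP => i.
by case: (unliftP ord0 i) => [j ->|->]; rewrite ?vec_cons0 ?vec_consS ?unvecK.
Qed.

(** Isometries x |-> +/- x + a; tuples carry no additive structure, hence the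
    detour through row vectors. *)
Definition aff n (eps : R) (a : 'rV[R]_n) (t : T n) : T n :=
  unvec (eps *: vec t + a)%R.

Lemma measurable_aff n eps a : measurable_fun setT (@aff n eps a).
Proof.
apply: measurable_unvec => i.
rewrite (_ : (fun _ => _) = (fun s : T n => eps * vec s 0 i + a 0 i))%R.
  apply: measurable_funD; last exact: measurable_cst.
  by apply: measurable_funM; [exact: measurable_cst|exact: measurable_entry].
by apply/funext => s; rewrite !mxE.
Qed.

Lemma measurable_cons1 n (t : T n) : measurable_fun setT (fun x : measurableTypeR R => tuple_cons (t, x)).
Proof. by apply: (measurableT_comp (@measurable_tuple_cons R n)); exact: measurable_fun_pair. Qed.

Lemma ge0_integral_aff n (eps : R) (a : 'rV[R]_n) (f : T n -> \bar R) :
  (eps = 1 \/ eps = -1)%R -> measurable_fun setT f -> (forall t, 0 <= f t) ->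
  \int[Lb n]_t f (aff eps a t) = \int[Lb n]_t f t.
Proof.
move=> e1; elim: n a f => [|n IH] a f mf f0.
  by congr (integral _ _ _); apply/funext => t; rewrite (tuple0 t) (tuple0 (aff _ _ _)).
have mfa := measurableT_comp mf (measurable_aff eps a).
pose a0 := a 0%R ord0; pose a' := (\row_i a 0 (lift ord0 i))%R.
have affE t x : aff eps a (tuple_cons (t, x)) = tuple_cons (aff eps a' t, eps * x + a0)%R.
  apply: unvec_row; first by rewrite !mxE tnth0.
  by move=> i; rewrite !mxE tnthS.
rewrite (ge0_integral_RnS mfa); last by move=> t; exact: f0.
rewrite (ge0_integral_RnS mf f0).
pose F (t : T n) := \int[@lebesgue_measure R]_x f (tuple_cons (t, x)).
have mF : measurable_fun setT F.
  apply: (measurable_fun_fubini_tonelli_F (fun z => f (tuple_cons z))) => //.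
  by apply: (measurableT_comp mf); exact: measurable_tuple_cons.
have F0 t : 0 <= F t by apply: integral_ge0.
rewrite -[RHS](IH a' F mF F0); apply: eq_integral => t _.
rewrite /comp; under eq_integral do rewrite affE.
apply: (ge0_integral_line_aff (f := fun y => f (tuple_cons (aff eps a' t, y)))) => //.
by apply: (measurableT_comp mf); exact: measurable_cons1.
Qed.

Lemma ge0_integral_Rn_prod n (h : R -> R) : measurable_fun setT h ->
  (forall x, 0 <= h x)%R -> (@lebesgue_measure R).-integrable setT (EFin \o h) ->
  \int[Lb n]_t (\prod_i h (vec t 0 i))%:E =
  ((\int[@lebesgue_measure R]_x h x) ^+ n)%:E.
Proof.
move=> mh h0 ih; elim: n => [|n IH].
  under eq_integral do rewrite big_ord0.
  by rewrite ge0_integral_Rn0// expr0.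
have mp m : measurable_fun setT (fun t : T m => \prod_i h (vec t 0 i))%R.
  apply: measurable_prod => i _.
  by apply: (measurableT_comp mh); exact: measurable_entry.
have p0 m (t : T m) : (0 <= \prod_i h (vec t 0 i))%R by exact: prodr_ge0.
rewrite ge0_integral_RnS; last 2 first.
- by apply/measurable_EFinP; exact: mp.
- by move=> t; rewrite lee_fin.
transitivity (\int[Lb n]_t ((\int[@lebesgue_measure R]_x h x)%:E * (\prod_i h (vec t 0 i))%:E)).
  apply: eq_integral => t _.
  under eq_integral => x _.
    rewrite big_ord_recl vec_cons0.
    under eq_bigr do rewrite vec_consS.
    rewrite EFinM; over.
  rewrite integralZr//= fineK//.
  exact: integrable_fin_num.
rewrite ge0_integralZl//; last 3 first.
- by apply/measurable_EFinP; exact: mp.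
- by move=> t _; rewrite lee_fin.
- by rewrite lee_fin Rintegral_ge0.
by rewrite IH -EFinM exprS.
Qed.

End LebesgueRn.

Arguments Lb {R} n _.

(** * Changes of variables, decay and sections *)

Section IntegralRn.
Context {R : realType}.
Local Notation T n := (n.-tuple (measurableTypeR R)).

Lemma vec_aff n eps (a : 'rV[R]_n) (t : T n) : vec (aff eps a t) = eps *: vec t + a.
Proof. by rewrite /aff unvecK. Qed.

Lemma Rintegral_aff n (eps : R) (a : 'rV[R]_n) (h : T n -> R) :
  (eps = 1 \/ eps = -1) -> (Lb n).-integrable setT (EFin \o h) ->
  (Lb n).-integrable setT (EFin \o (h \o aff eps a)) /\
  \int[Lb n]_t h (aff eps a t) = \int[Lb n]_t h t.
Proof.
move=> e1 ih; have /integrableP[mh hoo] := ih; split.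
  apply/integrableP; split.
    by apply: (measurableT_comp mh); exact: measurable_aff.
  rewrite (_ : (integral _ _ _) = \int[Lb n]_t `|(h (aff eps a t))%:E|)%E//.
  rewrite (ge0_integral_aff a (f := fun t => `|(h t)%:E|%E))//.
  exact: measurableT_comp.
rewrite /Rintegral; congr fine; rewrite [LHS]integralE [RHS]integralE.
congr (_ - _)%E.
  rewrite -(ge0_integral_aff a (f := ((EFin \o h)^\+)%E) e1)//; last exact: measurable_funepos.
  by apply: eq_integral => t _; rewrite !funeposE.
rewrite -(ge0_integral_aff a (f := ((EFin \o h)^\-)%E) e1)//; last exact: measurable_funeneg.
by apply: eq_integral => t _; rewrite !funenegE.
Qed.

Lemma cint_aff n (eps : R) (a : 'rV[R]_n) (F : 'rV[R]_n -> R[i]) :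
  (eps = 1 \/ eps = -1) -> cintg (Lb n) (fun t => F (vec t)) ->
  cintg (Lb n) (fun t => F (eps *: vec t + a)) /\
  cint (Lb n) (fun t => F (eps *: vec t + a)) = cint (Lb n) (fun t => F (vec t)).
Proof.
move=> e1 [ir ii].
have [ir' er] := Rintegral_aff a e1 ir; have [ii' ei] := Rintegral_aff a e1 ii.
split.
  split; [apply: eq_integrable ir'|apply: eq_integrable ii'] => // t _ /=;
    by rewrite vec_aff.
rewrite /cint; congr (_ +i* _); [rewrite -er|rewrite -ei];
  by apply: eq_Rintegral => t _; rewrite vec_aff.
Qed.

(** The inverse of this weight is the integrable majorant for all the integrals
    over R^n; a product over coordinates makes its integral a product of integrals
    over the line. *)
Definition jap n (x : 'rV[R]_n) : R := \prod_i (1 + x 0 i ^+ 2).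

Lemma jap_gt0 n (x : 'rV[R]_n) : 0 < jap x.
Proof. by apply: prodr_gt0 => i _; rewrite ltr_wpDr ?sqr_ge0. Qed.

Lemma jap_ge1 n (x : 'rV[R]_n) : 1 <= jap x.
Proof.
rewrite /jap; elim/big_ind: _ => [//|a b a1 b1|i _]; first by rewrite -[1]mulr1 ler_pM.
by rewrite lerDl sqr_ge0.
Qed.

(** In one variable, 1 + (a - b)^2 <= 2 (1 + a^2) (1 + b^2). *)
Lemma jap_sub n (x y : 'rV[R]_n) : jap (x - y) <= 2 ^+ n * jap x * jap y.
Proof.
rewrite /jap (_ : 2 ^+ n = \prod_(i < n) 2); last by rewrite prodr_const card_ord.
rewrite -!big_split /=.
apply: ler_prod => i _; rewrite !mxE; apply/andP; split.
  by rewrite addr_ge0 ?sqr_ge0.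
by nra.
Qed.

Lemma integrable_line : (@lebesgue_measure R).-integrable setT
  (EFin \o (fun x : R => (1 + x ^+ 2)^-1)).
Proof.
have c : continuous (fun x : R => (oneDsqr x)^-1) := @continuous_oneDsqrV R.
apply/integrableP; split.
  by apply/measurable_EFinP; exact: continuous_measurable_fun.
under eq_integral => x _.
  rewrite /= ger0_norm ?invr_ge0 ?addr_ge0 ?sqr_ge0// -[1 + _]/(oneDsqr x); over.
rewrite ge0_symfun_integralT//.
- rewrite (_ : [set x | _] = `[0, +oo[%classic); last first.
    by apply/seteqP; split => x/=; rewrite in_itv/= andbT.
  by rewrite integral0y_oneDsqr -EFinM ltry.
- by move=> x /=; rewrite /oneDsqr sqrrN.
Qed.

Lemma measurable_japV n : measurable_fun setT (fun t : T n => (jap (vec t))^-1).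
Proof.
rewrite (_ : (fun _ => _) = (fun t : T n => \prod_i (1 + vec t 0 i ^+ 2)^-1)).
  apply: measurable_prod => i _.
  have m1 : measurable_fun setT (fun x : R => (1 + x ^+ 2)^-1).
    exact: continuous_measurable_fun (@continuous_oneDsqrV R).
  by apply: (measurableT_comp m1); exact: measurable_entry.
by apply/funext => t; rewrite /jap prodfV.
Qed.

Lemma ge0_integrableR d (S : measurableType d) (mu : {measure set S -> \bar R}) (h : S -> R) :
  measurable_fun setT h -> (forall x, 0 <= h x) -> (\int[mu]_x (h x)%:E < +oo)%E ->
  mu.-integrable setT (EFin \o h).
Proof.
move=> mh h0 oo; apply/integrableP; split; first exact/measurable_EFinP.
by under eq_integral do rewrite /= ger0_norm//.
Qed.

Lemma integrable_japV n : (Lb n).-integrable setT (EFin \o (fun t : T n => (jap (vec t))^-1)).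
Proof.
apply: ge0_integrableR => //.
- exact: measurable_japV.
- by move=> t; rewrite invr_ge0 ltW// jap_gt0.
under eq_integral do rewrite /jap -prodfV.
rewrite (ge0_integral_Rn_prod n (h := fun x : R => (1 + x ^+ 2)^-1)) ?ltry//.
- exact: continuous_measurable_fun (@continuous_oneDsqrV R).
- by move=> x; rewrite invr_ge0 addr_ge0 ?sqr_ge0.
- exact: integrable_line.
Qed.

Definition japint n : R := \int[Lb n]_t (jap (vec t))^-1.

Lemma japint_ge0 n : 0 <= japint n.
Proof. by apply: Rintegral_ge0 => t _; rewrite invr_ge0 ltW// jap_gt0. Qed.

Lemma japV_shift n (a x : 'rV[R]_n) : (jap (a + x))^-1 <= 2 ^+ n * jap a * (jap x)^-1.
Proof.
rewrite ler_pdivlMr ?jap_gt0// ler_pdivrMl ?jap_gt0//.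
have := jap_sub (a + x) a; rewrite addrAC subrr add0r => h.
by apply: le_trans h _; apply: eq_lerW; ring.
Qed.

Lemma japV_aff n (eps : R) (a : 'rV[R]_n) : (eps = 1 \/ eps = -1) ->
  (Lb n).-integrable setT (EFin \o (fun t : T n => (jap (eps *: vec t + a))^-1)) /\
  \int[Lb n]_t (jap (eps *: vec t + a))^-1 = japint n.
Proof.
move=> e1; have [ih eh] := Rintegral_aff a e1 (integrable_japV n).
split; first by apply: eq_integrable ih => // t _ /=; rewrite vec_aff.
by rewrite /japint -eh; apply: eq_Rintegral => t _; rewrite vec_aff.
Qed.

Definition tcat m n (u : T m) (v : T n) : T (m + n) := unvec (row_mx (vec u) (vec v)).

Lemma vec_tcat m n (u : T m) (v : T n) : vec (tcat u v) = row_mx (vec u) (vec v).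
Proof. exact: unvecK. Qed.

Lemma measurable_tcat m n : measurable_fun setT (fun z : T m * T n => tcat z.1 z.2).
Proof.
apply: measurable_unvec => i; rewrite -(splitK i) /unsplit.
case: (fintype.split i) => j /=.
  rewrite (_ : (fun _ => _) = (fun z : T m * T n => vec z.1 0 j)).
    by apply: (measurableT_comp (measurable_entry j)); exact: measurable_fst.
  by apply/funext => z; rewrite row_mxEl.
rewrite (_ : (fun _ => _) = (fun z : T m * T n => vec z.2 0 j)).
  by apply: (measurableT_comp (measurable_entry j)); exact: measurable_snd.
by apply/funext => z; rewrite row_mxEr.
Qed.

Lemma measurable_tcat2 m n (u : T m) : measurable_fun setT (fun v : T n => tcat u v).
Proof. by have := measurableT_comp (@measurable_tcat m n) (measurable_pair1 u). Qed.

Lemma tcat_cons m n (u : T m) (x : R) (v : T n) :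
  tcat (tuple_cons (u, x)) v = tuple_cons (tcat u v, x) :> T (m.+1 + n).
Proof.
apply: unvec_row => [|i].
  rewrite (_ : ord0 = lshift n ord0 :> 'I_(m.+1 + n)); last exact: val_inj.
  by apply: etrans (vec_cons0 u x); exact: (row_mxEl (vec _) (vec v) 0 ord0).
rewrite -(splitK i) /unsplit; case: (fintype.split i) => j.
  rewrite (_ : lift ord0 (lshift n j) = lshift n (lift ord0 j) :> 'I_(m.+1 + n)); last exact: val_inj.
  rewrite row_mxEl -(vec_consS u x).
  exact: (row_mxEl (vec _) (vec v) 0 (lift ord0 j)).
rewrite (_ : lift ord0 (rshift m j) = rshift m.+1 j :> 'I_(m.+1 + n)); last exact: val_inj.
rewrite row_mxEr; exact: (row_mxEr (vec _) (vec v) 0 j).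
Qed.

Local Open Scope ereal_scope.

Lemma ge0_integral_split m n (f : T (m + n) -> \bar R) : measurable_fun setT f ->
  (forall t, 0 <= f t) ->
  \int[Lb (m + n)]_t f t = \int[Lb m]_u \int[Lb n]_v f (tcat u v).
Proof.
elim: m f => [|m IH] f mf f0.
  have mft : measurable_fun setT (fun u : T 0 => \int[Lb n]_v f (tcat u v)).
    apply: (measurable_fun_fubini_tonelli_F (fun z : T 0 * T n => f (tcat z.1 z.2))) => //.
    by apply: (measurableT_comp mf); exact: measurable_tcat.
  rewrite [RHS](ge0_integral_Rn0 mft); apply: eq_integral => t _.
  congr f; apply: (can_inj (@vecK _ _)); rewrite vec_tcat.
  by apply/rowP => i; rewrite -[X in row_mx _ _ _ X](_ : rshift 0 i = i) ?row_mxEr//; exact: val_inj.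
have mF : measurable_fun setT (fun t : T m.+1 => \int[Lb n]_v f (tcat t v)).
  apply: (measurable_fun_fubini_tonelli_F (fun z : T m.+1 * T n => f (tcat z.1 z.2))) => //.
  by apply: (measurableT_comp mf); exact: measurable_tcat.
have F0 (t : T m.+1) : 0 <= \int[Lb n]_v f (tcat t v) by apply: integral_ge0.
rewrite [RHS](ge0_integral_RnS mF F0).
rewrite [LHS](ge0_integral_RnS (n := m + n) mf f0).
have mG : measurable_fun setT (fun t : T (m + n) => \int[@lebesgue_measure R]_x f (tuple_cons (t, x))).
  apply: (measurable_fun_fubini_tonelli_F (fun z => f (tuple_cons z))) => //.
  by apply: (measurableT_comp mf); exact: measurable_tuple_cons.
have G0 (t : T (m + n)) : 0 <= \int[@lebesgue_measure R]_x f (tuple_cons (t, x)) by apply: integral_ge0.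
rewrite (IH _ mG G0); apply: eq_integral => u _.
rewrite [RHS](_ : _ = \int[lebesgue_measure]_x \int[Lb n]_v f (tuple_cons (tcat u v, x))); last first.
  by apply: eq_integral => x _; apply: eq_integral => v _; rewrite tcat_cons.
rewrite (fubini_tonelli (fun z : T n * measurableTypeR R => f (tuple_cons (tcat u z.1, z.2))))//.
apply: (measurableT_comp mf).
apply: (measurableT_comp (@measurable_tuple_cons R (m + n))).
apply: measurable_fun_pair; last exact: measurable_snd.
by apply: (measurableT_comp (measurable_tcat2 u)); exact: measurable_fst.
Qed.

Lemma ge0_integral_eq0_ae d (S : measurableType d) (mu : {measure set S -> \bar R})
    (f : S -> \bar R) : measurable_fun setT f -> (forall x, 0 <= f x) ->
  \int[mu]_x f x = 0 -> {ae mu, forall x, f x = 0}.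
Proof.
move=> mf f0 if0.
have /(ae_eq_integral_abs _ measurableT mf) : \int[mu]_x `|f x| = 0.
  by rewrite -if0; apply: eq_integral => x _; rewrite gee0_abs.
by apply: filterS => x; apply.
Qed.

(** A null set of R^(m+n) has null sections over almost every point of R^m, by
    Tonelli applied to its indicator function. *)
Lemma ae_section m n (P : T (m + n) -> Prop) : {ae Lb (m + n), forall t, P t} ->
  {ae Lb m, forall u, {ae Lb n, forall v, P (tcat u v)}}.
Proof.
move=> [N [mN N0 PN]].
have mI : measurable_fun setT (fun t : T (m + n) => (\1_N t : R)%:E).
  by apply/measurable_EFinP; exact: measurable_indic.
have mI2 : measurable_fun setT (fun z : T m * T n => (\1_N (tcat z.1 z.2) : R)%:E).
  by apply: (measurableT_comp mI); exact: measurable_tcat.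
have I0 (t : T (m + n)) : 0 <= (\1_N t : R)%:E by rewrite lee_fin.
have : \int[Lb m]_u \int[Lb n]_v (\1_N (tcat u v) : R)%:E = 0.
  by rewrite -(ge0_integral_split mI I0) integral_indic// setIT.
move/ge0_integral_eq0_ae => H.
have {H} := H (measurable_fun_fubini_tonelli_F _ mI2 (fun z => I0 _))
   (fun u => integral_ge0 _ (fun v _ => I0 _)).
apply: filterS => u; move/ge0_integral_eq0_ae => H.
have {H} := H (measurableT_comp mI2 (measurable_pair1 u)) (fun v => I0 _).
apply: filterS => v; rewrite indicE => h; apply: contrapT => nP.
have /mem_set Nuv := PN _ nP.
by move: h; rewrite Nuv => /eqP; rewrite eqe oner_eq0.
Qed.

End IntegralRn.

(** * Partial derivatives of complex-valued functions *)

Section HasPd.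
Context {R : realType} {n : nat}.
Local Notation V := 'rV[R]_n.
Implicit Types (f g : V -> R[i]) (x a : V) (i : 'I_n).

(** A directional derivative is an ordinary derivative along a line, where the
    chain rule and the mean value theorem are available. *)
Lemma is_derive_line (f : V -> R) (x v : V) (h0 l : R) :
  is_derive (h0 *: v + x) v f l <-> is_derive h0 1 (fun h : R => f (h *: v + x)) l.
Proof.
have E : (fun h : R => h^-1 *: ((f \o shift (h0 *: v + x)) (h *: v) - f (h0 *: v + x))) =
  (fun h : R => h^-1 *: (((fun h : R => f (h *: v + x)) \o shift h0) (h *: 1) - f (h0 *: v + x))).
  by apply/funext => h /=; rewrite scaler1 scalerDl addrA.
split => -[h1 h2]; split.
- by move: h1; rewrite /derivable E.
- by move: h2; rewrite /derive E.
- by move: h1; rewrite /derivable E.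
- by move: h2; rewrite /derive E.
Qed.

Lemma is_derive_ext (f g : V -> R) x v l m : is_derive x v f l ->
  f =1 g -> l = m -> is_derive x v g m.
Proof. by move=> h /funext <- <-. Qed.

Lemma is_derive_comp1 (phi : R -> R) (f : V -> R) (x v : V) (l m : R) :
  is_derive x v f l -> is_derive (f x) 1 phi m ->
  is_derive x v (phi \o f) (m * l).
Proof.
move=> hf hphi; have hf' : is_derive (0 *: v + x) v f l by rewrite scale0r add0r.
have h1 := (is_derive_line f x v 0 l).1 hf'.
suff : is_derive (0 *: v + x) v (phi \o f) (m * l) by rewrite scale0r add0r.
apply/is_derive_line.
have := @is_derive1_comp R phi (fun h : R => f (h *: v + x)) 0 m l.
by rewrite scale0r add0r; apply.
Qed.

(** Existence and value in one statement: each rule of calculus below then yields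
    differentiability and the formula for the derivative at once. *)
Definition has_pd i f x (l : R[i]) : Prop :=
  is_derive x (delta_mx 0 i) (fun y => complex.Re (f y)) (complex.Re l) /\
  is_derive x (delta_mx 0 i) (fun y => complex.Im (f y)) (complex.Im l).

Lemma has_pd_pderiv i f x l : has_pd i f x l -> pderiv i f x = l.
Proof. by move=> [h1 h2]; rewrite /pderiv !derive_val; case: l {h1 h2}. Qed.

Definition pdiff i f x : Prop :=
  derivable (fun y => complex.Re (f y)) x (delta_mx 0 i) /\
  derivable (fun y => complex.Im (f y)) x (delta_mx 0 i).

Lemma has_pd_pdiff i f x l : has_pd i f x l -> pdiff i f x.
Proof. by move=> [h1 h2]; split; exact: ex_derive. Qed.

Lemma pdiff_has_pd i f x : pdiff i f x -> has_pd i f x (pderiv i f x).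
Proof. by move=> [h1 h2]; split; exact: derivableP. Qed.

Lemma has_pdD i f g x l m : has_pd i f x l -> has_pd i g x m ->
  has_pd i (fun y => f y + g y) x (l + m).
Proof.
move=> [f1 f2] [g1 g2]; split.
  apply: (is_derive_ext (is_deriveD f1 g1)) => [y|].
    by rewrite !fctE; case: (f y) (g y) => ? ? [].
  by case: l m {f1 f2 g1 g2} => ? ? [].
apply: (is_derive_ext (is_deriveD f2 g2)) => [y|].
  by rewrite !fctE; case: (f y) (g y) => ? ? [].
by case: l m {f1 f2 g1 g2} => ? ? [].
Qed.

Lemma has_pdM i f g x l m : has_pd i f x l -> has_pd i g x m ->
  has_pd i (fun y => f y * g y) x (l * g x + f x * m).
Proof.
move=> [f1 f2] [g1 g2]; split.
  apply: (is_derive_ext (is_deriveB (is_deriveM f1 g1) (is_deriveM f2 g2))) => [y|].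
    by rewrite !fctE; case: (f y) (g y) => ? ? [].
  case: l m {f1 f2 g1 g2} (f x) (g x) => ? ? [? ?] [? ?] [? ?].
  by rewrite /GRing.scale /=; ring.
apply: (is_derive_ext (is_deriveD (is_deriveM f1 g2) (is_deriveM f2 g1))) => [y|].
  by rewrite !fctE; case: (f y) (g y) => ? ? [].
case: l m {f1 f2 g1 g2} (f x) (g x) => ? ? [? ?] [? ?] [? ?].
by rewrite /GRing.scale /=; ring.
Qed.

Lemma has_pd_cst i z x : has_pd i (fun=> z) x 0.
Proof. by split; exact: is_derive_cst. Qed.

Lemma has_pdMl i z f x l : has_pd i f x l -> has_pd i (fun y => z * f y) x (z * l).
Proof. by move=> h; have := has_pdM (has_pd_cst i z x) h; rewrite mul0r add0r. Qed.

Lemma has_pdJ i f x l : has_pd i f x l -> has_pd i (fun y => conjc (f y)) x (conjc l).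
Proof.
move=> [f1 f2]; split.
  by apply: (is_derive_ext f1) => [y|]; [case: (f y)|case: l {f1 f2}].
by apply: (is_derive_ext (is_deriveN f2)) => [y|]; [rewrite !fctE; case: (f y)|case: l {f1 f2}].
Qed.

Lemma is_derive_coord (x : V) i j :
  is_derive x (delta_mx 0 i) (fun y : V => y 0 j) (j == i)%:R.
Proof.
suff : is_derive (0 *: delta_mx 0 i + x) (delta_mx 0 i) (fun y : V => y 0 j) (j == i)%:R.
  by rewrite scale0r add0r.
apply/is_derive_line.
rewrite (_ : (fun _ => _) = (fun h : R => h * (j == i)%:R + x 0 j)); last first.
  by apply/funext => h; rewrite !mxE eqxx.
by apply: is_derive_eq; rewrite /GRing.scale /= addr0 mulr1 mulr0 add0r.
Qed.

Lemma has_pd_coord i j x : has_pd i (fun y => (y 0 j)%:C) x (j == i)%:R%:C.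
Proof. by split; [exact: is_derive_coord|exact: is_derive_cst]. Qed.

Lemma has_pd_cis i (phi : V -> R) x l : is_derive x (delta_mx 0 i) phi l ->
  has_pd i (fun y => cis (phi y)) x ('i * l%:C * cis (phi x)).
Proof.
move=> h; split.
  have := is_derive_comp1 h (is_derive_cos (phi x)); congr (is_derive _ _ _ _).
  by rewrite /cis; simpc; rewrite /=; ring.
have := is_derive_comp1 h (is_derive_sin (phi x)); congr (is_derive _ _ _ _).
by rewrite /cis; simpc; rewrite /=; ring.
Qed.

Lemma has_pd_aff i f x (c : R) a l : has_pd i f (a + c *: x) l ->
  has_pd i (fun y => f (a + c *: y)) x (c%:C * l).
Proof.
move=> [h1 h2].
have key (F : V -> R) (m : R) : is_derive (a + c *: x) (delta_mx 0 i) F m ->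
    is_derive x (delta_mx 0 i) (fun y => F (a + c *: y)) (c * m).
  move=> h; suff : is_derive (0 *: delta_mx 0 i + x) (delta_mx 0 i) (fun y => F (a + c *: y)) (c * m).
    by rewrite scale0r add0r.
  apply/is_derive_line.
  rewrite (_ : (fun _ => _) = (fun k : R => F (k *: delta_mx 0 i + (a + c *: x))) \o (fun h => c * h)); last first.
    by apply/funext => k /=; congr F; rewrite scalerDr scalerA addrCA.
  rewrite [c * m]mulrC.
  apply: is_derive1_comp; last by apply: is_derive_eq; rewrite /GRing.scale /= mulr1.
  by apply/is_derive_line; rewrite mulr0 scale0r add0r.
split.
  by have := key _ _ h1; congr (is_derive _ _ _ _); case: l {h1 h2} => ? ?; simpc.
by have := key _ _ h2; congr (is_derive _ _ _ _); case: l {h1 h2} => ? ?; simpc.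
Qed.

End HasPd.

(** * Smooth functions, mixed partial derivatives *)

Section Smooth.
Context {R : realType} {n : nat}.
Local Notation V := 'rV[R]_n.
Implicit Types (f g : V -> R[i]) (x : V) (i : 'I_n) (a b z : R[i]).

Definition ccont f := continuous (fun x => complex.Re (f x)) /\
  continuous (fun x => complex.Im (f x)).

Lemma continuous_ext (F G : V -> R) : F =1 G -> continuous F -> continuous G.
Proof. by move=> /funext ->. Qed.
Arguments continuous_ext : clear implicits.

Lemma contM (F G : V -> R) : continuous F -> continuous G -> continuous (fun x => F x * G x).
Proof. by move=> cF cG x; exact: (continuousM (@cF x) (@cG x)). Qed.

Lemma contD (F G : V -> R) : continuous F -> continuous G -> continuous (fun x => F x + G x).
Proof. by move=> cF cG x; exact: (continuousD (@cF x) (@cG x)). Qed.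

Lemma contN (F : V -> R) : continuous F -> continuous (fun x => - F x).
Proof. by move=> cF x; exact: (continuousN (@cF x)). Qed.

Lemma cont_cst (k : R) : continuous ((fun=> k) : V -> R).
Proof. exact: (@cst_continuous V R k). Qed.

Lemma ccontM f g : ccont f -> ccont g -> ccont (fun x => f x * g x).
Proof.
move=> [f1 f2] [g1 g2]; split.
  apply: (continuous_ext _ _ _ (contD (contM f1 g1) (contN (contM f2 g2)))) => y.
  by case: (f y) (g y) => ? ? [].
apply: (continuous_ext _ _ _ (contD (contM f1 g2) (contM f2 g1))) => y.
by case: (f y) (g y) => ? ? [].
Qed.

Lemma ccontD f g : ccont f -> ccont g -> ccont (fun x => f x + g x).
Proof.
move=> [f1 f2] [g1 g2]; split.
  by apply: (continuous_ext _ _ _ (contD f1 g1)) => y; case: (f y) (g y) => ? ? [].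
by apply: (continuous_ext _ _ _ (contD f2 g2)) => y; case: (f y) (g y) => ? ? [].
Qed.

Lemma ccont_cst z : ccont (fun=> z).
Proof. by split; exact: cont_cst. Qed.

Lemma ccontJ f : ccont f -> ccont (fun x => conjc (f x)).
Proof.
move=> [f1 f2]; split; first by apply: (continuous_ext _ _ _ f1) => y; case: (f y).
by apply: (continuous_ext _ _ _ (contN f2)) => y; case: (f y).
Qed.

(** Smoothness sealed in an inductive type: comparing two statements of
    smoothness then never unfolds iterated derivatives. *)
Variant Cinf f : Prop := MkCinf of smooth f.

Lemma CinfE f : Cinf f <-> smooth f.
Proof. by split=> [[]|]. Qed.

Lemma smoothP f : Cinf f <->
  [/\ ccont f, (forall i x, pdiff i f x) & forall i, Cinf (pderiv i f)].
Proof.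
split=> [[sf]|[[c1 c2] df sf]].
  split; [by have [] := sf [::]|by have [_ _] := sf [::]|move=> i; split=> s].
  by have := sf (rcons s i); rewrite foldr_rcons.
split=> s; case/lastP: s => [//|s i]; rewrite foldr_rcons.
by case: (sf i) => /(_ s).
Qed.

Lemma smooth_ccont f : Cinf f -> ccont f.
Proof. by move=> /smoothP[]. Qed.

Lemma smooth_pdiff f i x : Cinf f -> pdiff i f x.
Proof. by move=> /smoothP[]. Qed.

Lemma smooth_has_pd f i x : Cinf f -> has_pd i f x (pderiv i f x).
Proof. by move=> sf; exact/pdiff_has_pd/smooth_pdiff. Qed.

Lemma smooth_pderiv f i : Cinf f -> Cinf (pderiv i f).
Proof. by move=> /smoothP[]. Qed.

Inductive lspan (E : set (V -> R[i])) : (V -> R[i]) -> Prop :=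
| lspan_in f : E f -> lspan E f
| lspan_comb a b f g : lspan E f -> lspan E g -> lspan E (fun x => a * f x + b * g x).

Lemma lspanZ E a f : lspan E f -> lspan E (fun x => a * f x).
Proof.
move=> h; rewrite (_ : (fun _ => _) = (fun x => a * f x + 0 * f x)).
  exact: lspan_comb.
by apply/funext => x; rewrite mul0r addr0.
Qed.

Lemma lspanD E f g : lspan E f -> lspan E g -> lspan E (fun x => f x + g x).
Proof.
move=> h1 h2; rewrite (_ : (fun _ => _) = (fun x => 1 * f x + 1 * g x)).
  exact: lspan_comb.
by apply/funext => x; rewrite !mul1r.
Qed.

Lemma pderiv_eq f g i : (forall x, has_pd i f x (g x)) -> pderiv i f = g.
Proof. by move=> h; apply/funext => x; exact: has_pd_pderiv. Qed.

(** Smoothness is established without computing iterated derivatives: it is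
    enough that f lies in a family of continuous functions whose first partial
    derivatives are linear combinations of members of the family. *)
Lemma smooth_family (E : set (V -> R[i])) :
  (forall f, E f -> ccont f) -> (forall f i x, E f -> pdiff i f x) ->
  (forall f i, E f -> lspan E (pderiv i f)) -> forall f, E f -> Cinf f.
Proof.
move=> cE dE sE.
have comb_pd a b f g i x : pdiff i f x -> pdiff i g x ->
    has_pd i (fun x => a * f x + b * g x) x (a * pderiv i f x + b * pderiv i g x).
  by move=> df dg; apply: has_pdD; apply: has_pdMl; exact: pdiff_has_pd.
have key f : lspan E f -> [/\ ccont f, (forall i x, pdiff i f x) &
    forall i, lspan E (pderiv i f)].
  elim=> {f} [f Ef|a b f g _ [cf df sf] _ [cg dg sg]].
    by split; [exact: cE|move=> i x; exact: dE|move=> i; exact: sE].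
  split=> [|i x|i].
  - by apply: ccontD; apply: ccontM => //; exact: ccont_cst.
  - by apply: has_pd_pdiff; apply: comb_pd.
  - rewrite (pderiv_eq (g := fun x => a * pderiv i f x + b * pderiv i g x)).
      exact: lspan_comb.
    by move=> x; exact: comb_pd.
move=> f Ef; split=> s.
have : lspan E (foldr pderiv f s).
  elim: s => [|i s IH] /=; first exact: lspan_in.
  by have [_ _] := key _ IH.
by move=> /key[[? ?] ? _].
Qed.

Lemma smooth_cst z : Cinf ((fun=> z) : V -> R[i]).
Proof.
apply: (smooth_family (E := [set f | exists z, f = fun=> z])); last by exists z.
- by move=> _ [w ->]; exact: ccont_cst.
- by move=> _ i x [w ->]; exact: has_pd_pdiff (has_pd_cst _ _ _).
- move=> _ i [w ->]; apply: lspan_in; exists 0.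
  by apply: pderiv_eq => x; exact: has_pd_cst.
Qed.

Lemma smoothM f g : Cinf f -> Cinf g -> Cinf (fun x => f x * g x).
Proof.
move=> sf sg; apply: (smooth_family (E := [set h | exists f g,
  [/\ Cinf f, Cinf g & h = fun x => f x * g x]])); last by exists f, g.
- by move=> _ [{sf}f [{sg}g [sf sg ->]]]; apply: ccontM; exact: smooth_ccont.
- move=> _ i x [{sf}f [{sg}g [sf sg ->]]].
  by apply: has_pd_pdiff (has_pdM (smooth_has_pd _ _ sf) (smooth_has_pd _ _ sg)).
- move=> _ i [{sf}f [{sg}g [sf sg ->]]].
  rewrite (pderiv_eq (g := fun x => pderiv i f x * g x + f x * pderiv i g x)); last first.
    by move=> x; apply: has_pdM; exact: smooth_has_pd.
  apply: lspanD; apply: lspan_in.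
    exists (pderiv i f), g; split; [exact: smooth_pderiv|exact: sg|reflexivity].
  exists f, (pderiv i g); split; [exact: sf|exact: smooth_pderiv|reflexivity].
Qed.

Lemma smoothJ f : Cinf f -> Cinf (fun x => conjc (f x)).
Proof.
move=> sf; apply: (smooth_family (E := [set h | exists2 f,
  Cinf f & h = fun x => conjc (f x)])); last by exists f.
- by move=> _ [{sf}f sf ->]; apply: ccontJ; exact: smooth_ccont.
- by move=> _ i x [{sf}f sf ->]; exact: has_pd_pdiff (has_pdJ (smooth_has_pd _ _ sf)).
- move=> _ i [{sf}f sf ->]; apply: lspan_in; exists (pderiv i f).
    exact: smooth_pderiv.
  by apply: pderiv_eq => x; apply: has_pdJ; exact: smooth_has_pd.
Qed.

Lemma pderivJ f i : Cinf f -> pderiv i (fun x => conjc (f x)) = (fun x => conjc (pderiv i f x)).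
Proof. by move=> sf; apply: pderiv_eq => x; apply: has_pdJ; exact: smooth_has_pd. Qed.

Lemma pderivM f g i : Cinf f -> Cinf g ->
  pderiv i (fun x => f x * g x) = (fun x => pderiv i f x * g x + f x * pderiv i g x).
Proof. by move=> sf sg; apply: pderiv_eq => x; apply: has_pdM; exact: smooth_has_pd. Qed.

Lemma pderiv_comb a b f g i : Cinf f -> Cinf g ->
  pderiv i (fun x => a * f x + b * g x) = (fun x => a * pderiv i f x + b * pderiv i g x).
Proof.
move=> sf sg; apply: pderiv_eq => x.
by apply: has_pdD; apply: has_pdMl; exact: smooth_has_pd.
Qed.

Lemma pderiv_aff f i (c : R) (a : V) : Cinf f ->
  pderiv i (fun x => f (a + c *: x)) = (fun x => c%:C * pderiv i f (a + c *: x)).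
Proof. by move=> sf; apply: pderiv_eq => x; apply: has_pd_aff; exact: smooth_has_pd. Qed.

Lemma continuous_comp_aff (F : V -> R) (c : R) (a : V) : continuous F ->
  continuous (fun x => F (a + c *: x)).
Proof.
move=> cF x; apply/continuousP_entry => e e0.
have [d d0 hd] := (continuousP_entry _ _).1 (cF (a + c *: x)) _ e0.
have c0 : 0 < `|c| + 1 by rewrite ltr_wpDl.
exists (d / (`|c| + 1)); first exact: divr_gt0.
move=> y hy; apply: hd => i; have := hy i; rewrite !mxE ltr_pdivlMr// => hi.
rewrite opprD addrACA subrr add0r -mulrBr normrM mulrC; apply: le_lt_trans hi.
by rewrite ler_wpM2l// lerDl.
Qed.

Lemma continuous_comp1 (phi : R -> R) (F : V -> R) : continuous phi -> continuous F ->
  continuous (fun x => phi (F x)).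
Proof.
move=> cphi cF x; apply/continuousP_entry => e e0.
have /cvgrPdist_lt/(_ _ e0)/nbhs_ballP[d /= d0 hd] := cphi (F x).
have [d' d'0 hd'] := (continuousP_entry _ _).1 (cF x) _ d0.
exists d' => // y hy; rewrite distrC; apply: hd.
by rewrite /ball /= distrC; exact: hd'.
Qed.

Lemma ccont_aff f (c : R) (a : V) : ccont f -> ccont (fun x => f (a + c *: x)).
Proof.
move=> [c1 c2]; split.
  exact: (@continuous_comp_aff (fun x => complex.Re (f x))).
exact: (@continuous_comp_aff (fun x => complex.Im (f x))).
Qed.

Lemma smooth_aff f (c : R) (a : V) : Cinf f -> Cinf (fun x => f (a + c *: x)).
Proof.
move=> sf; apply: (smooth_family (E := [set h | exists2 f,
  Cinf f & h = fun x => f (a + c *: x)])); last by exists f.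
- by move=> _ [{sf}f sf ->]; apply: ccont_aff; exact: smooth_ccont.
- by move=> _ i x [{sf}f sf ->]; exact: has_pd_pdiff (has_pd_aff (smooth_has_pd _ _ sf)).
- move=> _ i [{sf}f sf ->]; rewrite pderiv_aff//; apply: lspanZ; apply: lspan_in.
  by exists (pderiv i f) => //; exact: smooth_pderiv.
Qed.

Lemma continuous_coord i : continuous (fun x : V => x 0 i).
Proof. exact: coord_continuous. Qed.

Lemma pderiv_coord i j : pderiv i (fun y : V => (y 0 j)%:C) = (fun=> (j == i)%:R%:C).
Proof. by apply: pderiv_eq => x; exact: has_pd_coord. Qed.

Lemma smooth_coord j : Cinf (fun y : V => (y 0 j)%:C).
Proof.
apply/smoothP; split.
- by split; [exact: continuous_coord|exact: cont_cst].
- by move=> i x; exact: has_pd_pdiff (has_pd_coord _ _ _).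
- by move=> i; rewrite pderiv_coord; exact: smooth_cst.
Qed.

Lemma is_derive_dotp (v x : V) (c : R) i :
  is_derive x (delta_mx 0 i) (fun y => c * dotp v y) (c * v 0 i).
Proof.
suff : is_derive (0 *: delta_mx 0 i + x) (delta_mx 0 i) (fun y : V => c * dotp v y) (c * v 0 i).
  by rewrite scale0r add0r.
apply/is_derive_line.
rewrite (_ : (fun _ => _) = (fun h : R => h * (c * v 0 i) + c * dotp v x)); last first.
  apply/funext => h; rewrite /dotp.
  rewrite (eq_bigr (fun j => h * (v 0 i * (j == i)%:R) + v 0 j * x 0 j)); last first.
    move=> j _; rewrite !mxE eqxx /=; case: eqVneq => [->|_] /=; ring.
  rewrite big_split /= -big_distrr /= (bigD1 i)//= eqxx mulr1 big1 ?addr0; first by ring.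
  by move=> j /negPf ->; rewrite mulr0.
by apply: is_derive_eq; rewrite /GRing.scale /= addr0 mulr1 mulr0 add0r.
Qed.

Lemma continuous_dotp (v : V) (c : R) : continuous (fun y => c * dotp v y).
Proof.
have h (r : seq 'I_n) : continuous (fun y : V => \sum_(i <- r) c * (v 0 i * y 0 i)).
  elim: r => [|i r IH].
    rewrite (_ : (fun _ => _) = (fun=> 0)); first exact: cont_cst.
    by apply/funext => y; rewrite big_nil.
  rewrite (_ : (fun _ => _) = (fun y : V => c * (v 0 i * y 0 i) +
      \sum_(j <- r) c * (v 0 j * y 0 j))); last by apply/funext => y; rewrite big_cons.
  apply: contD IH; apply: contM; first exact: cont_cst.
  by apply: contM; [exact: cont_cst|exact: continuous_coord].
by apply: (continuous_ext _ _ _ (h _)) => y; rewrite -big_distrr.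
Qed.

Lemma has_pd_cis_dotp (v x : V) (c : R) i :
  has_pd i (fun y => cis (c * dotp v y)) x ('i * (c * v 0 i)%:C * cis (c * dotp v x)).
Proof. by apply: has_pd_cis; exact: is_derive_dotp. Qed.

Lemma ccont_cis (h : V -> R) : continuous h -> ccont (fun y => cis (h y)).
Proof.
by move=> ch; split; apply: continuous_comp1 => //; [exact: continuous_cos|exact: continuous_sin].
Qed.

Lemma smooth_cis_dotp (v : V) (c : R) : Cinf (fun y => cis (c * dotp v y)).
Proof.
apply: (smooth_family (E := [set fun y => cis (c * dotp v y)])); last by [].
- by move=> _ ->; apply: ccont_cis; exact: continuous_dotp.
- by move=> _ i x ->; exact: has_pd_pdiff (has_pd_cis_dotp _ _ _ _).
- move=> _ i ->; rewrite (pderiv_eq (fun x => has_pd_cis_dotp v x c i)).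
  by apply: lspanZ; exact: lspan_in.
Qed.

Lemma MVT_ray (phi dphi : R -> R) (h : R) : 0 < h ->
  (forall t : R, is_derive t (1 : R) phi (dphi t)) ->
  exists2 c, 0 <= c <= h & phi h - phi 0 = dphi c * h.
Proof.
move=> h0 dp; have [//|c ch E] := @MVT_segment R phi dphi 0 h (ltW h0) (fun t _ => dp t).
  by apply: derivable_within_continuous => t _; exact: ex_derive.
by exists c; rewrite ?E ?subr0// -in_itv.
Qed.

Lemma lipschitz_step (F G : V -> R) i (M : R) :
  (forall x, is_derive x (delta_mx 0 i) F (G x)) -> (forall x, `|G x| <= M) ->
  forall x (h : R), `|F (h *: delta_mx 0 i + x) - F x| <= M * `|h|.
Proof.
move=> dF GM.
have pos x (h : R) : 0 < h -> `|F (h *: delta_mx 0 i + x) - F x| <= M * `|h|.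
  move=> h0; have [|c _] := @MVT_ray (fun t => F (t *: delta_mx 0 i + x)) (fun t => G (t *: delta_mx 0 i + x)) h h0.
    by move=> t; apply/is_derive_line; exact: dF.
  rewrite scale0r add0r => ->; rewrite normrM ler_wpM2r//.
move=> x h; have [h0|h0|->] := ltgtP h 0; last 2 first.
- exact: pos.
- by rewrite scale0r add0r subrr normr0 mulr0.
have := pos (h *: delta_mx 0 i + x) (- h); rewrite oppr_gt0 => /(_ h0).
by rewrite scaleNr addrA addNr add0r normrN distrC.
Qed.

(** Changing one coordinate at a time. *)
Lemma lipschitz_bound (F : V -> R) (G : 'I_n -> V -> R) (M : R) :
  (forall i x, is_derive x (delta_mx 0 i) F (G i x)) ->
  (forall i x, `|G i x| <= M) ->
  forall x y : V, `|F y - F x| <= M * \sum_i `|y 0 i - x 0 i|.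
Proof.
move=> dF GM x y.
pose z (k : nat) : V := \row_i if (i < k)%N then y 0 i else x 0 i.
have key k : (k <= n)%N -> `|F (z k) - F x| <= M * \sum_(i < n | (i < k)%N) `|y 0 i - x 0 i|.
  elim: k => [|k IH] kn.
    by rewrite big_pred0_eq mulr0 (_ : z 0%N = x) ?subrr ?normr0//; apply/rowP => i; rewrite mxE ltn0.
  have -> : z k.+1 = (y 0 (Ordinal kn) - x 0 (Ordinal kn)) *: delta_mx 0 (Ordinal kn) + z k.
    apply/rowP => i; rewrite !mxE eqxx /= ltnS leq_eqVlt.
    case: (eqVneq i (Ordinal kn)) => [->|ik]; first by rewrite /= eqxx ltnn /=; ring.
    by rewrite (_ : (nat_of_ord i == k) = false) ?mulr0 ?add0r//; apply/negbTE; exact: ik.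
  rewrite (bigD1 (Ordinal kn))//=.
  rewrite (eq_bigl (fun i : 'I_n => (i < k)%N)); last first.
    by move=> i; rewrite -val_eqE /= ltnS ltn_neqAle andbC.
  rewrite mulrDr -[F _ - F x](subrKA (F (z k))).
  apply: le_trans (ler_normD _ _) _; apply: lerD; last exact/IH/ltnW.
  exact: lipschitz_step (GM _) _ _.
have := key n (leqnn n); rewrite (_ : z n = y); last by apply/rowP => i; rewrite mxE ltn_ord.
by congr (_ <= _ * _); apply: eq_bigl => i; rewrite ltn_ord.
Qed.

(** Bounded first derivatives give continuity; for parametric integrals this
    replaces a separate continuity argument by dominated convergence. *)
Lemma lipschitz_continuous (F : V -> R) (G : 'I_n -> V -> R) (M : R) :
  (forall i x, is_derive x (delta_mx 0 i) F (G i x)) ->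
  (forall i x, `|G i x| <= M) -> continuous F.
Proof.
move=> dF GM x; have lip := lipschitz_bound dF GM x.
apply/continuousP_entry => e e0.
pose D := n%:R * `|M| + 1.
have D0 : 0 < D by rewrite ltr_wpDl ?mulr_ge0.
exists (e / D); first exact: divr_gt0.
move=> y hy; apply: le_lt_trans (lip y) _.
have h1 : \sum_i `|y 0 i - x 0 i| <= n%:R * (e / D).
  rewrite [leRHS](_ : _ = \sum_(i < n) e / D); last by rewrite sumr_const card_ord mulr_natl.
  by apply: ler_sum => i _; exact: ltW.
apply: (@le_lt_trans _ _ (`|M| * (n%:R * (e / D)))).
  apply: le_trans (ler_wpM2r _ (ler_norm M)) _; first exact: sumr_ge0.
  by rewrite ler_wpM2l.
by rewrite !mulrA ltr_pdivrMr// /D; lra.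
Qed.

(** Schwarz's theorem: the mixed second difference of F over the square of side h
    is h^2 times a value of either mixed derivative near p, by the mean value
    theorem applied twice in each order. *)
Lemma schwarz_real (F Fi Fj Fij Fji : V -> R) i j :
  (forall x, is_derive x (delta_mx 0 i) F (Fi x)) ->
  (forall x, is_derive x (delta_mx 0 j) F (Fj x)) ->
  (forall x, is_derive x (delta_mx 0 j) Fi (Fji x)) ->
  (forall x, is_derive x (delta_mx 0 i) Fj (Fij x)) ->
  continuous Fij -> continuous Fji -> Fij =1 Fji.
Proof.
move=> dFi dFj dFji dFij cij cji p.
have square (G Gi Gji : V -> R) k l (h : R) : 0 < h ->
    (forall x, is_derive x (delta_mx 0 k) G (Gi x)) ->
    (forall x, is_derive x (delta_mx 0 l) Gi (Gji x)) ->
    exists c c', [/\ 0 <= c <= h, 0 <= c' <= h &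
      G (h *: delta_mx 0 k + (h *: delta_mx 0 l + p)) - G (h *: delta_mx 0 k + p)
      - (G (h *: delta_mx 0 l + p) - G p) = Gji (c' *: delta_mx 0 l + (c *: delta_mx 0 k + p)) * h * h].
  move=> h0 dG dGi.
  have [t|c c01 E1] := @MVT_ray (fun t => G (t *: delta_mx 0 k + (h *: delta_mx 0 l + p)) - G (t *: delta_mx 0 k + p))
     (fun t => Gi (t *: delta_mx 0 k + (h *: delta_mx 0 l + p)) - Gi (t *: delta_mx 0 k + p)) h h0.
    by apply: is_deriveB; apply/is_derive_line; exact: dG.
  have [t|c' c01' E2] := @MVT_ray (fun t => Gi (t *: delta_mx 0 l + (c *: delta_mx 0 k + p)))
     (fun t => Gji (t *: delta_mx 0 l + (c *: delta_mx 0 k + p))) h h0.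
    by apply/is_derive_line; exact: dGi.
  exists c, c'; split => //; rewrite -E2 scale0r add0r.
  by move: E1; rewrite /= scale0r !add0r (addrCA (c *: _)) => ->.
apply/eqP; rewrite -subr_eq0 -normr_le0; apply/ler_addgt0Pl => e e0.
have e20 : 0 < e / 2 by rewrite divr_gt0.
have [d1 d10 h1] := (continuousP_entry _ _).1 (cij p) _ e20.
have [d2 d20 h2] := (continuousP_entry _ _).1 (cji p) _ e20.
pose h := Num.min d1 d2 / 4.
have h0 : 0 < h by rewrite divr_gt0// lt_min d10.
have hd1 : 2 * h < d1 by rewrite /h; have := ge_min d1 d1 d2; rewrite lexx /= => ?; lra.
have hd2 : 2 * h < d2 by rewrite /h; have := ge_min d2 d1 d2; rewrite lexx orbT /= => ?; lra.
have [c [c' [/andP[c0 ch] /andP[c0' ch'] E1]]] := square F Fi Fji i j h h0 dFi dFji.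
have [b [b' [/andP[b0 bh] /andP[b0' bh'] E2]]] := square F Fj Fij j i h h0 dFj dFij.
have near (u v : R) k l m : 0 <= u -> u <= h -> 0 <= v -> v <= h ->
    `|(u *: delta_mx 0 k + (v *: delta_mx 0 l + p)) 0 m - p 0 m| <= 2 * h.
  move=> u0 uh v0 vh; rewrite !mxE eqxx /= addrA addrK.
  have [q q01] : exists2 q : R, 0 <= q <= 1 & (m == k)%:R = q by exists (m == k)%:R => //; case: eqP; rewrite ?lexx ?ler01.
  have [r r01] : exists2 r : R, 0 <= r <= 1 & (m == l)%:R = r by exists (m == l)%:R => //; case: eqP; rewrite ?lexx ?ler01.
  move=> -> ->; rewrite ger0_norm; last by nra.
  by nra.
have E : Fij (b' *: delta_mx 0 i + (b *: delta_mx 0 j + p)) = Fji (c' *: delta_mx 0 j + (c *: delta_mx 0 i + p)).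
  apply: (mulIf (lt0r_neq0 h0)); apply: (mulIf (lt0r_neq0 h0)); rewrite -E1 -E2.
  by rewrite (addrCA (h *: delta_mx 0 j)); ring.
have := h1 (b' *: delta_mx 0 i + (b *: delta_mx 0 j + p)) (fun m => le_lt_trans (near _ _ _ _ m b0' bh' b0 bh) hd1).
have := h2 (c' *: delta_mx 0 j + (c *: delta_mx 0 i + p)) (fun m => le_lt_trans (near _ _ _ _ m c0' ch' c0 ch) hd2).
rewrite E; set A := Fji _ => {E E1 E2}; rewrite -/A => k1 k2.
rewrite addr0.
rewrite -[Fij p - Fji p](subrKA A); apply: le_trans (ler_normD _ _) _.
rewrite distrC; have -> : e = e / 2 + e / 2 by lra.
by apply: lerD; exact: ltW.
Qed.

Lemma complex_ext z w : complex.Re z = complex.Re w -> complex.Im z = complex.Im w -> z = w.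
Proof. by case: z w => ? ? [? ?] /= -> ->. Qed.

Lemma pderivC f i j : Cinf f -> pderiv i (pderiv j f) = pderiv j (pderiv i f).
Proof.
move=> sf; apply/funext => x.
have hi y := smooth_has_pd i y sf; have hj y := smooth_has_pd j y sf.
have hij y := smooth_has_pd i y (smooth_pderiv j sf).
have hji y := smooth_has_pd j y (smooth_pderiv i sf).
have [c1 c2] := smooth_ccont (smooth_pderiv i (smooth_pderiv j sf)).
have [c3 c4] := smooth_ccont (smooth_pderiv j (smooth_pderiv i sf)).
apply: complex_ext.
  exact: (schwarz_real (fun y => (hi y).1) (fun y => (hj y).1) (fun y => (hji y).1) (fun y => (hij y).1) c1 c3).
exact: (schwarz_real (fun y => (hi y).2) (fun y => (hj y).2) (fun y => (hji y).2) (fun y => (hij y).2) c2 c4).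
Qed.

End Smooth.

(** * Words in multiplications and derivatives; Gelfand-Shilov spaces *)

Section FactorialPower.
Context {R : realType}.
Variable s : R.
Hypothesis hs : 2^-1 <= s.

Definition fs (m : nat) : R := (m`!)%:R `^ s.

Let s_gt0 : 0 < s.
Proof. by apply: lt_le_trans hs; rewrite invr_gt0. Qed.

Lemma powR_le (x y : R) : 0 <= x -> x <= y -> x `^ s <= y `^ s.
Proof.
move=> x0 xy; apply: ge0_ler_powR => //; rewrite ?nnegrE; first exact: ltW.
exact: le_trans xy.
Qed.

Lemma powR_ge1 (x : R) : 1 <= x -> 1 <= x `^ s.
Proof. by move=> x1; have := powR_le ler01 x1; rewrite powR1. Qed.

Lemma fs_ge1 m : 1 <= fs m.
Proof. by apply: powR_ge1; rewrite ler1n fact_gt0. Qed.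

Lemma fs_gt0 m : 0 < fs m.
Proof. exact: lt_le_trans (fs_ge1 m). Qed.

Lemma fsS m : fs m.+1 = fs m * m.+1%:R `^ s.
Proof. by rewrite /fs factS mulnC natrM powRM. Qed.

Lemma fs_le m k : (m <= k)%N -> fs m <= fs k.
Proof. by move=> mk; apply: powR_le; rewrite ?ler0n// ler_nat leq_fact. Qed.

Lemma geom_le (K C : R) m p : 0 <= K -> 1 <= C -> (m <= p)%N ->
  K * C ^+ m * fs m <= K * C ^+ p * fs p.
Proof.
move=> K0 C1 mp; have C0 : 0 <= C := le_trans ler01 C1.
apply: ler_pM; [by rewrite mulr_ge0// exprn_ge0|exact/ltW/fs_gt0| |exact: fs_le].
by apply: ler_wpM2l => //; exact: ler_weXn2l.
Qed.

Lemma fsM_le m k : fs m * fs k <= fs (m + k).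
Proof.
rewrite /fs -powRM ?ler0n// -natrM; apply: powR_le; rewrite ?ler0n//.
rewrite ler_nat -(@bin_fact (m + k) m) ?leq_addr// addKn.
by rewrite leq_pmull// bin_gt0 leq_addr.
Qed.

Lemma fsD_le m k : fs (m + k) <= (2 `^ s) ^+ (m + k) * (fs m * fs k).
Proof.
rewrite /fs -powRM ?ler0n// -natrM -powR_mulrn ?powR_ge0// powRAC powR_mulrn//.
rewrite -powRM ?exprn_ge0 ?ler0n// -natrX -natrM; apply: powR_le; rewrite ?ler0n//.
rewrite ler_nat -(@bin_fact (m + k) m) ?leq_addr// addKn leq_mul2r.
apply/orP; right.
rewrite (_ : 2 = 1 + 1)%N// expnDn (bigD1 (inord m))//= inordK; last by rewrite ltnS leq_addr.
by rewrite !exp1n !muln1 leq_addr.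
Qed.

(** This is where s >= 1/2 rather than s > 0 is needed: moving a derivative past a
    multiplication costs a factor m, while it removes two letters from the word,
    which saves m^s * m^s. *)
Lemma natr_le_powR2 m : m%:R <= m%:R `^ s * m%:R `^ s :> R.
Proof.
case: m => [|m]; first by rewrite mulr_ge0 ?powR_ge0.
rewrite -powRD; last by rewrite pnatr_eq0 implybT.
have ss : 1 <= s + s by move: hs; lra.
by have := ler_powR (_ : 1 <= m.+1%:R :> R) ss; rewrite powRr1 ?ler0n// ler1n; apply.
Qed.

Lemma prod_fact_le (I : Type) (r : seq I) (a : I -> nat) :
  (\prod_(i <- r) (a i)`! <= (\sum_(i <- r) a i)`!)%N.
Proof.
elim: r => [|i r IH]; first by rewrite !big_nil.
rewrite !big_cons; apply: (@leq_trans ((a i)`! * (\sum_(j <- r) a j)`!)).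
  by rewrite leq_mul2l IH orbT.
rewrite -(@bin_fact (a i + \sum_(j <- r) a j) (a i)) ?leq_addr// addKn.
by rewrite leq_pmull// bin_gt0 leq_addr.
Qed.

(** The multinomial theorem evaluated at ones: a multinomial coefficient is at
    most (number of parts)^(total). *)
Lemma fact_sum_le (I : Type) (r : seq I) (a : I -> nat) :
  ((\sum_(i <- r) a i)`! <= size r ^ (\sum_(i <- r) a i) * \prod_(i <- r) (a i)`!)%N.
Proof.
elim: r => [|i r IH]; first by rewrite !big_nil.
rewrite !big_cons; set S := (\sum_(j <- r) a j)%N in IH *.
rewrite -(@bin_fact (a i + S) (a i)) ?leq_addr// addKn.
apply: (@leq_trans ('C(a i + S, a i) * ((a i)`! * (size r ^ S * \prod_(j <- r) (a j)`!)))).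
  by rewrite !leq_mul2l IH !orbT.
rewrite [X in (X <= _)%N](_ : _ = ('C(a i + S, a i) * size r ^ S) * ((a i)`! * \prod_(j <- r) (a j)`!))%N; last by ring.
rewrite leq_mul2r; apply/orP; right.
rewrite /= -addn1 expnDn (bigD1 (inord (a i)))//= inordK; last by rewrite ltnS leq_addr.
by rewrite exp1n muln1 addKn leq_addr.
Qed.

End FactorialPower.

Ltac nneg := repeat first
  [ assumption | apply: ler01 | apply: cmod_ge0 | apply: powR_ge0 | apply: ler0n | apply: expR_ge0
  | apply: exprn_ge0 | apply: mulr_ge0 | apply: addr_ge0 | rewrite invr_ge0
  | match goal with H : is_true (2^-1 <= _) |- _ => exact: (ltW (fs_gt0 H _)) end
  | apply: ltW; first [assumption | exact: jap_gt0] | exact: (le_trans ler01) ].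

Section Words.
Context {R : realType} {n : nat}.
Local Notation V := 'rV[R]_n.
Local Notation fspace := (V -> R[i]).
Implicit Types (f g : fspace) (x : V) (i : 'I_n).

(** Letters act by multiplication by a coordinate (inl) or by a partial
    derivative (inr); the words they generate allow the two kinds of operations
    to be interleaved, unlike the normally ordered monomials x^a d^b. *)
Definition letter := ('I_n + 'I_n)%type.

Definition lact (l : letter) f : fspace :=
  match l with inl i => fun x => (x 0 i)%:C * f x | inr i => pderiv i f end.

Definition wact (w : seq letter) f := foldr lact f w.

Lemma smooth_lact l f : Cinf f -> Cinf (lact l f).
Proof.
move=> sf; case: l => i /=; last exact: smooth_pderiv.
by apply: smoothM => //; exact: smooth_coord.
Qed.

Lemma smooth_wact w f : Cinf f -> Cinf (wact w f).
Proof. by move=> sf; elim: w => //= l w; exact: smooth_lact. Qed.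

Lemma lact_comb l (a b : R[i]) f g : Cinf f -> Cinf g ->
  lact l (fun x => a * f x + b * g x) = (fun x => a * lact l f x + b * lact l g x).
Proof.
move=> sf sg; case: l => i /=; last exact: pderiv_comb.
by apply/funext => x; ring.
Qed.

Lemma wact_comb w (a b : R[i]) f g : Cinf f -> Cinf g ->
  wact w (fun x => a * f x + b * g x) = (fun x => a * wact w f x + b * wact w g x).
Proof.
move=> sf sg; elim: w => //= l w ->.
by rewrite lact_comb//; exact: smooth_wact.
Qed.

(** The substitute for all Leibniz formulas: since one letter produces at most two
    terms of the next level, a word of length N produces at most 2^N terms, and no
    multinomial coefficient has to be written down. *)
Lemma bound_family (E : nat -> set fspace) (L : pred letter) (c : R) (b : nat -> R)
    (omega : V -> R) : 0 <= c ->
  (forall m f, E m f -> Cinf f) ->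
  (forall m f x, E m f -> cmod (f x) <= b m * omega x) ->
  (forall m f l, E m f -> L l -> exists a1 a2 f1 f2,
    [/\ cmod a1 <= c, cmod a2 <= c, E m.+1 f1, E m.+1 f2 &
        lact l f = (fun x => a1 * f1 x + a2 * f2 x)]) ->
  forall w, all L w -> forall m f x, E m f ->
    cmod (wact w f x) <= (2 * c) ^+ size w * (b (m + size w)%N * omega x).
Proof.
move=> c0 sE bE lE; elim/last_ind => [|w l IH] Lw m f x Ef.
  by rewrite expr0 mul1r addn0; exact: bE.
have /andP[Ll {}Lw] : L l && all L w by rewrite -all_rcons.
have [a1 [a2 [f1 [f2 [h1 h2 E1 E2 lf]]]]] := lE _ _ _ Ef Ll.
rewrite /wact foldr_rcons lf -/(wact w _) wact_comb; [|exact: sE E1|exact: sE E2].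
apply: le_trans (le_normcD _ _) _; rewrite !cmodM.
have B0 : 0 <= (2 * c) ^+ size w * (b (m.+1 + size w)%N * omega x).
  exact: le_trans (cmod_ge0 _) (IH Lw _ _ x E1).
rewrite size_rcons addnS exprS -mulrA -[2 * c * _]mulrA [2 * _]mulr_natl mulr2n.
rewrite -addSn; apply: lerD.
  exact: (ler_pM (cmod_ge0 _) (cmod_ge0 _) h1 (IH Lw _ _ x E1)).
exact: (ler_pM (cmod_ge0 _) (cmod_ge0 _) h2 (IH Lw _ _ x E2)).
Qed.

Lemma wact_cat w1 w2 f : wact (w1 ++ w2) f = wact w1 (wact w2 f).
Proof. exact: foldr_cat. Qed.

Lemma pderiv_shift f (u : V) i : Cinf f ->
  pderiv i (fun x => f (x - u)) = (fun x => pderiv i f (x - u)).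
Proof.
move=> sf; have E (k : V -> R[i]) : (fun x => k (x - u)) = (fun x => k (- u + 1 *: x)).
  by apply/funext => x; rewrite scale1r addrC.
rewrite E pderiv_aff// E; apply/funext => x; by rewrite rmorph1 mul1r.
Qed.

Lemma smooth_shift f (u : V) : Cinf f -> Cinf (fun x => f (x - u)).
Proof.
move=> sf; rewrite (_ : (fun x => f (x - u)) = (fun x => f (- u + 1 *: x))).
  exact: smooth_aff.
by apply/funext => x; rewrite scale1r addrC.
Qed.

(** The multi-index a as a word, so that mderiv and mpow become words too. *)
Definition mword (a : 'I_n -> nat) : seq 'I_n := flatten [seq nseq (a i) i | i <- enum 'I_n].

Lemma count_mword a i : count_mem i (mword a) = a i.
Proof.
rewrite /mword count_flatten -map_comp sumnE big_map big_enum /=.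
rewrite (bigD1 i)//= count_nseq /= eqxx mul1n big1 ?addn0// => j ji.
by rewrite count_nseq /= (negPf ji).
Qed.

Lemma size_mword a : size (mword a) = mlen a.
Proof.
rewrite /mword size_flatten /shape -map_comp sumnE big_map big_enum /mlen.
by apply: eq_bigr => i _; rewrite /= size_nseq.
Qed.

Lemma mderivE a f : mderiv a f = foldr pderiv f (mword a).
Proof.
rewrite /mderiv /mword; elim: (enum _) => //= i r ->.
by rewrite foldr_cat; elim: (a i) => //= k ->.
Qed.

Lemma wact_inr f r : wact (map inr r) f = foldr pderiv f r.
Proof. by elim: r => //= i r ->. Qed.

Definition prodx (r : seq 'I_n) x : R := \prod_(i <- r) x 0 i.

Lemma wact_inl f r : wact (map inl r) f = (fun x => (prodx r x)%:C * f x).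
Proof.
elim: r => [|i r IH] /=; apply/funext => x; first by rewrite /prodx big_nil mul1r.
by rewrite IH /prodx big_cons rmorphM mulrA.
Qed.

Lemma mpowE x a : mpow x a = prodx (mword a) x.
Proof.
rewrite /mpow /prodx /mword -[LHS]big_enum /=; elim: (enum _) => [|i r IH].
  by rewrite !big_nil.
rewrite big_cons IH /= big_cat /=; congr (_ * _).
by elim: (a i) => [|k IHk]; rewrite ?big_nil ?expr0//= big_cons exprS IHk.
Qed.

Lemma foldr_pderiv_rem f i r : Cinf f -> i \in r ->
  foldr pderiv f r = pderiv i (foldr pderiv f (rem i r)).
Proof.
move=> sf; elim: r => [//|j r IH]; rewrite in_cons eq_sym /=.
case: eqVneq => [-> _|ji /= ir]; first reflexivity.
rewrite (IH ir); apply: pderivC.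
by rewrite -wact_inr; exact: smooth_wact.
Qed.

Lemma perm_pderiv f r r' : Cinf f -> perm_eq r r' ->
  foldr pderiv f r = foldr pderiv f r'.
Proof.
move=> sf; elim: r r' => [|i r IH] r' pr.
  by rewrite (_ : r' = [::]); last by apply/perm_nilP; rewrite perm_sym.
have ir : i \in r' by rewrite -(perm_mem pr) mem_head.
rewrite (foldr_pderiv_rem sf ir) /= (IH (rem i r'))//.
by rewrite -(perm_cons i); apply: perm_trans pr _; exact: perm_to_rem.
Qed.

Lemma perm_mword r : perm_eq (mword (fun i => count_mem i r)) r.
Proof. by apply/allP => i _ /=; rewrite count_mword. Qed.

End Words.

Section Rapid.
Context {R : realType}.
Variable s : R.
Hypothesis hs : 2^-1 <= s.

Section Dim.
Context {n : nat}.
Local Notation V := 'rV[R]_n.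
Local Notation fspace := (V -> R[i]).
Implicit Types (f g : fspace) (x : V) (i : 'I_n).

(** An equivalent form of membership in S^s_s (GS_rapid, rapid_GS) that is stable
    under every operation of the proof; it includes an integrable weight. *)
Definition rapid f := Cinf f /\ exists K C, [/\ 0 <= K, 1 <= C &
  forall w x, cmod (wact w f x) <= K * C ^+ size w * fs s (size w) * (jap x)^-1].

Lemma mfact_le (a b : 'I_n -> nat) :
  mfact a `^ s * mfact b `^ s <= fs s (mlen a + mlen b).
Proof.
apply: le_trans (fsM_le hs _ _); rewrite /fs /mfact.
by apply: ler_pM; rewrite ?powR_ge0//; apply: (powR_le hs); rewrite ?ler0n// ler_nat;
  exact: prod_fact_le.
Qed.

Lemma fs_mlen_le (a : 'I_n -> nat) :
  fs s (mlen a) <= (n%:R `^ s) ^+ mlen a * mfact a `^ s.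
Proof.
rewrite /fs /mfact -powR_mulrn ?powR_ge0// powRAC powR_mulrn//.
rewrite -powRM ?exprn_ge0 ?ler0n// -natrX -natrM; apply: (powR_le hs); rewrite ?ler0n//.
rewrite ler_nat /mlen -[X in X`!]big_enum -[X in (_ <= _ ^ X * _)%N]big_enum -[X in (_ <= _ * X)%N]big_enum /=.
by have := fact_sum_le (enum 'I_n) a; rewrite size_enum_ord.
Qed.

Lemma prodx_mword r x : prodx (mword (fun i => count_mem i r)) x = prodx r x.
Proof. by rewrite /prodx; apply: perm_big; exact: perm_mword. Qed.

Lemma mlen_count (r : seq 'I_n) : mlen (fun i => count_mem i r) = size r.
Proof. by rewrite -size_mword; exact/perm_size/perm_mword. Qed.

Lemma GS_ordered_bound f : GS s f -> exists K C, [/\ 0 <= K, 1 <= C &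
  forall (r t : seq 'I_n) x, cmod ((prodx r x)%:C * foldr pderiv f t x) <=
    K * C ^+ (size r + size t) * fs s (size r + size t)].
Proof.
move=> [[/CinfE sf _] [A [B [K [A0 B0 K0 bf]]]]].
pose C := Num.max 1 (Num.max A B).
have C1 : 1 <= C by rewrite /C le_max lexx.
have AC : A <= C by rewrite /C !le_max lexx !orbT.
have BC : B <= C by rewrite /C !le_max lexx !orbT.
exists K, C; split=> //; first exact: ltW.
move=> r t x; have := bf x (fun i => count_mem i r) (fun i => count_mem i t).
rewrite mpowE prodx_mword mderivE (perm_pderiv sf (perm_mword t)) !mlen_count.
move/le_trans; apply; rewrite -mulrA.
have := mfact_le (fun i => count_mem i r) (fun i => count_mem i t).
rewrite !mlen_count => h.
apply: ler_pM => //.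
- by rewrite !mulr_ge0 ?exprn_ge0// ltW.
- by rewrite mulr_ge0 ?powR_ge0.
rewrite -mulrA ler_wpM2l ?(ltW K0)// exprD.
by apply: ler_pM; rewrite ?exprn_ge0// ?(ltW A0) ?(ltW B0)// lerXn2r// nnegrE ?ltW// (lt_le_trans A0, lt_le_trans B0).
Qed.

Lemma pderiv_prodx i (r : seq 'I_n) x :
  has_pd i (fun y => (prodx r y)%:C) x ((count_mem i r)%:R * prodx (rem i r) x)%:C.
Proof.
elim: r => [|j r IH].
  rewrite mul0r; have := has_pd_cst i 1 x; congr (has_pd _ _ _ _).
  by apply/funext => y; rewrite /prodx big_nil.
have -> : (fun y : V => (prodx (j :: r) y)%:C) = (fun y : V => (y 0 j)%:C * (prodx r y)%:C).
  by apply/funext => y; rewrite /prodx big_cons rmorphM.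
have := has_pdM (has_pd_coord i j x) IH; congr (has_pd _ _ _ _).
rewrite -!rmorphM -rmorphD /=; congr (_%:C).
case: eqVneq => [->|ji] /=; last by rewrite mul0r !add0r /prodx big_cons; ring.
suff -> : x 0 i * ((count_mem i r)%:R * prodx (rem i r) x) = (count_mem i r)%:R * prodx r x.
  by rewrite natrD; ring.
have [ir|ir] := boolP (i \in r); last by rewrite (count_memPn ir) !mul0r mulr0.
have -> : prodx r x = x 0 i * prodx (rem i r) x.
  by rewrite /prodx (perm_big _ (perm_to_rem ir)) big_cons.
by ring.
Qed.

Lemma smooth_prodx r : Cinf (fun y : V => (prodx r y)%:C).
Proof.
have -> : (fun y : V => (prodx r y)%:C) = wact (map inl r) (fun=> 1).
  by rewrite wact_inl; apply/funext => y; rewrite mulr1.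
by apply: smooth_wact; exact: smooth_cst.
Qed.

Lemma smooth_foldr f r : Cinf f -> Cinf (foldr pderiv f r).
Proof. by move=> sf; rewrite -wact_inr; exact: smooth_wact. Qed.

Lemma smoothZ a f : Cinf f -> Cinf (fun x => a * f x).
Proof. by move=> sf; apply: smoothM => //; exact: smooth_cst. Qed.

(** A word is brought to normal order x^r d^t by moving derivatives to the right;
    each commutator [d_i, x_i] = 1 removes two letters and is paid for by
    natr_le_powR2. *)
Lemma GS_word_bound f : GS s f -> exists K C, [/\ 0 <= K, 1 <= C &
  forall w x, cmod (wact w f x) <= K * C ^+ size w * fs s (size w)].
Proof.
move=> gf; have [K [C [K0 C1 bf]]] := GS_ordered_bound gf.
have [[/CinfE sf _] _] := gf.
have C0 : 0 < C := lt_le_trans ltr01 C1.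
pose T m := C ^+ m * fs s m.
have T0 m : 0 < T m by rewrite mulr_gt0 ?exprn_gt0 ?(fs_gt0 hs).
have TS m : T m.+1 = T m * C * m.+1%:R `^ s by rewrite /T exprSr fsS; ring.
have T_le m : T m * m.+1%:R `^ s <= T m.+1.
  by rewrite TS ler_wpM2r ?powR_ge0// ler_peMr// ltW.
(* lam records the integers produced by the derivatives of the monomials; they
   are paid for by the drop of the total order p of the term. *)
pose E m := [set h : fspace | exists r t lam, [/\ 0 <= lam, (size r + size t <= m)%N,
  lam * T (size r + size t)%N <= T m &
  h = fun x => lam%:C * ((prodx r x)%:C * foldr pderiv f t x)]].
have sE m h : E m h -> Cinf h.
  move=> [r [t [lam [_ _ _ ->]]]]; apply: smoothZ.
  by apply: smoothM; [exact: smooth_prodx|exact: smooth_foldr].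
have bE m h x : E m h -> cmod (h x) <= (K * T m) * 1.
  move=> [r [t [lam [l0 _ lT ->]]]]; rewrite mulr1 cmodM cmod_real ger0_norm//.
  apply: le_trans (ler_wpM2l l0 (bf r t x)) _.
  rewrite -mulrA mulrCA; apply: ler_wpM2l => //.
have up (p m : nat) (lam : R) : 0 <= lam -> (p <= m)%N -> lam * T p <= T m -> lam * T p.+1 <= T m.+1.
  move=> l0 pm h; rewrite !TS mulrA mulrA; apply: ler_pM => //.
  - exact: mulr_ge0 (mulr_ge0 l0 (ltW (T0 p))) (ltW C0).
  - by rewrite ler_wpM2r// ltW.
  - by apply: (powR_le hs); rewrite ?ler0n// ler_nat.
have lE m h l : E m h -> predT l -> exists a1 a2 f1 f2,
    [/\ cmod a1 <= 1, cmod a2 <= 1, E m.+1 f1, E m.+1 f2 &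
        lact l h = (fun x => a1 * f1 x + a2 * f2 x)].
  have c1 : cmod (1 : R[i]) <= 1 by rewrite (cmod_real 1) normr1.
  move=> [r [t [lam [l0 pm lT ->]]]] _; case: l => i /=.
    exists 1, 0, (fun x => lam%:C * ((prodx (i :: r) x)%:C * foldr pderiv f t x)),
      (fun x => lam%:C * ((prodx (i :: r) x)%:C * foldr pderiv f t x)).
    have Ei : E m.+1 (fun x => lam%:C * ((prodx (i :: r) x)%:C * foldr pderiv f t x)).
      by exists (i :: r), t, lam; split; [exact: l0|rewrite addSn ltnS|rewrite addSn; exact: up|reflexivity].
    split; [exact: c1|by rewrite cmod0|exact: Ei|exact: Ei|].
    by apply/funext => x; rewrite /prodx big_cons rmorphM; ring.
  exists 1, 1, (fun x => (lam * (count_mem i r)%:R)%:C * ((prodx (rem i r) x)%:C * foldr pderiv f t x)),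
    (fun x => lam%:C * ((prodx r x)%:C * foldr pderiv f (i :: t) x)).
  split; [exact: c1|exact: c1| | |].
  - exists (rem i r), t, (lam * (count_mem i r)%:R); split; last reflexivity.
    + by rewrite mulr_ge0.
    + apply: leq_trans (leqW pm); rewrite leq_add2r.
      by have [ir|ir] := boolP (i \in r); [rewrite size_rem// leq_pred|rewrite rem_id].
    + have [ir|ir] := boolP (i \in r); last by rewrite (count_memPn ir) mulr0 mul0r ltW.
      have rS : size r = (size (rem i r)).+1 by rewrite size_rem// prednK//; case: (r) ir.
      set q := (size (rem i r) + size t)%N.
      have pq : (size r + size t = q.+1)%N by rewrite rS.
      rewrite pq in lT pm.
      have cq : (count_mem i r)%:R <= q.+1%:R `^ s * q.+1%:R `^ s :> R.
        apply: le_trans (natr_le_powR2 hs _); rewrite ler_nat.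
        by apply: leq_trans (count_size _ _) _; rewrite rS ltnS leq_addr.
      have Tq : T q * q.+1%:R `^ s <= T q.+1 := T_le q.
      apply: (@le_trans _ _ (lam * (T q.+1 * q.+1%:R `^ s))).
        rewrite -mulrA; apply: ler_wpM2l => //.
        apply: le_trans (ler_wpM2r (ltW (T0 q)) cq) _.
        rewrite -mulrA mulrC; apply: ler_wpM2r; first exact: powR_ge0.
        by rewrite mulrC.
      rewrite mulrA; apply: le_trans (T_le m); apply: ler_pM => //.
      - by rewrite mulr_ge0// ltW.
      - by apply: (powR_le hs); rewrite ?ler0n// ler_nat leqW.
  - exists r, (i :: t), lam; split; [exact: l0|by rewrite addnS ltnS|rewrite addnS; exact: up|reflexivity].
  - apply: pderiv_eq => x.
    have h1 := has_pdMl lam%:C (has_pdM (pderiv_prodx i r x) (smooth_has_pd i x (smooth_foldr t sf))).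
    move: h1; congr (has_pd _ _ _ _); rewrite !rmorphM /=; ring.
exists K, (2 * C); split=> //; first by lra.
move=> w x.
have Ef : E 0%N f.
  exists [::], [::], 1; split=> //; first by rewrite mul1r.
  by apply/funext => y; rewrite /prodx big_nil !mul1r.
have := bound_family (L := predT) ler01 sE bE lE (w := w) (all_predT _) x Ef.
move/le_trans; apply; rewrite add0n mulr1 mulr1 exprMn /T.
by apply: eq_lerW; ring.
Qed.

(** Multiplication by 1 + x_i^2 is the sum of two words, so that weights can be
    inserted in front of a word at the price of finitely many letters. *)
Lemma rapid_of_word_bound f K C : Cinf f -> 0 <= K -> 1 <= C ->
  (forall w x, cmod (wact w f x) <= K * C ^+ size w * fs s (size w)) -> rapid f.
Proof.
move=> sf K0 C1 bf; have C0 : 0 < C := lt_le_trans ltr01 C1.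
pose b m := K * C ^+ m * fs s m.
have b_mono m p : (m <= p)%N -> b m <= b p.
  exact: (geom_le hs).
have key (r : seq 'I_n) w x :
    \prod_(i <- r) (1 + x 0 i ^+ 2) * cmod (wact w f x) <= 2 ^+ size r * b (size w + 2 * size r)%N.
  elim: r w => [|i r IH] w; first by rewrite big_nil expr0 !mul1r muln0 addn0 bf.
  rewrite big_cons; set P := \prod_(j <- r) _; set W := cmod _.
  have xx : x 0 i ^+ 2 = `|x 0 i| * `|x 0 i| by rewrite -expr2 real_normK ?num_real.
  rewrite xx (_ : _ * W = P * W + P * (`|x 0 i| * (`|x 0 i| * W))); last by ring.
  have := IH (inl i :: inl i :: w); rewrite /= !cmodM !cmod_real -/P -/W => h2.
  apply: le_trans (lerD (IH w) h2) _.
  rewrite exprS -mulrA [2 * _]mulr_natl mulr2n; apply: lerD;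
    (apply: ler_wpM2l; [exact: exprn_ge0|apply: b_mono; rewrite /=; lia]).
split => //; exists (2 ^+ n * K * C ^+ (2 * n) * (2 `^ s) ^+ (2 * n) * fs s (2 * n)), (C * 2 `^ s).
split=> [||w x].
- by nneg.
- have p1 : 1 <= 2 `^ s by apply: (powR_ge1 hs); rewrite ler1n.
  by apply: le_trans C1 _; rewrite ler_peMr// ltW.
rewrite ler_pdivlMr ?jap_gt0// mulrC.
have := key (enum 'I_n) w x; rewrite big_enum /= size_enum_ord => /le_trans; apply.
rewrite /b; apply: (@le_trans _ _ (2 ^+ n * (K * C ^+ (size w + 2 * n) *
   ((2 `^ s) ^+ (size w + 2 * n) * (fs s (size w) * fs s (2 * n)))))).
  apply: ler_wpM2l; first exact: exprn_ge0.
  apply: ler_wpM2l; last exact: (fsD_le hs).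
  by nneg.
by apply: eq_lerW; rewrite exprMn !exprD; ring.
Qed.

Lemma GS_rapid f : GS s f -> rapid f.
Proof.
move=> gf; have [K [C [K0 C1 bf]]] := GS_word_bound gf.
by have [[/CinfE sf _] _] := gf; exact: rapid_of_word_bound bf.
Qed.

Lemma rapid_smooth f : rapid f -> Cinf f.
Proof. by case. Qed.

Lemma rapid_GS f : rapid f -> GS s f.
Proof.
move=> [sf [K [C [K0 C1 bf]]]]; have C0 : 0 < C := lt_le_trans ltr01 C1.
have bd (a b : 'I_n -> nat) x : cmod ((mpow x a)%:C * mderiv b f x) <=
    K * C ^+ (mlen a + mlen b) * fs s (mlen a + mlen b).
  have := bf (map inl (mword a) ++ map inr (mword b)) x.
  rewrite wact_cat wact_inr wact_inl.
  rewrite mpowE mderivE size_cat !size_map !size_mword => /le_trans; apply.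
  rewrite ler_piMr ?invf_le1 ?jap_gt0 ?jap_ge1//.
  by nneg.
split; first split.
- exact/CinfE.
- by move=> a b; exists (K * C ^+ (mlen a + mlen b) * fs s (mlen a + mlen b)) => x; exact: bd.
have p0 : 0 < 2 `^ s :> R by exact: powR_gt0.
pose D := C * 2 `^ s * (n%:R `^ s + 1).
have n0 : 0 < n%:R `^ s + 1 :> R by rewrite ltr_wpDl ?powR_ge0.
have D0 : 0 < D by rewrite !mulr_gt0.
exists D, D, (K + 1); split=> //; first by rewrite ltr_wpDl.
move=> x a b; apply: le_trans (bd a b x) _.
have := fsD_le hs (mlen a) (mlen b) => h.
have ha := fs_mlen_le a; have hb := fs_mlen_le b.
have up m : (n%:R `^ s) ^+ m <= (n%:R `^ s + 1) ^+ m :> R.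
  by apply: lerXn2r; rewrite ?nnegrE ?lerDl//; nneg.
have fa0 (c : 'I_n -> nat) : 0 <= mfact c `^ s :> R by exact: powR_ge0.
have {}ha : fs s (mlen a) <= (n%:R `^ s + 1) ^+ mlen a * mfact a `^ s.
  by apply: le_trans ha _; rewrite ler_wpM2r.
have {}hb : fs s (mlen b) <= (n%:R `^ s + 1) ^+ mlen b * mfact b `^ s.
  by apply: le_trans hb _; rewrite ler_wpM2r.
have hab : fs s (mlen a) * fs s (mlen b) <= (n%:R `^ s + 1) ^+ mlen a * mfact a `^ s *
   ((n%:R `^ s + 1) ^+ mlen b * mfact b `^ s).
  by apply: ler_pM => //; exact/ltW/(fs_gt0 hs).
have KC : 0 <= K * C ^+ (mlen a + mlen b) by rewrite mulr_ge0// exprn_ge0// ltW.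
apply: le_trans (ler_wpM2l KC h) _.
apply: le_trans (ler_wpM2l KC (ler_wpM2l (exprn_ge0 _ (ltW p0)) hab)) _.
have -> : (K + 1) * D ^+ mlen a * D ^+ mlen b * mfact a `^ s * mfact b `^ s =
  K * C ^+ (mlen a + mlen b) * ((2 `^ s) ^+ (mlen a + mlen b) *
   ((n%:R `^ s + 1) ^+ mlen a * mfact a `^ s * ((n%:R `^ s + 1) ^+ mlen b * mfact b `^ s))) +
   D ^+ mlen a * D ^+ mlen b * mfact a `^ s * mfact b `^ s.
  by rewrite /D !exprMn !exprD; ring.
by rewrite lerDl; nneg.
Qed.

(** The letter x_i acts on f(. - u) as x_i + u_i acts on f. *)
Lemma rapid_translate f (u : V) : rapid f -> rapid (fun x => f (x - u)).
Proof.
move=> [sf [K [C [K0 C1 bf]]]]; have C0 : 0 < C := lt_le_trans ltr01 C1.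
pose c := 1 + \sum_i `|u 0 i|.
have c1 : 1 <= c by rewrite lerDl sumr_ge0.
have ci i : cmod (u 0 i)%:C <= c.
  by rewrite cmod_real /c (bigD1 i)//= addrCA lerDl addr_ge0// sumr_ge0.
pose b m := K * C ^+ m * fs s m.
have b_mono m p : (m <= p)%N -> b m <= b p.
  exact: (geom_le hs).
pose E m := [set h : fspace | exists2 w, (size w <= m)%N & h = fun x => wact w f (x - u)].
have sE m h : E m h -> Cinf h by move=> [w _ ->]; apply: smooth_shift; exact: smooth_wact.
have bE m h x : E m h -> cmod (h x) <= b m * (jap (x - u))^-1.
  move=> [w wm ->]; apply: le_trans (bf w _) _; apply: ler_wpM2r; last exact: b_mono.
  by rewrite invr_ge0 ltW// jap_gt0.
have cone : cmod (1 : R[i]) <= c by rewrite (cmod_real 1) normr1.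
have czero : cmod (0 : R[i]) <= c by rewrite cmod0; exact: le_trans c1.
have lE m h l : E m h -> predT l -> exists a1 a2 f1 f2,
    [/\ cmod a1 <= c, cmod a2 <= c, E m.+1 f1, E m.+1 f2 &
        lact l h = (fun x => a1 * f1 x + a2 * f2 x)].
  move=> [w wm ->] _; have E1 l' : E m.+1 (fun x => wact (l' :: w) f (x - u)) by exists (l' :: w).
  have E0 : E m.+1 (fun x => wact w f (x - u)) by exists w => //; exact: leqW.
  case: l => i /=.
    exists 1, (u 0 i)%:C, (fun x => wact (inl i :: w) f (x - u)), (fun x => wact w f (x - u)).
    split; [exact: cone|exact: ci|exact: E1|exact: E0|].
    by apply/funext => x /=; rewrite !mxE rmorphB; ring.
  exists 1, 0, (fun x => wact (inr i :: w) f (x - u)), (fun x => wact w f (x - u)).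
  split; [exact: cone|exact: czero|exact: E1|exact: E0|].
  rewrite pderiv_shift; last exact: smooth_wact.
  by apply/funext => x; rewrite mul0r addr0 mul1r.
split; first exact: smooth_shift.
have ju := jap_gt0 (- u); exists (2 ^+ n * jap (- u) * K), (2 * c * C); split.
- by nneg.
- have c2 : 1 <= 2 * c by lra.
  by apply: le_trans c2 _; rewrite ler_peMr//; lra.
move=> w x.
have E0f : E 0%N (fun x => f (x - u)) by exists [::].
have := bound_family (L := predT) (le_trans ler01 c1) sE bE lE (w := w) (all_predT _) x E0f.
move/le_trans; apply; rewrite add0n.
have jj : (jap (x - u))^-1 <= 2 ^+ n * jap (- u) * (jap x)^-1 by rewrite addrC; exact: japV_shift.
apply: (@le_trans _ _ ((2 * c) ^+ size w * (b (size w) * (2 ^+ n * jap (- u) * (jap x)^-1)))).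
  apply: ler_wpM2l; first by rewrite exprn_ge0// mulr_ge0// (le_trans ler01 c1).
  apply: ler_wpM2l => //; by rewrite /b; nneg.
by apply: eq_lerW; rewrite /b [(2 * c * C) ^+ _]exprMn; ring.
Qed.

End Dim.
End Rapid.

(** * Differentiation under the integral sign and the Fourier transform of Gaussians *)

Section ParametricIntegrals.
Context {R : realType} {n : nat} {d} {S : measurableType d}.
Variable mu : {measure set S -> \bar R}.
Local Notation V := 'rV[R]_n.

Lemma is_derive_integral_line (f df : R -> S -> R) (G : S -> R) :
  (forall h : R, mu.-integrable setT (EFin \o f h)) ->
  (forall (h : R) y, is_derive h (1 : R) (f^~ y) (df h y)) ->
  mu.-integrable setT (EFin \o G) ->
  (forall (h : R) y, `|h| < 1 -> `|df h y| <= G y) ->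
  is_derive (0 : R) (1 : R) (fun h => \int[mu]_y f h y) (\int[mu]_y df 0 y).
Proof.
move=> fi fd Gi dG.
have G0 y : 0 <= G y by apply: le_trans (dG 0 y _); rewrite ?normr0.
have I0 : [set` `]-1, 1[%R] (0 : R) by rewrite /= in_itv /=; apply/andP; split; lra.
have pE h y : partial1of2 f h y = df h y by rewrite partial1of2E derive_val.
have der (h : R) y : [set` `]-1, 1[%R] h -> setT y -> derivable (f^~ y) h 1.
  by move=> _ _; have [] := fd h y.
have H := @cvg_differentiation_under_integral R d S mu f setT measurableT 0 (-1) 1 I0
   (fun h _ => fi h) der G G0 Gi.
have dI h y : [set` `]-1, 1[%R] h -> setT y -> `|partial1of2 f h y| <= G y.
  by rewrite /= in_itv /= => hI _; rewrite pE; apply: dG; rewrite ltr_norml.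
have eqd : \int[mu]_y partial1of2 f 0 y = \int[mu]_y df 0 y.
  by apply: eq_Rintegral => y _; exact: pE.
have {H} := H dI; rewrite eqd.
set l := (X in _ --> X) => H.
have E : (fun h : R => h^-1 *: (((fun h0 : R => \int[mu]_y f h0 y) \o shift 0) (h *: 1) -
   (\int[mu]_y f 0 y))) = (fun h : R => h^-1 *: (\int[mu]_y f (h + 0) y - \int[mu]_y f 0 y)).
  by apply/funext => h /=; rewrite /GRing.scale /= mulr1.
by split; [apply/cvg_ex; exists l; rewrite E; exact: H|rewrite /derive E; exact: cvg_lim H].
Qed.

(** The difference quotients at x only see a segment around x, so the majorant G is
    asked for there. *)
Lemma has_pd_cint (F DF : V -> S -> R[i]) (G : S -> R) i x :
  (forall y, cintg mu (F y)) ->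
  (forall y s, has_pd i (F^~ s) y (DF y s)) ->
  mu.-integrable setT (EFin \o G) ->
  (forall (h : R) s, `|h| < 1 -> cmod (DF (h *: delta_mx 0 i + x) s) <= G s) ->
  has_pd i (fun y => cint mu (F y)) x (cint mu (DF x)).
Proof.
move=> Fi Fd Gi DG.
split.
  suff : is_derive (0 *: delta_mx 0 i + x) (delta_mx 0 i) (fun y => complex.Re (cint mu (F y)))
      (complex.Re (cint mu (DF (0 *: delta_mx 0 i + x)))).
    by rewrite scale0r add0r.
  apply/(is_derive_line (fun y => complex.Re (cint mu (F y)))).
  apply: (is_derive_integral_line (f := fun h s => complex.Re (F (h *: delta_mx 0 i + x) s))
    (df := fun h s => complex.Re (DF (h *: delta_mx 0 i + x) s)) (G := G)) => //.
  - by move=> h; have [] := Fi (h *: delta_mx 0 i + x).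
  - move=> h s; apply/(is_derive_line (fun z => complex.Re (F z s))); exact: (Fd _ s).1.
  - by move=> h s h1; apply: le_trans (Re_le_cmod _) (DG h s h1).
suff : is_derive (0 *: delta_mx 0 i + x) (delta_mx 0 i) (fun y => complex.Im (cint mu (F y)))
    (complex.Im (cint mu (DF (0 *: delta_mx 0 i + x)))).
  by rewrite scale0r add0r.
apply/(is_derive_line (fun y => complex.Im (cint mu (F y)))).
apply: (is_derive_integral_line (f := fun h s => complex.Im (F (h *: delta_mx 0 i + x) s))
  (df := fun h s => complex.Im (DF (h *: delta_mx 0 i + x) s)) (G := G)) => //.
- by move=> h; have [] := Fi (h *: delta_mx 0 i + x).
- move=> h s; apply/(is_derive_line (fun z => complex.Im (F z s))); exact: (Fd _ s).2.
- by move=> h s h1; apply: le_trans (Im_le_cmod _) (DG h s h1).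
Qed.

End ParametricIntegrals.

Section IntegralDerivative.
Context {R : realType} {n : nat}.
Local Notation V := 'rV[R]_n.
Local Notation T := (n.-tuple (measurableTypeR R)).
Implicit Types (F : V -> R[i]) (i : 'I_n).

Lemma ccont_cmeas F : ccont F -> cmeas (fun t : T => F (vec t)).
Proof.
move=> [c1 c2]; split.
  exact: (@continuous_measurable_vec R n (fun x => complex.Re (F x))).
exact: (@continuous_measurable_vec R n (fun x => complex.Im (F x))).
Qed.

Lemma cintg_jap F c : ccont F -> (forall x, cmod (F x) <= c * (jap x)^-1) ->
  cintg (Lb n) (fun t => F (vec t)).
Proof.
move=> cF bF; apply: (cintg_dom (ccont_cmeas cF) (fun t => bF (vec t))).
exact: integrable_scale (integrable_japV n).
Qed.

Lemma cint_jap F c : ccont F -> (forall x, cmod (F x) <= c * (jap x)^-1) ->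
  cmod (cint (Lb n) (fun t => F (vec t))) <= 2 * (c * japint n).
Proof.
move=> cF bF; rewrite /japint -RintegralZl//; last exact: integrable_japV.
apply: cint_le (fun t => bF (vec t)) _; first exact: ccont_cmeas.
exact: integrable_scale (integrable_japV n).
Qed.

Lemma jap_delta_le (h : R) i : `|h| < 1 -> jap (h *: delta_mx 0 i : V) <= 2 ^+ n.
Proof.
move=> h1; rewrite /jap (_ : 2 ^+ n = \prod_(j < n) 2); last by rewrite prodr_const card_ord.
apply: ler_prod => j _; rewrite !mxE eqxx /=; apply/andP; split.
  by rewrite addr_ge0// sqr_ge0.
case: eqVneq => _ /=; last by rewrite mulr0; lra.
by rewrite mulr1; move: h1; rewrite ltr_norml => /andP[? ?]; nra.
Qed.

(** Translation invariance says that F(. + h e_i) has a constant integral;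
    differentiating in h under the integral sign gives the claim. *)
Lemma cint_pderiv0 F (DF : V -> R[i]) (c : R) i : cintg (Lb n) (fun t : T => F (vec t)) ->
  (forall x, has_pd i F x (DF x)) -> 0 <= c ->
  (forall x, cmod (DF x) <= c * (jap x)^-1) ->
  cint (Lb n) (fun t : T => DF (vec t)) = 0.
Proof.
move=> iF dF c0 bF.
have aff1 (a : V) := cint_aff a (or_introl (erefl (1 : R))) iF.
have key : has_pd i (fun a : V => cint (Lb n) (fun t : T => F (vec t + a))) 0
    (cint (Lb n) (fun t : T => DF (vec t + 0))).
  apply: (has_pd_cint (F := fun a t => F (vec t + a)) (DF := fun a t => DF (vec t + a)) (G := fun t : T => c * (2 ^+ n * 2 ^+ n) * (jap (vec t))^-1)).
  - by move=> a; have [] := aff1 a; rewrite (eq_fun (fun t => congr1 F (congr1 (+%R^~ a) (scale1r (vec t))))).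
  - move=> a t; have /(@has_pd_aff _ _ _ _ _ 1 (vec t)) := dF (vec t + 1 *: a).
    rewrite mul1r scale1r; congr (has_pd _ _ _ _).
    by apply/funext => y; rewrite scale1r.
  - exact: integrable_scale (integrable_japV n).
  - move=> h t h1; rewrite addr0; apply: le_trans (bF _) _.
    rewrite -mulrA; apply: ler_wpM2l => //.
    rewrite addrC; apply: le_trans (japV_shift _ _) _.
    apply: ler_wpM2r; first by rewrite invr_ge0 ltW// jap_gt0.
    by apply: ler_wpM2l (jap_delta_le _ h1); exact: exprn_ge0.
have E : (fun a : V => cint (Lb n) (fun t : T => F (vec t + a))) = fun=> cint (Lb n) (fun t : T => F (vec t)).
  apply/funext => a; have [_ <-] := aff1 a.
  by apply: eq_cint => t; rewrite scale1r.
rewrite E in key.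
have := has_pd_pderiv key; rewrite (has_pd_pderiv (has_pd_cst _ _ _)) => ->.
by apply: eq_cint => t; rewrite addr0.
Qed.

End IntegralDerivative.

Section Gaussian.
Context {R : realType} {n : nat}.
Local Notation V := 'rV[R]_n.
Local Notation T := (n.-tuple (measurableTypeR R)).
Implicit Types (a : R) (x v : V) (i : 'I_n).

Definition gauss a x : R := expR (- (a * dotp x x)).

Lemma gauss_prod a x : gauss a x = \prod_i expR (- (a * x 0 i ^+ 2)).
Proof.
rewrite -expR_sum /gauss; congr expR; rewrite /dotp big_distrr /= -sumrN.
by apply: eq_bigr => i _; rewrite expr2.
Qed.

Lemma gauss_gt0 a x : 0 < gauss a x.
Proof. exact: expR_gt0. Qed.

Lemma dotp_ge0 x : 0 <= dotp x x.
Proof. by apply: sumr_ge0 => i _; rewrite -expr2 sqr_ge0. Qed.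

Lemma gauss_le1 a x : 0 <= a -> gauss a x <= 1.
Proof. by move=> a0; rewrite /gauss -expR0 ler_expR oppr_le0 mulr_ge0// dotp_ge0. Qed.

Lemma coord_le_jap x i : `|x 0 i| <= jap x.
Proof.
rewrite /jap (bigD1 i)//=; apply: (@le_trans _ _ (1 + x 0 i ^+ 2)).
  have -> : x 0 i ^+ 2 = `|x 0 i| ^+ 2 by rewrite real_normK ?num_real.
  by have := sqr_ge0 (`|x 0 i| - 1); nra.
rewrite ler_peMr ?addr_ge0 ?sqr_ge0//.
elim/big_ind: _ => [//|y z y1 z1|j _]; first by rewrite -[1]mulr1 ler_pM.
by rewrite lerDl sqr_ge0.
Qed.

Lemma dotp_le_jap x : dotp x x <= jap x.
Proof.
suff h (r : seq 'I_n) : 1 + \sum_(i <- r) x 0 i * x 0 i <= \prod_(i <- r) (1 + x 0 i ^+ 2).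
  by have := h (index_enum _); rewrite -/(jap x) -/(dotp x x); lra.
elim: r => [|i r IH]; first by rewrite !big_nil addr0.
rewrite !big_cons; set P := \prod_(j <- r) _ in IH *; set Q := \sum_(j <- r) _ in IH *.
have Q0 : 0 <= Q by apply: sumr_ge0 => j _; rewrite -expr2 sqr_ge0.
have := sqr_ge0 (x 0 i); rewrite expr2; set z := x 0 i * x 0 i => z0.
by nra.
Qed.

Definition gaussC a : R := (1 + 2 / a) ^+ 2 ^+ n.

(** Coordinatewise, (1 + y^2) e^(-a y^2 / 2) is bounded because e^u >= 1 + u. *)
Lemma gauss_jap a x : 0 < a -> gauss a x <= gaussC a * (jap x)^-1 ^+ 2.
Proof.
move=> a0; rewrite exprVn ler_pdivlMr ?exprn_gt0 ?jap_gt0//.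
rewrite gauss_prod /jap -prodrXl -big_split /= /gaussC.
rewrite (_ : (1 + 2 / a) ^+ 2 ^+ n = \prod_(i < n) (1 + 2 / a) ^+ 2); last by rewrite prodr_const card_ord.
apply: ler_prod => i _; rewrite mulr_ge0 ?expR_ge0 ?exprn_ge0 ?addr_ge0 ?sqr_ge0//=.
set y := x 0 i; rewrite expRN ler_pdivrMl ?expR_gt0//.
have h1 : 1 + y ^+ 2 <= (1 + 2 / a) * expR (a / 2 * y ^+ 2).
  have h := expR_ge1Dx (a / 2 * y ^+ 2).
  have c0 : 0 <= 1 + 2 / a by rewrite addr_ge0// divr_ge0// ltW.
  apply: le_trans (ler_wpM2l c0 h).
  have an : a != 0 by rewrite lt0r_neq0.
  have -> : (1 + 2 / a) * (1 + a / 2 * y ^+ 2) = 1 + y ^+ 2 + 2 / a + a / 2 * y ^+ 2 by field; rewrite ?an.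
  have := divr_ge0 (ler0n R 2) (ltW a0); have : 0 <= a / 2 * y ^+ 2.
    by rewrite mulr_ge0 ?sqr_ge0// divr_ge0// ltW.
  lra.
have -> : expR (a * y ^+ 2) = expR (a / 2 * y ^+ 2) ^+ 2.
  by rewrite -expRM_natl; congr expR; field.
by rewrite mulrC -exprMn lerXn2r// nnegrE ?addr_ge0 ?sqr_ge0// mulr_ge0 ?expR_ge0// addr_ge0// divr_ge0// ltW.
Qed.

Lemma gaussC_ge0 a : 0 <= gaussC a.
Proof. by rewrite exprn_ge0 ?sqr_ge0. Qed.

Lemma japV_le1 x : (jap x)^-1 <= 1.
Proof. by rewrite invf_le1 ?jap_gt0 ?jap_ge1. Qed.

Lemma gauss_le_japV a x : 0 < a -> gauss a x <= gaussC a * (jap x)^-1.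
Proof.
move=> a0; apply: le_trans (gauss_jap x a0) _; apply: ler_wpM2l; first exact: gaussC_ge0.
by rewrite expr2 ler_piMr ?japV_le1// invr_ge0 ltW// jap_gt0.
Qed.

Lemma gauss_coord_le a x i : 0 < a -> gauss a x * `|x 0 i| <= gaussC a * (jap x)^-1.
Proof.
move=> a0; apply: le_trans (ler_pM (ltW (gauss_gt0 _ _)) (normr_ge0 _) (gauss_jap x a0) (coord_le_jap x i)) _.
by rewrite expr2 mulrA mulfVK// gt_eqF// jap_gt0.
Qed.

Lemma is_derive_gauss a x i :
  is_derive x (delta_mx 0 i) (gauss a) (- (2 * a) * x 0 i * gauss a x).
Proof.
have h : is_derive x (delta_mx 0 i) (fun y : V => - (a * dotp y y)) (- (2 * a) * x 0 i).
  suff : is_derive (0 *: delta_mx 0 i + x) (delta_mx 0 i) (fun y : V => - (a * dotp y y)) (- (2 * a) * x 0 i).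
    by rewrite scale0r add0r.
  apply/(is_derive_line (fun y : V => - (a * dotp y y))).
  rewrite (_ : (fun _ => _) = (fun h : R => - a * (h * h) + (- (2 * a) * x 0 i * h - a * dotp x x))).
    by apply: is_derive_eq; rewrite /GRing.scale /=; ring.
  apply/funext => h; rewrite /dotp.
  rewrite (eq_bigr (fun j => (h * h + 2 * h * x 0 i) * (j == i)%:R + x 0 j * x 0 j)); last first.
    by move=> j _; rewrite !mxE eqxx /=; case: eqVneq => [->|_] /=; ring.
  have S1 : \sum_(j < n) (j == i)%:R = 1 :> R.
    by rewrite (bigD1 i)//= eqxx big1 ?addr0// => j /negPf ->.
  by rewrite big_split /= -big_distrr /= S1; ring.
by have := is_derive_comp1 h (is_derive_expR _); rewrite mulrC.
Qed.

Lemma continuous_dotpxx : continuous (fun x : V => dotp x x).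
Proof.
have h (r : seq 'I_n) : continuous (fun y : V => \sum_(i <- r) y 0 i * y 0 i).
  elim: r => [|i r IH].
    rewrite (_ : (fun _ => _) = (fun=> 0)); first exact: cont_cst.
    by apply/funext => y; rewrite big_nil.
  rewrite (_ : (fun _ => _) = (fun y : V => y 0 i * y 0 i +
      \sum_(j <- r) y 0 j * y 0 j)); last by apply/funext => y; rewrite big_cons.
  by apply: contD IH; apply: contM; exact: continuous_coord.
exact: (h (index_enum _)).
Qed.

Lemma continuous_gauss a : continuous (gauss a).
Proof.
apply: (continuous_comp1 (phi := @expR R)); first exact: continuous_expR.
apply: contN; apply: contM; [exact: cont_cst|exact: continuous_dotpxx].
Qed.

Lemma ccont_real (h : V -> R) : continuous h -> ccont (fun x => (h x)%:C).
Proof. by move=> ch; split => //; exact: cont_cst. Qed.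

Lemma measurable_gauss a : measurable_fun setT (fun t : T => gauss a (vec t)).
Proof. exact: (@continuous_measurable_vec R n (gauss a) (@continuous_gauss a)). Qed.

(** The Gaussian is a multiple of a centred normal density of variance 1/(2a). *)
Lemma integral_line_gauss (a : R) : 0 < a ->
  (@lebesgue_measure R).-integrable setT (EFin \o (fun x : R => expR (- (a * x ^+ 2)))) /\
  \int[@lebesgue_measure R]_x expR (- (a * x ^+ 2)) = Num.sqrt (pi / a).
Proof.
move=> a0; pose s := Num.sqrt (2 * a)^-1.
have a20 : 0 < 2 * a by rewrite mulr_gt0.
have s0 : s != 0 by rewrite gt_eqF// sqrtr_gt0 invr_gt0.
have s2 : s ^+ 2 = (2 * a)^-1 by rewrite sqr_sqrtr// invr_ge0 ltW.
have pk : normal_peak s != 0 by rewrite gt_eqF// normal_peak_gt0.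
have E (y : R) : expR (- (a * y ^+ 2)) = (normal_peak s)^-1 * normal_pdf 0 s y.
  rewrite normal_pdfE// mulKf// /normal_fun; congr expR.
  by rewrite s2 subr0; field; rewrite lt0r_neq0.
have i1 := integrable_normal_pdf 0 s.
rewrite (_ : (fun x : R => _) = (fun y : R => (normal_peak s)^-1 * normal_pdf 0 s y)); last first.
  by apply/funext => y; exact: E.
split; first exact: (integrable_scale _ i1).
rewrite RintegralZl// /Rintegral integral_normal_pdf /= mulr1 /normal_peak invrK s2.
by congr Num.sqrt; field; rewrite lt0r_neq0.
Qed.

Definition gmass a : R := Num.sqrt (pi / a) ^+ n.

Lemma integral_gauss a : 0 < a ->
  (Lb n).-integrable setT (EFin \o (fun t : T => gauss a (vec t))) /\
  \int[Lb n]_t gauss a (vec t) = gmass a.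
Proof.
move=> a0; have [i1 e1] := integral_line_gauss a0.
have E : (\int[Lb n]_t (gauss a (vec t))%:E)%E = (gmass a)%:E.
  under eq_integral do rewrite gauss_prod.
  rewrite (ge0_integral_Rn_prod n (h := fun y : R => expR (- (a * y ^+ 2)))) ?e1//.
    have c : continuous (fun x : R => expR (- (a * x ^+ 2))).
      move=> y; apply: continuous_comp; last exact: continuous_expR.
      by apply: cvgN; apply: cvgM; [exact: cvg_cst|exact: exprn_continuous].
    exact: continuous_measurable_fun.
split.
  apply: ge0_integrableR; rewrite ?E ?ltry//; first exact: measurable_gauss.
  by move=> t; exact: expR_ge0.
by rewrite /Rintegral E.
Qed.

(** A Gaussian and its Fourier transform gauss (pi^2 / a) have reciprocal masses; so
    the convolution kernels of Gaussian summation have mass one. *)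
Lemma gmass_mul a : 0 < a -> gmass a * gmass (pi ^+ 2 / a) = 1.
Proof.
move=> a0; have p0 := pi_gt0 R.
rewrite /gmass -exprMn -sqrtrM ?divr_ge0 ?ltW//.
rewrite (_ : _ * _ = 1) ?sqrtr1 ?expr1n//.
have an : a != 0 by rewrite lt0r_neq0.
have pn : pi != 0 :> R by rewrite lt0r_neq0.
move: (pi : R) pn => p pn; field.
by rewrite ?an ?pn.
Qed.

End Gaussian.

Section FubiniComplex.
Context {d1 d2} {T1 : measurableType d1} {T2 : measurableType d2} {R : realType}.
Variables (m1 : {sigma_finite_measure set T1 -> \bar R})
          (m2 : {sigma_finite_measure set T2 -> \bar R}).

Lemma integrable_prod (g1 : T1 -> R) (g2 : T2 -> R) :
  m1.-integrable setT (EFin \o g1) -> m2.-integrable setT (EFin \o g2) ->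
  (m1 \x m2)%E.-integrable setT (EFin \o (fun z => g1 z.1 * g2 z.2)).
Proof.
move=> i1 i2; have /integrableP[/measurable_EFinP mg1 _] := i1.
have /integrableP[/measurable_EFinP mg2 _] := i2.
have mg : measurable_fun setT (fun z : T1 * T2 => g1 z.1 * g2 z.2).
  apply: measurable_funM.
    by apply: (measurableT_comp mg1); exact: measurable_fst.
  by apply: (measurableT_comp mg2); exact: measurable_snd.
apply/integrable12ltyP; first exact/measurable_EFinP.
rewrite (_ : (integral _ _ _) = \int[m1]_x (`|g1 x|%:E * (\int[m2]_y `|g2 y|)%:E))%E; last first.
  apply: eq_integral => x _.
  under eq_integral do rewrite /= normrM EFinM.
  rewrite integralZl//; last exact: integrable_norm.
  rewrite fineK//; exact/integrable_fin_num/integrable_norm.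
rewrite integralZr//; last exact: integrable_norm.
by apply: lte_mul_pinfty; rewrite ?integral_ge0//; [exact/integrable_fin_num/integrable_norm|exact: ltry].
Qed.

Lemma Rintegral_fubini (f : T1 * T2 -> R) :
  (m1 \x m2)%E.-integrable setT (EFin \o f) ->
  (forall x, m2.-integrable setT (EFin \o (fun y => f (x, y)))) ->
  (forall y, m1.-integrable setT (EFin \o (fun x => f (x, y)))) ->
  m1.-integrable setT (EFin \o (fun x => \int[m2]_y f (x, y))) /\
  \int[m1]_x \int[m2]_y f (x, y) = \int[m2]_y \int[m1]_x f (x, y).
Proof.
move=> fi f1 f2.
have E1 x : (\int[m2]_y (f (x, y))%:E)%E = (\int[m2]_y f (x, y))%:E.
  by rewrite fineK//; exact: integrable_fin_num (f1 x).
have E2 y : (\int[m1]_x (f (x, y))%:E)%E = (\int[m1]_x f (x, y))%:E.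
  by rewrite fineK//; exact: integrable_fin_num (f2 y).
split.
  have := integrable_fubini_F fi; apply: eq_integrable => // x _.
  by rewrite /fubini_F E1.
have := Fubini fi; rewrite /=.
under eq_integral do rewrite E1.
under [RHS]eq_integral do rewrite E2.
by move=> H; rewrite /Rintegral H.
Qed.

Lemma cint_fubini (K : T1 * T2 -> R[i]) : cintg (m1 \x m2)%E K ->
  (forall x, cintg m2 (fun y => K (x, y))) -> (forall y, cintg m1 (fun x => K (x, y))) ->
  cintg m1 (fun x => cint m2 (fun y => K (x, y))) /\
  cint m1 (fun x => cint m2 (fun y => K (x, y))) = cint m2 (fun y => cint m1 (fun x => K (x, y))).
Proof.
move=> [Kr Ki] K1 K2.
have [i1 e1] := Rintegral_fubini Kr (fun x => (K1 x).1) (fun y => (K2 y).1).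
have [i2 e2] := Rintegral_fubini Ki (fun x => (K1 x).2) (fun y => (K2 y).2).
by split; [split|rewrite /cint; congr (_ +i* _)].
Qed.

End FubiniComplex.

Section Fourier.
Context {R : realType} {n : nat}.
Local Notation V := 'rV[R]_n.
Local Notation T := (n.-tuple (measurableTypeR R)).
Implicit Types (a : R) (x v t : V) (i : 'I_n) (H : V -> R[i]).

Definition ker v x : R[i] := cis (- (2 * pi * dotp v x)).

Lemma kerE v x : ker v x = cis (- (2 * pi) * dotp v x).
Proof. by rewrite /ker mulNr. Qed.

Lemma dotpC v x : dotp v x = dotp x v.
Proof. by apply: eq_bigr => i _; rewrite mulrC. Qed.

Lemma dotpDr v x y : dotp v (x + y) = dotp v x + dotp v y.
Proof. by rewrite /dotp -big_split; apply: eq_bigr => i _; rewrite mxE mulrDr. Qed.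

Lemma dotpDl v x y : dotp (x + y) v = dotp x v + dotp y v.
Proof. by rewrite dotpC dotpDr !(dotpC v). Qed.

Lemma dotpZr c v x : dotp v (c *: x) = c * dotp v x.
Proof. by rewrite /dotp big_distrr; apply: eq_bigr => i _; rewrite mxE mulrCA. Qed.

Lemma dotpNr v x : dotp v (- x) = - dotp v x.
Proof. by rewrite -scaleN1r dotpZr mulN1r. Qed.

Lemma kerC v x : ker v x = ker x v.
Proof. by rewrite /ker dotpC. Qed.

Lemma cmod_ker v x : cmod (ker v x) = 1.
Proof. exact: cmod_cis. Qed.

Lemma ker_opp v x : ker v (- x) = cis (2 * pi * dotp v x).
Proof. by rewrite /ker dotpNr mulrN opprK. Qed.

Lemma ker0 v : ker v 0 = 1.
Proof. by rewrite /ker -(scale0r 0) dotpZr mul0r mulr0 oppr0 cis0. Qed.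

Lemma ker_negC t v : ker t (- v) = ker (- t) v.
Proof. by rewrite [RHS]kerC /ker !dotpNr [dotp v t]dotpC. Qed.

Lemma kerDr v x y : ker v (x + y) = ker v x * ker v y.
Proof. by rewrite /ker dotpDr mulrDr opprD cisD. Qed.

Lemma kerDl v w x : ker (v + w) x = ker v x * ker w x.
Proof. by rewrite ![ker _ x]kerC kerDr. Qed.

Lemma has_pd_ker v x i : has_pd i (ker v) x ('i * (- (2 * pi) * v 0 i)%:C * ker v x).
Proof.
rewrite kerE (_ : ker v = fun y => cis (- (2 * pi) * dotp v y)); first exact: has_pd_cis_dotp.
by apply/funext => y; rewrite kerE.
Qed.

Lemma smooth_ker v : Cinf (ker v).
Proof.
rewrite (_ : ker v = fun y => cis (- (2 * pi) * dotp v y)); first exact: smooth_cis_dotp.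
by apply/funext => y; rewrite kerE.
Qed.

Lemma measurable_dotp : measurable_fun setT (fun z : T * T => dotp (vec z.1) (vec z.2)).
Proof.
rewrite /dotp; apply: measurable_sum => i; apply: measurable_funM.
  by apply: (measurableT_comp (measurable_entry i)); exact: measurable_fst.
by apply: (measurableT_comp (measurable_entry i)); exact: measurable_snd.
Qed.

Lemma cmeas_ker2 : cmeas (fun z : T * T => ker (vec z.1) (vec z.2)).
Proof.
apply: cmeas_cis; apply: measurable_funN; apply: measurable_funM; first exact: measurable_cst.
exact: measurable_dotp.
Qed.

Lemma cmeas_ker v : cmeas (fun z : T => ker v (vec z)).
Proof. exact: ccont_cmeas (smooth_ccont (smooth_ker v)). Qed.

Lemma cmeas_kerN t : cmeas (fun z : T => ker t (- vec z)).
Proof.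
rewrite (_ : (fun z : T => ker t (- vec z)) = (fun z : T => ker (- t) (vec z))); first exact: cmeas_ker.
by apply/funext => z; exact: ker_negC.
Qed.

Lemma cmod_mul_ker z v x : cmod (z * ker v x) = cmod z.
Proof. by rewrite cmodM cmod_ker mulr1. Qed.

Definition fourier H v := cint (Lb n) (fun t : T => H (vec t) * ker v (vec t)).

Lemma cintg_ker H v : cintg (Lb n) (fun t : T => H (vec t)) ->
  cintg (Lb n) (fun t : T => H (vec t) * ker v (vec t)).
Proof.
move=> iH; apply: cintg_dom (cintg_cmod iH).
  exact: (cmeasM (cintg_meas iH) (cmeas_ker v)).
by move=> t; rewrite cmod_mul_ker.
Qed.

Lemma has_pd0_const (Q : V -> R[i]) : (forall i x, has_pd i Q x 0) -> forall x, Q x = Q 0.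
Proof.
move=> dQ x; apply: complex_ext.
  have := lipschitz_bound (F := fun y => complex.Re (Q y)) (G := fun i y => 0) (M := 0)
    (fun i y => (dQ i y).1) (fun i y => _) 0 x.
  by rewrite mul0r normr0 => /(_ (fun _ _ => lexx _)); rewrite normr_le0 subr_eq0 => /eqP.
have := lipschitz_bound (F := fun y => complex.Im (Q y)) (G := fun i y => 0) (M := 0)
  (fun i y => (dQ i y).2) (fun i y => _) 0 x.
by rewrite mul0r normr0 => /(_ (fun _ _ => lexx _)); rewrite normr_le0 subr_eq0 => /eqP.
Qed.

(** The transform I solves d_i I = - (2 pi^2 / a) v_i I (differentiate under the
    integral sign, then integrate by parts), so that I divided by the Gaussian on
    the right is constant. *)
Lemma fourier_gauss a v : 0 < a ->
  fourier (fun x => (gauss a x)%:C) v = (gmass (n := n) a * gauss (pi ^+ 2 / a) v)%:C.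
Proof.
move=> a0; have an : a != 0 by rewrite lt0r_neq0.
pose I w := fourier (fun x => (gauss a x)%:C) w.
have cgk w : ccont (fun x => (gauss a x)%:C * ker w x).
  apply: ccontM; first exact: ccont_real (@continuous_gauss _ _ a).
  exact: smooth_ccont (smooth_ker w).
have gn x : cmod (gauss a x)%:C = gauss a x by rewrite cmod_real ger0_norm// ltW// gauss_gt0.
have igk w : cintg (Lb n) (fun t : T => (gauss a (vec t))%:C * ker w (vec t)).
  apply: (cintg_jap (F := fun x => (gauss a x)%:C * ker w x) (c := gaussC (n := n) a)) => //.
  by move=> x; rewrite cmod_mul_ker gn gauss_le_japV.
pose M i w := cint (Lb n) (fun t : T => (vec t 0 i * gauss a (vec t))%:C * ker w (vec t)).
have iM i w : cintg (Lb n) (fun t : T => (vec t 0 i * gauss a (vec t))%:C * ker w (vec t)).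
  apply: (cintg_jap (F := fun x => (x 0 i * gauss a x)%:C * ker w x) (c := gaussC (n := n) a)).
    apply: ccontM; last exact: smooth_ccont (smooth_ker w).
    by apply: ccont_real; apply: contM; [exact: continuous_coord|exact: continuous_gauss].
  by move=> x; rewrite cmod_mul_ker cmod_real normrM (ger0_norm (ltW (gauss_gt0 _ _))) mulrC gauss_coord_le.
have dI i w : has_pd i I w ('i * (- (2 * pi))%:C * M i w).
  have -> : 'i * (- (2 * pi))%:C * M i w = cint (Lb n) (fun t : T =>
      (gauss a (vec t))%:C * ('i * (- (2 * pi) * vec t 0 i)%:C * ker w (vec t))).
    rewrite -cintMl//; apply: eq_cint => t; rewrite !rmorphM /=; ring.
  pose F (w : V) (t : T) := (gauss a (vec t))%:C * ker w (vec t).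
  pose DF (w : V) (t : T) := (gauss a (vec t))%:C * ('i * (- (2 * pi) * vec t 0 i)%:C * ker w (vec t)).
  pose G (t : T) : R := (2 * pi * gaussC (n := n) a) * (jap (vec t))^-1.
  apply: (@has_pd_cint R n _ T (Lb n) F DF G i w).
  - exact: igk.
  - move=> y t; apply: has_pdMl; rewrite kerC (_ : ker^~ (vec t) = ker (vec t)).
      exact: has_pd_ker.
    by apply/funext => z; rewrite kerC.
  - exact: integrable_scale (integrable_japV n).
  - move=> h t _; rewrite /DF cmodM gn cmod_mul_ker cmodM cmod_real normrM normrN.
    rewrite cmod_i.
    rewrite mul1r (ger0_norm (x := 2 * pi)) ?mulr_ge0 ?pi_ge0// mulrCA /G.
    rewrite -[leRHS]mulrA; apply: ler_wpM2l; first by rewrite mulr_ge0 ?pi_ge0.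
    exact: gauss_coord_le.
have ibp i w : (- (2 * a))%:C * M i w + 'i * (- (2 * pi) * w 0 i)%:C * I w = 0.
  rewrite -!cintMl// -cintD; [|exact: cintgMl..].
  rewrite -[RHS](cint_pderiv0 (F := fun x => (gauss a x)%:C * ker w x)
    (DF := fun x => (- (2 * a) * x 0 i * gauss a x)%:C * ker w x +
       (gauss a x)%:C * ('i * (- (2 * pi) * w 0 i)%:C * ker w x))
    (c := (2 * a + 2 * pi * `|w 0 i|) * gaussC (n := n) a) (i := i)) //.
  - by apply: eq_cint => t; rewrite !rmorphM /=; ring.
  - move=> x; apply: has_pdM; last exact: has_pd_ker.
    by split; [exact: is_derive_gauss|exact: is_derive_cst].
  - by rewrite mulr_ge0 ?gaussC_ge0// addr_ge0 ?mulr_ge0 ?pi_ge0// ltW.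
  - move=> x; apply: le_trans (le_normcD _ _) _.
    rewrite cmod_mul_ker cmodM cmod_mul_ker cmodM !cmod_real.
    rewrite cmod_i.
    rewrite mul1r !normrM !normrN (ger0_norm (ltW (gauss_gt0 a x))).
    rewrite (ger0_norm (x := 2 * pi)) ?mulr_ge0 ?pi_ge0//.
    have a20 : 0 <= 2 * a by rewrite mulr_ge0// ltW.
    rewrite (ger0_norm a20) [leRHS](_ : _ = 2 * a * (gaussC (n := n) a / jap x) +
      2 * pi * `|w 0 i| * (gaussC (n := n) a / jap x)); last by ring.
    apply: lerD.
      by rewrite -[leLHS]mulrA; apply: ler_wpM2l => //; rewrite mulrC; exact: gauss_coord_le.
    rewrite mulrC; apply: ler_wpM2l; last exact: gauss_le_japV.
    by rewrite mulr_ge0 ?normr_ge0// mulr_ge0 ?pi_ge0.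
pose b := pi ^+ 2 / a.
(* 2a times this derivative is a multiple of ibp, since 2a * 2b = (2 pi)^2. *)
have key i w : has_pd i (fun w => I w * (gauss (- b) w)%:C) w 0.
  have hg : has_pd i (fun w => (gauss (- b) w)%:C) w (- (2 * - b) * w 0 i * gauss (- b) w)%:C.
    by split; [exact: is_derive_gauss|exact: is_derive_cst].
  have := has_pdM (dI i w) hg; congr (has_pd _ _ _ _).
  have a2 : (2 * a)%:C != 0 :> R[i].
    by apply/eqP => /complexI/eqP; rewrite mulf_eq0 pnatr_eq0 /= (negPf an).
  apply: (mulfI a2); rewrite mulr0.
  have -> : (2 * a)%:C * ('i * (- (2 * pi))%:C * M i w * (gauss (- b) w)%:C + I w * (- (2 * - b) * w 0 i * gauss (- b) w)%:C)
    = ('i * (2 * pi)%:C) * (gauss (- b) w)%:C * ((- (2 * a))%:C * M i w + 'i * (- (2 * pi) * w 0 i)%:C * I w)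
      + I w * (gauss (- b) w)%:C * ('i * 'i * (2 * pi)%:C * (2 * pi * w 0 i)%:C + (2 * a)%:C * (2 * b * w 0 i)%:C).
    by rewrite !(rmorphM, rmorphN) /=; ring.
  rewrite ibp mulr0 add0r -expr2 sqr_i.
  have -> : -1 * (2 * pi)%:C * (2 * pi * w 0 i)%:C + (2 * a)%:C * (2 * b * w 0 i)%:C = 0 :> R[i].
      have ab : a * b = pi ^+ 2 by rewrite /b mulrC mulfVK.
    have -> : (2 * a)%:C * (2 * b * w 0 i)%:C = (2 * pi)%:C * (2 * pi * w 0 i)%:C :> R[i].
      rewrite -!rmorphM; congr (_%:C).
      by rewrite (_ : 2 * a * _ = 4 * (a * b) * w 0 i); [rewrite ab; ring|ring].
    by rewrite mulN1r mulNr addNr.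
  by rewrite mulr0.
have := has_pd0_const key v; rewrite /= -/(I v).
have -> : gauss (- b) (0 : V) = 1 by rewrite /gauss -(scale0r 0) dotpZr mul0r mulr0 oppr0 expR0.
have -> : I 0 = (gmass (n := n) a)%:C.
  rewrite /I /fourier /cint (_ : Rintegral _ _ _ = gmass (n := n) a); last first.
    rewrite -(integral_gauss (n := n) a0).2; apply: eq_Rintegral => t _.
    by rewrite kerC ker0 mulr1.
  rewrite (_ : Rintegral _ _ _ = 0)//.
  rewrite (eq_Rintegral _ (g := fun=> 0)); first by rewrite Rintegral_cst// mul0r.
  by move=> t _; rewrite kerC ker0 mulr1.
move=> E; have g1 : (gauss (- b) v)%:C * (gauss b v)%:C = 1 :> R[i].
  by rewrite -rmorphM /= /gauss -expRD mulNr opprK subrr expR0.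
rewrite -/b; transitivity (I v * (gauss (- b) v)%:C * (gauss b v)%:C).
  by rewrite -mulrA g1 mulr1.
by rewrite E mulr1 -rmorphM.
Qed.

End Fourier.

(** * Fourier inversion *)

Section FourierInversion.
Context {R : realType} {n : nat}.
Local Notation V := 'rV[R]_n.
Local Notation T := (n.-tuple (measurableTypeR R)).
Implicit Types (a : R) (x v t : V) (i : 'I_n) (H : V -> R[i]).

Lemma cintg_dom_ae d (S : measurableType d) (mu : {measure set S -> \bar R})
    (F : S -> R[i]) (G : S -> R) : cmeas F -> (forall y, 0 <= G y) ->
  {ae mu, forall y, cmod (F y) <= G y} -> mu.-integrable setT (EFin \o G) -> cintg mu F.
Proof.
move=> mF G0 FG iG; suff iF : mu.-integrable setT (EFin \o (fun y => cmod (F y))).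
  exact: cintg_dom mF (fun=> lexx _) iF.
apply: ge0_integrableR; [exact: cmeas_cmod|by move=> y; exact: cmod_ge0|].
apply: le_lt_trans (integrable_lty measurableT iG).
have /integrableP[mG _] := iG.
apply: ae_ge0_le_integral => //.
- by move=> x _; rewrite lee_fin cmod_ge0.
- by apply/measurable_EFinP; exact: cmeas_cmod.
- by move=> x _; rewrite lee_fin.
- by apply: filterS FG => x hx _; rewrite lee_fin.
Qed.

(** Gaussian summation: the Gaussian mean of the inverse Fourier integral is the
    convolution of H with a Gaussian of mass one. *)
Lemma fourier_gauss_mean H t a : 0 < a -> ccont H -> cintg (Lb n) (fun x : T => H (vec x)) ->
  cintg (Lb n) (fun v : T => (gauss a (vec v))%:C * ker t (- vec v) * fourier H (vec v)) /\
  cint (Lb n) (fun v : T => (gauss a (vec v))%:C * ker t (- vec v) * fourier H (vec v)) =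
  cint (Lb n) (fun x : T => H (vec x) * (gmass (n := n) a * gauss (pi ^+ 2 / a) (vec x - t))%:C).
Proof.
move=> a0 cH iH.
pose K (z : T * T) := (gauss a (vec z.1))%:C * ker t (- vec z.1) * (H (vec z.2) * ker (vec z.1) (vec z.2)).
have [ig _] := integral_gauss (n := n) a0.
have mkt := cmeas_kerN t.
have mgk : cmeas (fun v : T => (gauss a (vec v))%:C * ker t (- vec v)).
  by apply: cmeasM => //; exact: cmeas_real (measurable_gauss a).
have comp_fst (F : T -> R[i]) : cmeas F -> cmeas (fun z : T * T => F z.1).
  move=> [h1 h2]; split; first by apply: (measurableT_comp h1); exact: measurable_fst.
  by apply: (measurableT_comp h2); exact: measurable_fst.
have comp_snd (F : T -> R[i]) : cmeas F -> cmeas (fun z : T * T => F z.2).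
  move=> [h1 h2]; split; first by apply: (measurableT_comp h1); exact: measurable_snd.
  by apply: (measurableT_comp h2); exact: measurable_snd.
have modK z : cmod (K z) = gauss a (vec z.1) * cmod (H (vec z.2)).
  by rewrite /K cmodM !cmod_mul_ker cmod_real ger0_norm// ltW// gauss_gt0.
have iK : cintg (Lb n \x Lb n)%E K.
  apply: cintg_dom (integrable_prod ig (cintg_cmod iH)).
    apply: cmeasM; first exact: comp_fst mgk.
    by apply: cmeasM; [exact: comp_snd (cintg_meas iH)|exact: cmeas_ker2].
  by move=> z; rewrite modK.
have iK1 (v : T) : cintg (Lb n) (fun y : T => K (v, y)).
  exact: (cintgMl ((gauss a (vec v))%:C * ker t (- vec v)) (cintg_ker (vec v) iH)).
have KE (v y : T) : K (v, y) = H (vec y) * ((gauss a (vec v))%:C * ker (vec y - t) (vec v)).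
  rewrite /K /=; have -> : ker (vec y - t) (vec v) = ker t (- vec v) * ker (vec v) (vec y).
    by rewrite kerDl [ker (vec v) _]kerC mulrC; congr (_ * _); rewrite /ker dotpNr dotpC dotpNr dotpC.
  by ring.
have ikg w : cintg (Lb n) (fun v : T => (gauss a (vec v))%:C * ker w (vec v)).
  apply: cintg_dom ig.
    by apply: cmeasM; [exact: cmeas_real (measurable_gauss a)|exact: cmeas_ker].
  by move=> v; rewrite cmod_mul_ker cmod_real ger0_norm// ltW// gauss_gt0.
have iK2 (y : T) : cintg (Lb n) (fun v : T => K (v, y)).
  have -> : (fun v : T => K (v, y)) = (fun v : T => H (vec y) * ((gauss a (vec v))%:C * ker (vec y - t) (vec v))).
    by apply/funext => v; exact: KE.
  exact: cintgMl.
have [i1 e1] := cint_fubini iK iK1 iK2.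
have E (v : T) : cint (Lb n) (fun y : T => K (v, y)) = (gauss a (vec v))%:C * ker t (- vec v) * fourier H (vec v).
  rewrite /fourier -(cintMl _ (cintg_ker (vec v) iH)); reflexivity.
have F1 : (fun v : T => cint (Lb n) (fun y : T => K (v, y))) =
  (fun v : T => (gauss a (vec v))%:C * ker t (- vec v) * fourier H (vec v)) by apply/funext => v; exact: E.
rewrite F1 in i1 e1; split; first exact: i1.
rewrite e1; apply: eq_cint => y.
rewrite -(fourier_gauss _ a0) /fourier -cintMl//.
by apply: eq_cint => v; exact: KE.
Qed.

(** Fubini gives measurability of the transform times a Gaussian; divide by the
    Gaussian. *)
Lemma cmeas_fourier H : ccont H -> cintg (Lb n) (fun x : T => H (vec x)) ->
  cmeas (fun v : T => fourier H (vec v)).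
Proof.
move=> cH iH; have [i1 _] := fourier_gauss_mean 0 ltr01 cH iH.
have -> : (fun v : T => fourier H (vec v)) = (fun v : T => (gauss (- 1) (vec v))%:C *
    ((gauss 1 (vec v))%:C * ker 0 (- vec v) * fourier H (vec v))).
  apply/funext => v; rewrite !mulrA -rmorphM /= /gauss -expRD mulN1r opprK mul1r subrr expR0.
  by rewrite mul1r kerC ker0 mul1r.
by apply: cmeasM; [exact: cmeas_real (measurable_gauss _)|exact: cintg_meas i1].
Qed.

Lemma gmass_gt0 a : 0 < a -> 0 < gmass (R := R) (n := n) a.
Proof. by move=> a0; rewrite exprn_gt0// sqrtr_gt0 divr_gt0// pi_gt0. Qed.

(** The mass gmass (pi^2 / b) grows like b^(n/2) only, so that for large b it is
    beaten by the exponential at distance r. *)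
Lemma gauss_concentration (B r e : R) : 1 <= B -> 0 < r -> 0 < e -> exists2 b, B <= b &
  gmass (R := R) (n := n) (pi ^+ 2 / b) * expR (- ((b - 1) * r ^+ 2)) <= e.
Proof.
move=> B1 r0 e0; have p1 : 1 <= pi :> R by have := @pi_ge2 R; lra.
have p0 : 0 < pi :> R by exact: pi_gt0.
have r20 : 0 < r ^+ 2 by rewrite exprn_gt0.
pose q := (r ^+ 2) ^+ n.+1 / n.+1`!%:R.
have q0 : 0 < q by rewrite divr_gt0 ?exprn_gt0// ltr0n fact_gt0.
pose b := Num.max B (expR (r ^+ 2) / (q * e)).
have bB : B <= b by rewrite le_max lexx.
have b1 : 1 <= b := le_trans B1 bB.
have b0 : 0 < b := lt_le_trans ltr01 b1.
exists b => //.
have m1 : gmass (R := R) (n := n) (pi ^+ 2 / b) <= b ^+ n.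
  rewrite /gmass; apply: lerXn2r; [by rewrite nnegrE sqrtr_ge0|by rewrite nnegrE ltW|].
  rewrite -[leRHS]ger0_norm ?(ltW b0)// -sqrtr_sqr ler_wsqrtr//.
  rewrite invfM invrK mulrA expr2 invfM mulrA divff ?gt_eqF// mul1r.
  rewrite expr2 ler_pM2r// (le_trans _ b1)// invf_le1//.
have h1 : q * b ^+ n.+1 <= expR (b * r ^+ 2).
  apply: le_trans (@expR_ge1Dxn R (b * r ^+ 2) n _); last by rewrite mulr_ge0// ltW.
  have -> : q * b ^+ n.+1 = (b * r ^+ 2) ^+ n.+1 / n.+1`!%:R.
    by rewrite /q; move: (n.+1`!%:R : R) (r ^+ 2) => f y; rewrite exprMn; ring.
  by rewrite lerDr ler01.
apply: le_trans (ler_wpM2r (expR_ge0 _) m1) _.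
rewrite mulrBl mul1r opprB expRD expRN.
rewrite mulrA ler_pdivrMr ?expR_gt0//.
have h2 : expR (r ^+ 2) <= b * (q * e).
  have : expR (r ^+ 2) / (q * e) <= b by rewrite /b le_max lexx orbT.
  by rewrite ler_pdivrMr// mulr_gt0.
apply: le_trans (_ : e * (q * b ^+ n.+1) <= _); last by rewrite ler_pM2l.
have -> : e * (q * b ^+ n.+1) = b ^+ n * (b * (q * e)) by rewrite exprS; ring.
by rewrite ler_pM2l// exprn_gt0.
Qed.

Lemma le0_small (x K : R) : 0 <= K -> (forall e, 0 < e -> x <= e * K) -> x <= 0.
Proof.
move=> K0 h; rewrite leNgt; apply/negP => x0.
have K1 : 0 < K + 1 by lra.
have /(h _) : 0 < x / (2 * (K + 1)) by rewrite divr_gt0// mulr_gt0.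
apply/negP; rewrite -ltNge mulrAC ltr_pdivrMr ?mulr_gt0//.
by rewrite ltr_pM2l//; lra.
Qed.

Lemma integral_gauss_shift a t : 0 < a ->
  (Lb n).-integrable setT (EFin \o (fun y : T => gauss a (vec y - t))) /\
  \int[Lb n]_y gauss a (vec y - t) = gmass (n := n) a.
Proof.
move=> a0; have [ig eg] := integral_gauss (n := n) a0.
have [i1 e1] := Rintegral_aff (- t) (or_introl erefl) ig.
have E : (fun y : T => gauss a (vec y - t)) = (fun y : T => gauss a (vec y)) \o aff 1 (- t).
  by apply/funext => y /=; rewrite vec_aff scale1r.
by rewrite E; split; [exact: i1|rewrite -eg; exact: e1].
Qed.

(** Near t the continuity of H makes H x - H t small, and far from t the Gaussian
    kernel is small compared with the fixed Gaussian gauss 1. *)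
Lemma gauss_mean_near H t e : ccont H -> cintg (Lb n) (fun x : T => H (vec x)) -> 0 < e ->
  forall B, 1 <= B -> exists2 b, B <= b &
  cmod (cint (Lb n) (fun x : T => H (vec x) * (gmass (n := n) (pi ^+ 2 / b) * gauss b (vec x - t))%:C) - H t)
   <= e * (2 * (1 + (\int[Lb n]_y cmod (H (vec y)) + cmod (H t) * gmass (n := n) 1))).
Proof.
move=> cH iH e0 B B1.
have e20 : 0 < e / 2 by rewrite divr_gt0.
have [d1 d10 h1] := (continuousP_entry _ t).1 (cH.1 t) _ e20.
have [d2 d20 h2] := (continuousP_entry _ t).1 (cH.2 t) _ e20.
pose r := Num.min d1 d2; have r0 : 0 < r by rewrite lt_min d10.
have near x : (forall i, `|x 0 i - t 0 i| < r) -> cmod (H x - H t) <= e.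
  move=> hx; apply: le_trans (cmod_le_ReIm _) _.
  have k1 : `|complex.Re (H x) - complex.Re (H t)| < e / 2.
    by apply: h1 => i; apply: lt_le_trans (hx i) _; rewrite ge_min lexx.
  have k2 : `|complex.Im (H x) - complex.Im (H t)| < e / 2.
    by apply: h2 => i; apply: lt_le_trans (hx i) _; rewrite ge_min lexx orbT.
  have -> : complex.Re (H x - H t) = complex.Re (H x) - complex.Re (H t) by rewrite raddfB.
  have -> : complex.Im (H x - H t) = complex.Im (H x) - complex.Im (H t) by rewrite raddfB.
  lra.
have [b bB hb] := gauss_concentration B1 r0 e0.
have b1 : 1 <= b := le_trans B1 bB.
have b0 : 0 < b := lt_le_trans ltr01 b1.
have p0 : 0 < pi ^+ 2 :> R by rewrite exprn_gt0// pi_gt0.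
have a0 : 0 < pi ^+ 2 / b by rewrite divr_gt0.
have gm0 := gmass_gt0 a0.
exists b => //.
pose k x := gmass (n := n) (pi ^+ 2 / b) * gauss b (x - t).
have k0 x : 0 <= k x by apply: mulr_ge0; apply: ltW => //; exact: gauss_gt0.
have [ib eb] := integral_gauss_shift t b0.
have [i1 e1] := integral_gauss_shift t ltr01.
have ik : (Lb n).-integrable setT (EFin \o (fun y : T => k (vec y))) by exact: integrable_scale ib.
have mm : gmass (n := n) (pi ^+ 2 / b) * gmass (n := n) b = 1.
  have := gmass_mul (n := n) a0.
  by have -> : pi ^+ 2 / (pi ^+ 2 / b) = b :> R by rewrite invfM invrK mulrA divff ?gt_eqF// mul1r.
have ek : \int[Lb n]_y k (vec y) = 1 by rewrite /k RintegralZl// eb.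
have ck : ccont (fun x => (k x)%:C).
  apply: ccont_real; rewrite /k; apply: contM; first exact: cont_cst.
  have h := continuous_comp_aff (F := gauss b) (c := 1) (a := - t) (@continuous_gauss _ _ b).
  by apply: continuous_ext h => x /=; rewrite scale1r addrC.
have ickT : cintg (Lb n) (fun y : T => (k (vec y))%:C).
  apply: cintg_dom ik; first exact: ccont_cmeas ck.
  by move=> y; rewrite cmod_real ger0_norm.
have iHk : cintg (Lb n) (fun y : T => H (vec y) * (k (vec y))%:C).
  have kb y : k y <= gmass (n := n) (pi ^+ 2 / b).
    by rewrite -[leRHS]mulr1 ler_pM2l//; apply: gauss_le1; exact: ltW.
  apply: cintg_dom (integrable_scale (gmass (n := n) (pi ^+ 2 / b)) (cintg_cmod iH)).
    by apply: cmeasM; [exact: cintg_meas iH|exact: ccont_cmeas ck].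
  move=> y; rewrite cmodM cmod_real ger0_norm// mulrC.
  by apply: ler_wpM2r; [exact: cmod_ge0|exact: kb].
have E1 : cint (Lb n) (fun y : T => (k (vec y))%:C) = 1.
  rewrite /cint /= ek; congr (_ +i* _).
  by under eq_Rintegral do rewrite /=; rewrite Rintegral_cst//= mul0r.
have iHtk := cintgMl (- H t) ickT.
have -> : cint (Lb n) (fun y : T => H (vec y) * (k (vec y))%:C) - H t =
    cint (Lb n) (fun y : T => (H (vec y) - H t) * (k (vec y))%:C).
  rewrite -[X in _ - X]mulr1 -E1 -mulNr -cintMl// -cintD//.
  by apply: eq_cint => y; rewrite mulrDl.
pose G (y : T) := e * k (vec y) + e * (cmod (H (vec y)) + cmod (H t) * gauss 1 (vec y - t)).
have iH1 := integrable_add (cintg_cmod iH) (integrable_scale (cmod (H t)) i1).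
have iG : (Lb n).-integrable setT (EFin \o G).
  by apply: integrable_add; apply: integrable_scale.
have dG (y : T) : cmod ((H (vec y) - H t) * (k (vec y))%:C) <= G y.
  rewrite cmodM cmod_real ger0_norm// /G.
  have S0 : 0 <= e * (cmod (H (vec y)) + cmod (H t) * gauss 1 (vec y - t)).
    apply: mulr_ge0; first exact: ltW.
    apply: addr_ge0; first exact: cmod_ge0.
    by apply: mulr_ge0; [exact: cmod_ge0|apply: ltW; exact: gauss_gt0].
  have [nr|] := pselect (forall i, `|(vec y) 0 i - t 0 i| < r).
    apply: le_trans (_ : e * k (vec y) <= _); last by rewrite lerDl.
    by apply: ler_wpM2r => //; exact: near.
  move=> /existsNP[i /negP]; rewrite -leNgt => far.
  apply: le_trans (_ : e * (cmod (H (vec y)) + cmod (H t) * gauss 1 (vec y - t)) <= _); last first.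
    by rewrite lerDr; apply: mulr_ge0 => //; exact: ltW.
  have dr : r ^+ 2 <= dotp (vec y - t) (vec y - t).
    rewrite /dotp (bigD1 i)//= -expr2.
    apply: le_trans (_ : ((vec y - t) 0 i) ^+ 2 <= _); last first.
      by rewrite lerDl; apply: sumr_ge0 => j _; rewrite -expr2 sqr_ge0.
    rewrite -[leRHS]real_normK ?num_real//; apply: lerXn2r; rewrite ?nnegrE ?normr_ge0 ?(ltW r0)//.
    by move: far; rewrite !mxE.
(* The Gaussian of parameter b splits into parameters 1 and b - 1. *)
  have kg : k (vec y) <= e * gauss 1 (vec y - t).
    apply: le_trans (ler_wpM2r (ltW (gauss_gt0 1 (vec y - t))) hb).
    rewrite /k /= -[leRHS]mulrA ler_pM2l// /gauss -expRD ler_expR -opprD lerN2 mul1r.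
    have : (b - 1) * r ^+ 2 <= (b - 1) * dotp (vec y - t) (vec y - t).
      by apply: ler_wpM2l => //; lra.
    lra.
  apply: le_trans (_ : (cmod (H (vec y)) + cmod (H t)) * (e * gauss 1 (vec y - t)) <= _).
    apply: ler_pM => //; first exact: cmod_ge0.
    apply: le_trans (le_normcD _ _) _.
    by rewrite (_ : cmod (- H t) = cmod (H t))// -mulN1r cmodM -[X in cmod X](rmorphN1 (real_complex R)) cmod_real normrN1 mul1r.
  rewrite mulrCA ler_pM2l// mulrDl lerD2r.
  by rewrite ler_piMr ?cmod_ge0// gauss_le1.
have iS : (Lb n).-integrable setT (EFin \o (fun y : T => cmod (H (vec y)) + cmod (H t) * gauss 1 (vec y - t))) by [].
apply: le_trans (cint_le _ dG iG) _.
  apply: cmeasM; last exact: ccont_cmeas ck.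
  by apply: cmeasD; [exact: cintg_meas iH|exact: cmeas_cst].
rewrite /G RintegralD//; [|exact: integrable_scale ik|exact: integrable_scale iS].
rewrite !RintegralZl// RintegralD//; [|exact: cintg_cmod iH|exact: integrable_scale i1].
rewrite RintegralZl// e1 eb mm.
by rewrite -mulrDr mulrCA lexx.
Qed.

(** Insert the factor gauss a under the inverse integral and let a tend to 0: the
    factor costs at most a * jap v, which the assumed decay absorbs, while the
    modified integral is the average of H against a concentrating Gaussian. *)
Theorem fourier_inversion H M t : ccont H -> cintg (Lb n) (fun x : T => H (vec x)) -> 0 <= M ->
  {ae Lb n, forall v : T, cmod (fourier H (vec v)) <= M * (jap (vec v))^-1 ^+ 2} ->
  cint (Lb n) (fun v : T => ker t (- vec v) * fourier H (vec v)) = H t.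
Proof.
move=> cH iH M0 bH.
have mkt := cmeas_kerN t.
have mI : cmeas (fun v : T => ker t (- vec v) * fourier H (vec v)).
  by apply: cmeasM => //; exact: cmeas_fourier.
have iMj : (Lb n).-integrable setT (EFin \o (fun v : T => M * (jap (vec v))^-1)).
  exact: integrable_scale (integrable_japV n).
have j0 v : 0 <= (jap v)^-1 by rewrite invr_ge0 ltW// jap_gt0.
have iJ : cintg (Lb n) (fun v : T => ker t (- vec v) * fourier H (vec v)).
  apply: cintg_dom_ae iMj => //; first by move=> y; apply: mulr_ge0.
  apply: filterS bH => v hv; rewrite mulrC cmod_mul_ker.
  apply: le_trans hv _; apply: ler_wpM2l => //.
  by rewrite expr2; apply: ler_piMr => //; exact: japV_le1.
apply/eqP; rewrite -subr_eq0; apply/eqP; apply: cmod_eq0; apply/eqP.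
rewrite eq_le cmod_ge0 andbT.
set J := cint _ _.
pose K1 : R := 2 * (1 + (\int[Lb n]_y cmod (H (vec y)) + cmod (H t) * gmass (n := n) 1)).
have K10 : 0 <= K1.
  apply: mulr_ge0 => //; apply: addr_ge0 => //; apply: addr_ge0.
    by apply: Rintegral_ge0 => y _; exact: cmod_ge0.
  by apply: mulr_ge0; [exact: cmod_ge0|apply: ltW; exact: gmass_gt0].
have p0 : 0 < pi ^+ 2 :> R by rewrite exprn_gt0// pi_gt0.
have Mj0 : 0 <= M * japint (R := R) n by apply: mulr_ge0 => //; exact: japint_ge0.
apply: (@le0_small _ (2 * (pi ^+ 2 * (M * japint n)) + K1)).
  by apply: addr_ge0 => //; apply: mulr_ge0 => //; apply: mulr_ge0 => //; exact: ltW.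
move=> e e0.
(* a = pi^2 / b is at most e * pi^2. *)
pose B := Num.max 1 e^-1; have B1 : 1 <= B by rewrite le_max lexx.
have [b bB hb] := gauss_mean_near t cH iH e0 B1.
have b0 : 0 < b by apply: lt_le_trans bB; apply: lt_le_trans B1.
pose a := pi ^+ 2 / b.
have a0 : 0 < a by rewrite divr_gt0.
have ae : a <= e * pi ^+ 2.
  rewrite /a mulrC ler_pM2r// -[leRHS]invrK lef_pV2 ?posrE ?invr_gt0//.
  by apply: le_trans bB; rewrite le_max lexx orbT.
have [iA eA] := fourier_gauss_mean t a0 cH iH.
have pab : pi ^+ 2 / a = b by rewrite /a invfM invrK mulrA divff ?gt_eqF// mul1r.
rewrite pab -/a in eA hb *; rewrite -eA in hb.
set A := cint _ _ in hb.
have iJA := cintgMl (-1) iA.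
have -> : J - H t = (J + (-1) * A) + (A - H t) by ring.
apply: le_trans (le_normcD _ _) _.
rewrite mulrDr; apply: lerD; last exact: hb.
rewrite /J /A -(cintMl (-1) iA) -(cintD iJ iJA).
have iaMj := integrable_scale a iMj.
apply: le_trans (cint_le_ae _ _ iaMj _) _.
- exact: cintgD iJ iJA.
- by move=> y; apply: mulr_ge0; [exact: ltW|apply: mulr_ge0].
- apply: filterS bH => v hv.
  have -> : ker t (- vec v) * fourier H (vec v) +
     -1 * ((gauss a (vec v))%:C * ker t (- vec v) * fourier H (vec v)) =
     (1 - gauss a (vec v))%:C * fourier H (vec v) * ker t (- vec v).
    by rewrite rmorphB rmorph1; ring.
  rewrite cmod_mul_ker cmodM cmod_real ger0_norm; last by rewrite subr_ge0 gauss_le1// ltW.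
  have g1 : 1 - gauss a (vec v) <= a * jap (vec v).
    have := expR_ge1Dx (- (a * dotp (vec v) (vec v))).
    have := ler_wpM2l (ltW a0) (dotp_le_jap (vec v)).
    rewrite /gauss; lra.
  apply: le_trans (ler_pM _ _ g1 hv) _; [by rewrite subr_ge0 gauss_le1// ltW|exact: cmod_ge0|].
  have jn : jap (vec v) != 0 by rewrite gt_eqF// jap_gt0.
  by apply: eq_lerW; rewrite expr2; field.
rewrite !RintegralZl//; last exact: integrable_japV.
rewrite -/(japint n) mulrCA -[leRHS]mulrCA.
rewrite [leRHS](_ : _ = 2 * (e * pi ^+ 2 * (M * japint n))); last by ring.
by rewrite mulrCA ler_pM2l//; apply: ler_wpM2r.
Qed.

End FourierInversion.

(** * Exponential decay of the Fourier transform and growth of derivatives *)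

Section Moments.
Context {R : realType} {n : nat}.
Variable s : R.
Hypothesis hs : 2^-1 <= s.
Local Notation V := 'rV[R]_n.
Local Notation T := (n.-tuple (measurableTypeR R)).
Implicit Types (x v t : V) (i : 'I_n) (D : seq 'I_n).

Lemma half_gt0 : 0 < s.
Proof. by apply: lt_le_trans hs; rewrite invr_gt0. Qed.

(** The p-th term of the exponential series of eps y^(1/s) / s, raised to the
    power s, is a multiple of y^p / (p!)^s. *)
Lemma powerX_expR_le (eps : R) : 0 < eps -> exists2 c, 1 <= c &
  forall p (y : R), 0 <= y -> y ^+ p * expR (- (eps * y `^ s^-1)) <= c ^+ p * fs s p.
Proof.
move=> e0; have s0 := half_gt0.
have es0 : 0 < eps / s by rewrite divr_gt0.
pose q := (eps / s) `^ s; have q0 : 0 < q by exact: powR_gt0.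
exists (Num.max 1 q^-1); first by rewrite le_max lexx.
move=> p y y0; set w := y `^ s^-1.
have w0 : 0 <= w by exact: powR_ge0.
have wy : w `^ s = y by rewrite /w -powRrM mulVf ?gt_eqF// powRr1.
have h1 : (eps / s * w) ^+ p <= p`!%:R * expR (eps / s * w).
  case: p => [|p].
    by rewrite expr0 mul1r -[leLHS]expR0 ler_expR mulr_ge0// ltW.
  rewrite -ler_pdivrMl ?ltr0n ?fact_gt0// mulrC.
  apply: le_trans (@expR_ge1Dxn R _ p _); last by rewrite mulr_ge0// ltW.
  by rewrite lerDr ler01.
have h2 : q ^+ p * y ^+ p <= fs s p * expR (eps * w).
  have := powR_le hs (exprn_ge0 _ (mulr_ge0 (ltW es0) w0)) h1.
  have -> : ((eps / s * w) ^+ p) `^ s = q ^+ p * y ^+ p.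
    have ew0 : 0 <= eps / s * w by apply: mulr_ge0 => //; exact: ltW.
    rewrite -(powR_mulrn p ew0) powRAC powR_mulrn ?powR_ge0//.
    by rewrite powRM ?(ltW es0)// wy exprMn.
  move=> /le_trans; apply.
  rewrite powRM ?ler0n ?expR_ge0// -/(fs s p) -expRM.
  by rewrite (_ : eps / s * w * s = eps * w)//; field; exact: lt0r_neq0.
rewrite expRN ler_pdivrMr ?expR_gt0//.
have h3 : y ^+ p <= q^-1 ^+ p * (fs s p * expR (eps * w)).
  by rewrite exprVn mulrC ler_pdivlMr ?exprn_gt0// mulrC.
apply: le_trans h3 _; rewrite -mulrA; apply: ler_wpM2r.
  by apply: mulr_ge0; [apply: ltW; exact: fs_gt0|exact: expR_ge0].
apply: lerXn2r; rewrite ?nnegrE ?invr_ge0 ?(ltW q0)//.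
  by rewrite le_max ler01.
by rewrite le_max lexx orbT.
Qed.

Lemma coord_le_enorm v i : `|v 0 i| <= enorm v.
Proof.
rewrite /enorm -sqrtr_sqr ler_wsqrtr// /dotp (bigD1 i)//= -expr2 lerDl.
by apply: sumr_ge0 => j _; rewrite -expr2 sqr_ge0.
Qed.

Lemma enorm_ge0 v : 0 <= enorm v. Proof. exact: sqrtr_ge0. Qed.

Lemma prodx_le_enorm D v : `|prodx D v| <= enorm v ^+ size D.
Proof.
rewrite /prodx; elim: D => [|i D IH]; first by rewrite big_nil normr1.
rewrite big_cons normrM exprS; apply: ler_pM => //; exact: coord_le_enorm.
Qed.

Lemma jap_le_enorm v : jap v <= (1 + enorm v ^+ 2) ^+ n.
Proof.
rewrite /jap -[X in _ <= _ ^+ X](card_ord n) -prodr_const.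
apply: ler_prod => i _; rewrite addr_ge0 ?sqr_ge0//= lerD2l.
by rewrite -[leLHS]real_normK ?num_real// lerXn2r ?nnegrE ?enorm_ge0// coord_le_enorm.
Qed.

Lemma pow1D_le (y : R) k : 0 <= y -> (1 + y) ^+ k <= 2 ^+ k * (1 + y ^+ k).
Proof.
move=> y0; have [y1|y1] := leP y 1.
  apply: le_trans (_ : 2 ^+ k <= _).
    by apply: lerXn2r; rewrite ?nnegrE//; lra.
  by apply: ler_peMr; [exact: exprn_ge0|rewrite lerDl exprn_ge0].
apply: le_trans (_ : (2 * y) ^+ k <= _).
  by apply: lerXn2r; rewrite ?nnegrE//; lra.
by rewrite exprMn; apply: ler_wpM2l; [exact: exprn_ge0|rewrite lerDr].
Qed.

(** The weight is a polynomial in the norm of v of degree 4n, so it only shifts the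
    order of the moment by 4n. *)
Lemma moment_bound (eps : R) : 0 < eps -> exists K C, [/\ 0 <= K, 1 <= C &
  forall D v, `|prodx D v| * expR (- (eps * enorm v `^ s^-1)) <=
    K * C ^+ size D * fs s (size D) * (jap v)^-1 ^+ 2].
Proof.
move=> /powerX_expR_le [c c1 hc].
have c0 : 0 <= c := le_trans ler01 c1.
have t1 : 1 <= 2 `^ s by apply: powR_ge1 => //; lra.
have t0 := le_trans ler01 t1.
pose N := (2 * (n * 2))%N.
exists (2 ^+ (n * 2) * 2 * (c ^+ N * (2 `^ s) ^+ N * fs s N)), (c * 2 `^ s); split.
- by nneg.
- by rewrite -[leLHS]mulr1; apply: ler_pM.
move=> D v; set p := size D; set y := enorm v; set ex := expR _.
have y0 : 0 <= y := enorm_ge0 v.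
have ex0 : 0 <= ex := expR_ge0 _.
have j0 := jap_gt0 v.
rewrite exprVn ler_pdivlMr ?exprn_gt0//.
have hj : jap v ^+ 2 <= 2 ^+ (n * 2) * (1 + y ^+ N).
  apply: le_trans (_ : (1 + y ^+ 2) ^+ (n * 2) <= _); last first.
    have -> : y ^+ N = (y ^+ 2) ^+ (n * 2) by rewrite /N exprM.
    by apply: pow1D_le; exact: exprn_ge0.
  rewrite exprM; apply: lerXn2r; rewrite ?nnegrE ?(ltW j0)//; last exact: jap_le_enorm.
  by apply: exprn_ge0; apply: addr_ge0 => //; exact: sqr_ge0.
apply: le_trans (ler_pM _ _ (ler_wpM2r ex0 (prodx_le_enorm D v)) hj) _; [by nneg|by nneg|].
rewrite -/p -/y.
have h (m : nat) : (m <= p + N)%N -> y ^+ m * ex <= c ^+ (p + N) * fs s (p + N).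
  move=> mp; apply: le_trans (hc m y y0) _.
  by have := geom_le hs ler01 c1 mp; rewrite !mul1r.
have h1 : y ^+ p * ex * (1 + y ^+ N) <= 2 * (c ^+ (p + N) * fs s (p + N)).
  have := h p (leq_addr _ _); have := h (p + N)%N (leqnn _).
  by rewrite exprD; lra.
have h2 : c ^+ (p + N) * fs s (p + N) <= (c * 2 `^ s) ^+ p * fs s p * (c ^+ N * (2 `^ s) ^+ N * fs s N).
  apply: le_trans (ler_wpM2l _ (fsD_le hs p N)) _; first by nneg.
  by rewrite exprMn !exprD; apply: eq_lerW; ring.
have h3 : y ^+ p * ex * (2 ^+ (n * 2) * (1 + y ^+ N)) <=
   2 ^+ (n * 2) * (2 * ((c * 2 `^ s) ^+ p * fs s p * (c ^+ N * (2 `^ s) ^+ N * fs s N))).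
  rewrite mulrCA; apply: ler_wpM2l; first by nneg.
  by apply: le_trans h1 _; apply: ler_wpM2l.
by apply: le_trans h3 _; apply: eq_lerW; ring.
Qed.

Lemma has_pd_ker_neg v t i : has_pd i (fun y => ker (- y) v) t ('i * (2 * pi * v 0 i)%:C * ker (- t) v).
Proof.
have E : (fun y => ker (- y) v) = (fun y => cis (2 * pi * dotp v y)).
  by apply/funext => y; rewrite kerC ker_opp.
by rewrite E kerC ker_opp; exact: has_pd_cis_dotp.
Qed.

Lemma cmod_ipow m : cmod (('i * (2 * pi)%:C) ^+ m : R[i]) = (2 * pi) ^+ m.
Proof.
elim: m => [|m IH]; first by rewrite !expr0 -(cmod_cis 0) cis0.
rewrite !exprS cmodM IH cmodM cmod_real ger0_norm; last by rewrite mulr_ge0// pi_ge0.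
by rewrite cmod_i mul1r.
Qed.

(** Each derivative of the inverse Fourier integral of psi inserts a factor
    2 pi i v_j, which is absorbed by the decay of psi. *)
Lemma deriv_inverse_fourier (eps : R) : 0 < eps -> exists K C, [/\ 0 <= K, 1 <= C &
  forall M (psi : T -> R[i]), 0 <= M -> cmeas psi ->
  {ae Lb n, forall v : T, cmod (psi v) <= M * expR (- (eps * enorm (vec v) `^ s^-1))} ->
  forall D t, cmod (foldr pderiv (fun y => cint (Lb n) (fun v : T => psi v * ker (- y) (vec v))) D t)
    <= M * K * C ^+ size D * fs s (size D)].
Proof.
move=> /moment_bound [K [C [K0 C1 hK]]].
have C0 := le_trans ler01 C1; have ji0 := japint_ge0 (R := R) n.
have p1 : 1 <= pi :> R by have := @pi_ge2 R; lra.
have p0 : 0 < pi :> R by exact: pi_gt0.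
exists (2 * (K * japint n)), (2 * pi * C); split; first by nneg.
  by rewrite -[leLHS]mulr1; apply: ler_pM => //; lra.
move=> M psi M0 mpsi bpsi D t.
pose P D (v : T) := (prodx D (vec v))%:C * psi v.
pose B D := M * (K * C ^+ size D * fs s (size D)).
have B0 D0 : 0 <= B D0 by rewrite /B; nneg.
have iB D0 : (Lb n).-integrable setT (EFin \o (fun v : T => B D0 * (jap (vec v))^-1)).
  exact: integrable_scale (integrable_japV n).
have bP D0 : {ae Lb n, forall v : T, cmod (P D0 v) <= B D0 * (jap (vec v))^-1}.
  apply: filterS bpsi => v hv; rewrite /P cmodM cmod_real.
  apply: le_trans (ler_wpM2l (normr_ge0 _) hv) _.
  rewrite mulrCA /B -mulrA; apply: ler_wpM2l => //.
  apply: le_trans (hK D0 (vec v)) _.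
  apply: ler_wpM2l; first by nneg.
  rewrite expr2; apply: ler_piMl; last exact: japV_le1.
  by rewrite invr_ge0 ltW// jap_gt0.
have mP D0 : cmeas (P D0).
  by apply: cmeasM => //; exact: ccont_cmeas (smooth_ccont (smooth_prodx D0)).
have jB0 D0 (v : T) : 0 <= B D0 * (jap (vec v))^-1.
  by apply: mulr_ge0 => //; rewrite invr_ge0 ltW// jap_gt0.
have iP D0 : cintg (Lb n) (P D0) := cintg_dom_ae (mP D0) (jB0 D0) (bP D0) (iB D0).
have iPk D0 (y : V) : cintg (Lb n) (fun v : T => P D0 v * ker (- y) (vec v)).
  have := cintg_ker (H := fun x => P D0 (unvec x)) (- y).
  have -> : (fun v : T => P D0 (unvec (vec v))) = P D0 by apply/funext => v; rewrite vecK.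
  move=> /(_ (iP D0)).
  by have -> : (fun v : T => P D0 (unvec (vec v)) * ker (- y) (vec v)) =
     (fun v : T => P D0 v * ker (- y) (vec v)) by apply/funext => v; rewrite vecK.
pose J D (y : V) := cint (Lb n) (fun v : T => P D v * ker (- y) (vec v)).
have pdJ D0 i y : has_pd i (J D0) y ('i * (2 * pi)%:C * J (i :: D0) y).
  pose F (y0 : V) (v : T) := P D0 v * ker (- y0) (vec v).
  pose DF (y0 : V) (v : T) := P D0 v * ('i * (2 * pi * vec v 0 i)%:C * ker (- y0) (vec v)).
  have EDF y0 : DF y0 = (fun v : T => 'i * (2 * pi)%:C * (P (i :: D0) v * ker (- y0) (vec v))).
    apply/funext => v; rewrite /DF /P /prodx big_cons !rmorphM /=; ring.
  rewrite /J -(cintMl _ (iPk (i :: D0) y)) -EDF.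
  pose G (v : T) : R := 2 * pi * cmod (P (i :: D0) v).
  apply: (@has_pd_cint R n _ T (Lb n) F DF G i y).
  - exact: iPk.
  - by move=> y0 v; apply: has_pdMl; exact: has_pd_ker_neg.
  - exact: integrable_scale (cintg_cmod (iP _)).
  move=> h v _; rewrite EDF cmodM cmod_mul_ker cmodM cmod_real.
  rewrite cmod_i mul1r.
  by rewrite ger0_norm// mulr_ge0// ltW.
have fJ D0 : foldr pderiv (J [::]) D0 = (fun y => ('i * (2 * pi)%:C) ^+ size D0 * J D0 y).
  elim: D0 => [|i D0 IH]; first by apply/funext => y; rewrite expr0 mul1r.
  rewrite [LHS]/= IH; apply: pderiv_eq => y.
  by rewrite [size _]/= exprSr -mulrA; apply: has_pdMl; exact: pdJ.
have -> : (fun y => cint (Lb n) (fun v : T => psi v * ker (- y) (vec v))) = J [::].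
  by apply/funext => y; apply: eq_cint => v; rewrite /P /prodx big_nil mul1r.
rewrite fJ cmodM.
rewrite cmod_ipow.
have hJ : cmod (J D t) <= 2 * (B D * japint n).
  have := cint_le_ae (iPk D t) (jB0 D) (iB D).
  rewrite RintegralZl//; last exact: integrable_japV.
  by apply; apply: filterS (bP D) => v; rewrite cmod_mul_ker.
apply: le_trans (ler_wpM2l _ hJ) _; first by apply: exprn_ge0; rewrite mulr_ge0// ltW.
by rewrite /B !exprMn; apply: eq_lerW; ring.
Qed.

End Moments.

(** * The cross-Wigner distribution *)

Section CoordinateChange.
Context {R : realType} {m n : nat}.

(** Chain rule for a map that sends the line in direction j to the line in
    direction i; used for the two projections of phase space. *)
Lemma has_pd_slide (L : 'rV[R]_m -> 'rV[R]_n) (j : 'I_m) (i : 'I_n) f z l :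
  (forall h : R, L (h *: delta_mx 0 j + z) = h *: delta_mx 0 i + L z) ->
  has_pd i f (L z) l -> has_pd j (fun y => f (L y)) z l.
Proof.
move=> hL [h1 h2].
have key (F : 'rV[R]_n -> R) (k : R) : is_derive (L z) (delta_mx 0 i) F k ->
    is_derive z (delta_mx 0 j) (fun y => F (L y)) k.
  move=> h; suff : is_derive (0 *: delta_mx 0 j + z) (delta_mx 0 j) (fun y => F (L y)) k.
    by rewrite scale0r add0r.
  apply/is_derive_line.
  rewrite (_ : (fun _ => _) = (fun k : R => F (k *: delta_mx 0 i + L z))).
    by apply/is_derive_line; rewrite scale0r add0r.
  by apply/funext => k'; rewrite hL.
by split; [exact: key h1|exact: key h2].
Qed.

Lemma has_pd_still (L : 'rV[R]_m -> 'rV[R]_n) (j : 'I_m) (f : 'rV[R]_n -> R[i]) z :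
  (forall h : R, L (h *: delta_mx 0 j + z) = L z) ->
  has_pd j (fun y => f (L y)) z 0.
Proof.
move=> hL.
have key (F : 'rV[R]_n -> R) : is_derive z (delta_mx 0 j) (fun y => F (L y)) 0.
  suff : is_derive (0 *: delta_mx 0 j + z) (delta_mx 0 j) (fun y => F (L y)) 0.
    by rewrite scale0r add0r.
  apply/is_derive_line.
  rewrite (_ : (fun _ => _) = (fun k : R => F (L z))); first exact: is_derive_cst.
  by apply/funext => k'; rewrite hL.
by split; [exact: (key (fun x => complex.Re (f x)))|exact: (key (fun x => complex.Im (f x)))].
Qed.

End CoordinateChange.

Section Wigner.
Context {R : realType} {d : nat}.
Local Notation V := 'rV[R]_d.
Local Notation Z := 'rV[R]_(d + d).
Local Notation T := (d.-tuple (measurableTypeR R)).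
Implicit Types (f g h : V -> R[i]) (x t : V) (z : Z) (i : 'I_d).

(** Schwartz functions, encoded by words and an integrable weight. *)
Definition sw f := Cinf f /\
  forall w, exists2 c, 0 <= c & forall x, cmod (wact w f x) <= c * (jap x)^-1.

Lemma rapid_sw s f : 2^-1 <= s -> rapid s f -> sw f.
Proof.
move=> hs [sf [K [C [K0 C1 b]]]]; split=> // w.
by exists (K * C ^+ size w * fs s (size w)) => //; have C0 := le_trans ler01 C1; nneg.
Qed.

Lemma sw_lact l f : sw f -> sw (lact l f).
Proof.
move=> [sf b]; split; first exact: smooth_lact.
by move=> w; have [c c0 h] := b (rcons w l); exists c => // x; have := h x; rewrite /wact foldr_rcons.
Qed.

Definition wint f h z t : R[i] :=
  f (lsubmx z + 2^-1 *: t) * conjc (h (lsubmx z - 2^-1 *: t)) * ker (rsubmx z) t.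

Lemma wignerE f h z : wigner f h z = cint (Lb d) (fun t : T => wint f h z (vec t)).
Proof.
rewrite /wigner cintegralE; apply: eq_cint => t /=.
by rewrite /wint /ker dotpC.
Qed.

Lemma ccont_wint f h z : ccont f -> ccont h -> ccont (wint f h z).
Proof.
move=> cf ch; apply: ccontM; last exact: smooth_ccont (smooth_ker _).
apply: ccontM; first exact: ccont_aff.
apply: ccontJ; rewrite (_ : (fun x => _) = (fun x => h (lsubmx z + (- 2^-1) *: x))); first exact: ccont_aff.
by apply/funext => x; rewrite scaleNr.
Qed.

(** The two arguments differ by t, so that the weights at both of them together
    dominate the weight at t, uniformly in z. *)
Lemma wint_le f h a b z t : (forall x, cmod (f x) <= a * (jap x)^-1) ->
  (forall x, cmod (h x) <= b * (jap x)^-1) -> 0 <= a -> 0 <= b ->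
  cmod (wint f h z t) <= 2 ^+ d * (a * b) * (jap t)^-1.
Proof.
move=> bf bh a0 b0; rewrite /wint cmod_mul_ker cmodM cmodJ.
set y := _ + _; set y' := _ - _.
have E : t = y - y'.
  by apply/rowP => q; rewrite !mxE; field.
have j1 := jap_gt0 y; have j2 := jap_gt0 y'; have j3 := jap_gt0 t.
apply: le_trans (ler_pM _ _ (bf y) (bh y')) _; [exact: cmod_ge0|exact: cmod_ge0|].
have -> : a * (jap y)^-1 * (b * (jap y')^-1) = a * b * ((jap y) * (jap y'))^-1.
  by field; rewrite ?gt_eqF.
have -> : 2 ^+ d * (a * b) * (jap t)^-1 = a * b * (2 ^+ d * (jap t)^-1) by ring.
apply: ler_wpM2l; first exact: mulr_ge0.
rewrite ler_pdivlMr// mulrC ler_pdivrMr ?mulr_gt0// mulrA {1}E; exact: jap_sub.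
Qed.

Lemma sw_ccont f : sw f -> ccont f. Proof. by move=> [/smooth_ccont]. Qed.

Lemma sw_le f : sw f -> exists2 c, 0 <= c & forall x, cmod (f x) <= c * (jap x)^-1.
Proof. by move=> [_ /(_ [::])]. Qed.

Lemma cintg_wint f h z : sw f -> sw h -> cintg (Lb d) (fun t : T => wint f h z (vec t)).
Proof.
move=> sf sh; have [a a0 ba] := sw_le sf; have [b b0 bb] := sw_le sh.
apply: cintg_jap (fun t => wint_le z t ba bb a0 b0).
by apply: ccont_wint; exact: sw_ccont.
Qed.

Lemma wigner_le f h a b z : ccont f -> ccont h -> (forall x, cmod (f x) <= a * (jap x)^-1) ->
  (forall x, cmod (h x) <= b * (jap x)^-1) -> 0 <= a -> 0 <= b ->
  cmod (wigner f h z) <= 2 * (2 ^+ d * (a * b) * japint d).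
Proof.
move=> cf ch bf bh a0 b0; rewrite wignerE.
apply: cint_jap (fun t => wint_le z t bf bh a0 b0).
exact: ccont_wint.
Qed.

Lemma wigner_pdx f h i z : sw f -> sw h ->
  has_pd (lshift d i) (wigner f h) z (wigner (pderiv i f) h z + wigner f (pderiv i h) z).
Proof.
move=> sf sh.
have sf' : sw (pderiv i f) := sw_lact (inr i) sf.
have sh' : sw (pderiv i h) := sw_lact (inr i) sh.
have [a a0 ba] := sw_le sf; have [b b0 bb] := sw_le sh.
have [a' a0' ba'] := sw_le sf'; have [b' b0' bb'] := sw_le sh'.
pose F (y : Z) (t : T) := wint f h y (vec t).
pose DF (y : Z) (t : T) := wint (pderiv i f) h y (vec t) + wint f (pderiv i h) y (vec t).
pose G (t : T) := (2 ^+ d * (a' * b) + 2 ^+ d * (a * b')) * (jap (vec t))^-1.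
rewrite !wignerE -cintD; [|exact: cintg_wint|exact: cintg_wint].
have -> : wigner f h = (fun y => cint (Lb d) (F y)) by apply/funext => y; exact: wignerE.
have hl (c : V) y (k : R) : lsubmx (k *: delta_mx 0 (lshift d i) + y : Z) + c = k *: delta_mx 0 i + (lsubmx y + c).
  by apply/rowP => q; rewrite !mxE /= eq_shift addrA.
apply: (@has_pd_cint R (d + d) _ T (Lb d) F DF G (lshift d i) z).
- by move=> y; exact: cintg_wint.
- move=> y t; rewrite /F /DF /wint.
  have -> : forall A B C D E : R[i], A * B * E + C * D * E = (A * B + C * D) * E + C * B * 0.
    by move=> A B C D E; ring.
  have h1 : has_pd (lshift d i) (fun y : Z => f (lsubmx y + 2^-1 *: vec t)) y (pderiv i f (lsubmx y + 2^-1 *: vec t)).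
    apply: (has_pd_slide (L := fun y : Z => lsubmx y + 2^-1 *: vec t) (i := i)); first by move=> k; exact: hl.
    exact: smooth_has_pd sf.1.
  have h2 : has_pd (lshift d i) (fun y : Z => conjc (h (lsubmx y - 2^-1 *: vec t))) y (conjc (pderiv i h (lsubmx y - 2^-1 *: vec t))).
    apply: has_pdJ.
    apply: (has_pd_slide (L := fun y : Z => lsubmx y - 2^-1 *: vec t) (i := i)); first by move=> k; exact: hl.
    exact: smooth_has_pd sh.1.
  have h3 : has_pd (lshift d i) (fun y : Z => ker (rsubmx y) (vec t)) y 0.
    apply: (has_pd_still (L := fun y : Z => rsubmx y) (fun v => ker v (vec t))).
    by move=> k; apply/rowP => q; rewrite !mxE eq_rlshift mulr0 add0r.
  have := has_pdM (has_pdM h1 h2) h3.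
  by rewrite !mulr0.
- exact: integrable_scale (integrable_japV d).
move=> k t _; rewrite /DF /G mulrDl.
apply: le_trans (le_normcD _ _) _; apply: lerD; exact: wint_le.
Qed.

Lemma wint_inl_l f h z t i :
  wint (lact (inl i) f) h z t = (lsubmx z 0 i + 2^-1 * t 0 i)%:C * wint f h z t.
Proof. by rewrite /wint /= !mxE !mulrA. Qed.

Lemma wint_inl_r f h z t i :
  wint f (lact (inl i) h) z t = (lsubmx z 0 i - 2^-1 * t 0 i)%:C * wint f h z t.
Proof.
rewrite /wint /= !mxE.
move: (h _) (f _) (ker _ _) (z 0 _ - _) => [u v] a k r.
rewrite (_ : conjc (r%:C * (u +i* v)) = r%:C * conjc (u +i* v)); first by ring.
by simpc.
Qed.

Lemma wigner_mulx f h i z : sw f -> sw h ->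
  (lsubmx z 0 i)%:C * wigner f h z =
  (2^-1)%:C * wigner (lact (inl i) f) h z + (2^-1)%:C * wigner f (lact (inl i) h) z.
Proof.
move=> sf sh; have sf' := sw_lact (inl i) sf; have sh' := sw_lact (inl i) sh.
have ig := cintg_wint z sf sh.
have i1 := cintg_wint z sf' sh; have i2 := cintg_wint z sf sh'.
rewrite -mulrDr !wignerE -(cintD i1 i2).
have -> : cint (Lb d) (fun t : T => wint (lact (inl i) f) h z (vec t) + wint f (lact (inl i) h) z (vec t)) =
    (2 * lsubmx z 0 i)%:C * cint (Lb d) (fun t : T => wint f h z (vec t)).
  rewrite -(cintMl _ ig); apply: eq_cint => t.
  by rewrite wint_inl_l wint_inl_r -mulrDl -rmorphD /=; congr (_%:C * _); field.
by rewrite mulrA -rmorphM /= mulrA mulVf ?mul1r// pnatr_eq0.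
Qed.

(** The factor of the derivative in frequency, - 2 pi i. *)
Definition dxic : R[i] := 'i * (- (2 * pi))%:C.

Lemma wigner_pdxi f h i z : sw f -> sw h ->
  has_pd (rshift d i) (wigner f h) z
    (dxic * wigner (lact (inl i) f) h z + - dxic * wigner f (lact (inl i) h) z).
Proof.
move=> sf sh.
have sf' := sw_lact (inl i) sf; have sh' := sw_lact (inl i) sh.
have [a a0 ba] := sw_le sf; have [b b0 bb] := sw_le sh.
have [a' a0' ba'] := sw_le sf'; have [b' b0' bb'] := sw_le sh'.
pose F (y : Z) (t : T) := wint f h y (vec t).
pose DF (y : Z) (t : T) := dxic * wint (lact (inl i) f) h y (vec t) + - dxic * wint f (lact (inl i) h) y (vec t).
pose G (t : T) := (2 * pi) * ((2 ^+ d * (a' * b) + 2 ^+ d * (a * b')) * (jap (vec t))^-1).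
have i1 := cintg_wint z sf' sh; have i2 := cintg_wint z sf sh'.
rewrite !wignerE -(cintMl _ i1) -(cintMl _ i2) -(cintD (cintgMl _ i1) (cintgMl _ i2)).
have -> : wigner f h = (fun y => cint (Lb d) (F y)) by apply/funext => y; exact: wignerE.
have cd : cmod dxic = 2 * pi.
  rewrite /dxic cmodM cmod_real normrN ger0_norm ?mulr_ge0 ?pi_ge0//.
  by rewrite cmod_i mul1r.
apply: (@has_pd_cint R (d + d) _ T (Lb d) F DF G (rshift d i) z).
- by move=> y; exact: cintg_wint.
- move=> y t; rewrite /F /DF wint_inl_l wint_inl_r.
  have -> : dxic * ((lsubmx y 0 i + 2^-1 * vec t 0 i)%:C * wint f h y (vec t)) +
     - dxic * ((lsubmx y 0 i - 2^-1 * vec t 0 i)%:C * wint f h y (vec t)) =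
     f (lsubmx y + 2^-1 *: vec t) * conjc (h (lsubmx y - 2^-1 *: vec t)) *
      ('i * (- (2 * pi) * vec t 0 i)%:C * ker (rsubmx y) (vec t)).
    rewrite mulNr -mulrBr -mulrBl -rmorphB /=.
    rewrite (_ : _ + _ - (_ - _) = vec t 0 i); last by field.
    by rewrite /wint /dxic !rmorphM /=; ring.
  have h1 : has_pd (rshift d i) (fun y : Z => f (lsubmx y + 2^-1 *: vec t)) y 0.
    apply: (has_pd_still (L := fun y : Z => lsubmx y) (fun x => f (x + 2^-1 *: vec t))).
    by move=> k; apply/rowP => q; rewrite !mxE eq_lrshift mulr0 add0r.
  have h2 : has_pd (rshift d i) (fun y : Z => conjc (h (lsubmx y - 2^-1 *: vec t))) y 0.
    apply: (has_pd_still (L := fun y : Z => lsubmx y) (fun x => conjc (h (x - 2^-1 *: vec t)))).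
    by move=> k; apply/rowP => q; rewrite !mxE eq_lrshift mulr0 add0r.
  have h3 : has_pd (rshift d i) (fun y : Z => ker (rsubmx y) (vec t)) y ('i * (- (2 * pi) * vec t 0 i)%:C * ker (rsubmx y) (vec t)).
    rewrite kerC (_ : (fun y : Z => _) = (fun y : Z => ker (vec t) (rsubmx y))); last first.
      by apply/funext => y'; rewrite kerC.
    apply: (has_pd_slide (L := fun y : Z => rsubmx y) (i := i)); last exact: has_pd_ker.
    by move=> k; apply/rowP => q; rewrite !mxE /= eq_shift.
  have := has_pdM (has_pdM h1 h2) h3.
  by rewrite mul0r mulr0 addr0 mul0r add0r.
- by apply: integrable_scale; exact: integrable_scale (integrable_japV d).
move=> k t _; rewrite /DF /G.
apply: le_trans (le_normcD _ _) _; rewrite mulNr.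
rewrite cmodN !(cmodM dxic) cd -mulrDr; apply: ler_wpM2l; first by rewrite mulr_ge0// pi_ge0.
by rewrite mulrDl; apply: lerD; exact: wint_le.
Qed.

(** The factor of the multiplication by a frequency, 1 / (4 pi i). *)
Definition mxic : R[i] := 'i * (- (4 * pi)^-1)%:C.

(** The integrand has a total derivative in t_i of integral zero; the factor
    1 / (4 pi i) is 1 / 2 over 2 pi i. *)
Lemma wigner_mulxi f h i z : sw f -> sw h ->
  (rsubmx z 0 i)%:C * wigner f h z =
  mxic * wigner (pderiv i f) h z + - mxic * wigner f (pderiv i h) z.
Proof.
move=> sf sh.
have sf' : sw (pderiv i f) := sw_lact (inr i) sf.
have sh' : sw (pderiv i h) := sw_lact (inr i) sh.
have [a a0 ba] := sw_le sf; have [b b0 bb] := sw_le sh.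
have [a' a0' ba'] := sw_le sf'; have [b' b0' bb'] := sw_le sh'.
have i0 := cintg_wint z sf sh.
have i1 := cintg_wint z sf' sh; have i2 := cintg_wint z sf sh'.
pose D1 t := (2^-1)%:C * wint (pderiv i f) h z t + (- 2^-1)%:C * wint f (pderiv i h) z t.
pose c3 : R[i] := 'i * (- (2 * pi) * rsubmx z 0 i)%:C.
pose DF t := D1 t + c3 * wint f h z t.
have hd t : has_pd i (wint f h z) t (DF t).
  have h1 := has_pd_aff (smooth_has_pd i (lsubmx z + 2^-1 *: t) sf.1).
  have h2 := has_pd_aff (smooth_has_pd i (lsubmx z + (- 2^-1) *: t) sh.1).
  have := has_pdM (has_pdM h1 (has_pdJ h2)) (has_pd_ker (rsubmx z) t i).
  rewrite (_ : (fun y => _) = wint f h z); last first.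
    by apply/funext => y; rewrite /wint scaleNr.
  rewrite /DF /D1 /wint scaleNr -/c3.
  set l1 := (X in has_pd _ _ _ X -> _); set l2 := (X in _ -> has_pd _ _ _ X).
  suff -> : l1 = l2 by [].
  rewrite /l1 /l2; move: (pderiv i h _) (pderiv i f _) (ker _ _) (f _) (h _) => [u v] A k B C.
  rewrite (_ : conjc ((- 2^-1)%:C * (u +i* v)) = (- 2^-1)%:C * conjc (u +i* v)); last by simpc.
  by ring.
have z0 : cint (Lb d) (fun t : T => DF (vec t)) = 0.
  apply: (cint_pderiv0 (F := wint f h z) (i := i)
    (c := 2^-1 * (2 ^+ d * (a' * b)) + 2^-1 * (2 ^+ d * (a * b')) + cmod c3 * (2 ^+ d * (a * b)))) => //.
    have h2 : 0 <= 2^-1 :> R by rewrite invr_ge0.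
    by nneg.
  move=> t; rewrite /DF /D1 !mulrDl.
  apply: le_trans (le_normcD _ _) _; apply: lerD; last first.
    by rewrite cmodM -!mulrA; apply: ler_wpM2l; [exact: cmod_ge0|rewrite !mulrA -[2 ^+ d * a * b]mulrA; exact: wint_le].
  apply: le_trans (le_normcD _ _) _; rewrite (cmodM (2^-1)%:C) (cmodM (- 2^-1)%:C) !cmod_real normrN ger0_norm ?invr_ge0//.
  by apply: lerD; rewrite -[leRHS]mulrA; apply: ler_wpM2l; rewrite ?invr_ge0//; exact: wint_le.
have : (2^-1)%:C * wigner (pderiv i f) h z + (- 2^-1)%:C * wigner f (pderiv i h) z + c3 * wigner f h z = 0.
  rewrite !wignerE -(cintMl _ i1) -(cintMl _ i2) -(cintMl _ i0).
  rewrite -(cintD (cintgMl _ i1) (cintgMl _ i2)).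
  by rewrite -(cintD (cintgD (cintgMl _ i1) (cintgMl _ i2)) (cintgMl _ i0)).
move: (wigner _ _ _) (wigner _ _ _) (wigner _ _ _) => C B A.
have pn : pi != 0 :> R by rewrite gt_eqF// pi_gt0.
have i2E : 'i * 'i = - 1 :> R[i] by simpc.
have : mxic * c3 = - (2^-1 * rsubmx z 0 i)%:C.
  rewrite /mxic /c3 mulrACA i2E -[(_)%:C * (_)%:C]rmorphM mulN1r; congr (- _%:C).
  by move: (pi : R) pn (rsubmx z 0 i) => p pn r; field; rewrite pn.
move=> E1 E2; move/(congr1 (fun w => 2 * (mxic * w))): E2.
rewrite mulr0 mulr0 !mulrDr [mxic * (c3 * _)]mulrA E1.
have k2 : 2 * (2^-1)%:C = 1 :> R[i].
  by rewrite fmorphV rmorph_nat mulfV// pnatr_eq0.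
rewrite [(2^-1 * _)%:C]rmorphM [(- 2^-1)%:C]rmorphN /= => E2.
rewrite -[LHS]mul1r -[RHS]mul1r -k2; apply/eqP.
by rewrite -subr_eq0 -oppr_eq0 -[X in _ == X]E2; apply/eqP; ring.
Qed.

(** Every letter on phase space distributes over the two arguments of W as a letter
    on R^d; words on W(g,g) are therefore controlled by words on g. *)
Lemma wigner_lact (l : letter (n := d + d)) f h : sw f -> sw h -> exists a1 a2 l',
  [/\ cmod a1 <= 2 * pi, cmod a2 <= 2 * pi &
      (forall z, (if l is inr j then has_pd j (wigner f h) z
          (a1 * wigner (lact l' f) h z + a2 * wigner f (lact l' h) z) else True)) /\
      lact l (wigner f h) = (fun z => a1 * wigner (lact l' f) h z + a2 * wigner f (lact l' h) z)].
Proof.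
move=> sf sh.
have p2 : 2 <= pi :> R := @pi_ge2 R.
have c2 : cmod ((2^-1)%:C : R[i]) <= 2 * pi.
  by rewrite cmod_real ger0_norm ?invr_ge0//; lra.
have cd : cmod dxic <= 2 * pi.
  by rewrite /dxic cmodM cmod_i mul1r cmod_real normrN ger0_norm// mulr_ge0// pi_ge0.
have cm : cmod mxic <= 2 * pi.
  rewrite /mxic cmodM cmod_i mul1r cmod_real normrN ger0_norm; last by rewrite invr_ge0 mulr_ge0// pi_ge0.
  apply: (@le_trans _ _ 1); last by lra.
  by rewrite invf_le1; lra.
have c1 : cmod (1 : R[i]) <= 2 * pi.
  by rewrite -(rmorph1 (real_complex R)) cmod_real normr1; lra.
case: l => j; case: (split_ordP j) => i ->.
- exists (2^-1)%:C, (2^-1)%:C, (inl i); split => //; split => //.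
  apply/funext => z; rewrite -(wigner_mulx i z sf sh) /= /lsubmx mxE; reflexivity.
- exists mxic, (- mxic), (inr i); split => //; first by rewrite cmodN.
  split => //.
  apply/funext => z; rewrite -(wigner_mulxi i z sf sh) /= /rsubmx mxE; reflexivity.
- have hh z : has_pd (lshift d i) (wigner f h) z
      (1 * wigner (lact (inr i) f) h z + 1 * wigner f (lact (inr i) h) z).
    by rewrite !mul1r; exact: wigner_pdx.
  by exists 1, 1, (inr i); split => //; split => //; exact: pderiv_eq.
- exists dxic, (- dxic), (inl i); split => //; first by rewrite cmodN.
  by split; [move=> z; exact: wigner_pdxi|apply: pderiv_eq => z; exact: wigner_pdxi].
Qed.

Lemma wigner_bounded f h : sw f -> sw h -> exists M, forall z, cmod (wigner f h z) <= M.
Proof.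
move=> sf sh; have [a a0 ba] := sw_le sf; have [b b0 bb] := sw_le sh.
exists (2 * (2 ^+ d * (a * b) * japint d)) => z.
by apply: wigner_le => //; exact: sw_ccont.
Qed.

Lemma ccont_bounded_pd (F : Z -> R[i]) (G : 'I_(d + d) -> Z -> R[i]) :
  (forall j z, has_pd j F z (G j z)) -> (forall j, exists M, forall z, cmod (G j z) <= M) -> ccont F.
Proof.
move=> hF bG.
have [M hM] : exists M, forall j z, cmod (G j z) <= M.
  have [M hM] := choice bG; exists (\sum_j `|M j|) => j z.
  apply: le_trans (hM j z) _; apply: le_trans (ler_norm _) _.
  by rewrite (bigD1 j)//= lerDl; apply: sumr_ge0.
split.
  apply: (lipschitz_continuous (G := fun j z => complex.Re (G j z)) (M := M)).
    by move=> j z; exact: (hF j z).1.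
  by move=> j z; exact: le_trans (Re_le_cmod _) (hM j z).
apply: (lipschitz_continuous (G := fun j z => complex.Im (G j z)) (M := M)).
  by move=> j z; exact: (hF j z).2.
by move=> j z; exact: le_trans (Im_le_cmod _) (hM j z).
Qed.

(** The family of all W(f,h) is closed under differentiation, so smooth_family
    applies. *)
Lemma smooth_wigner f h : sw f -> sw h -> Cinf (wigner f h).
Proof.
move=> sf sh; pose E : set (Z -> R[i]) := [set F | exists f h, [/\ sw f, sw h & F = wigner f h]].
have : E (wigner f h) by exists f, h; split.
apply: smooth_family => {f h sf sh}.
- move=> _ [f [h [sf sh ->]]].
  have hj j : exists G : Z -> R[i], (forall z, has_pd j (wigner f h) z (G z)) /\ exists M, forall z, cmod (G z) <= M.
    have [a1 [a2 [l' [_ _ [hd _]]]]] := wigner_lact (inr j) sf sh.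
    eexists; split; first exact: hd.
    have [M1 h1] := wigner_bounded (sw_lact l' sf) sh.
    have [M2 h2] := wigner_bounded sf (sw_lact l' sh).
    exists (cmod a1 * M1 + cmod a2 * M2) => z.
    by apply: le_trans (le_normcD _ _) _; rewrite !cmodM; apply: lerD; apply: ler_wpM2l => //; exact: cmod_ge0.
  have [G hG] := choice hj.
  by apply: (ccont_bounded_pd (G := G)) => j; [move=> z; exact: (hG j).1|exact: (hG j).2].
- move=> _ j z [f [h [sf sh ->]]].
  have [a1 [a2 [l' [_ _ [hd _]]]]] := wigner_lact (inr j) sf sh.
  exact: has_pd_pdiff (hd z).
- move=> _ j [f [h [sf sh ->]]].
  have [a1 [a2 [l' [_ _ [_ /= ->]]]]] := wigner_lact (inr j) sf sh.
  apply: lspan_comb; apply: lspan_in.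
    by exists (lact l' f), h; split => //; exact: sw_lact.
  by exists f, (lact l' h); split => //; exact: sw_lact.
Qed.

Lemma sw_wact w f : sw f -> sw (wact w f).
Proof. by elim: w => //= l w IH /IH; exact: sw_lact. Qed.

(** Level m is the set of the W(Pg, Qg) with words P, Q of total length m. *)
Lemma wigner_rapid (s : R) g : 2^-1 <= s -> rapid s g -> rapid s (wigner g g).
Proof.
move=> hs rg; have sg := rapid_sw hs rg; have [_ [K [C [K0 C1 b]]]] := rg.
have C0 := le_trans ler01 C1; have ji0 := japint_ge0 (R := R) d.
have p2 : 2 <= pi :> R := @pi_ge2 R.
pose E m : set (Z -> R[i]) := [set F | exists p q,
  (size p + size q)%N = m /\ F = wigner (wact p g) (wact q g)].
pose A : R := 2 * (2 ^+ d * (K * K) * japint d).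
have A0 : 0 <= A by rewrite /A; nneg.
have bE m F z : E m F -> cmod (F z) <= A * C ^+ m * fs s m * 1.
  move=> [p [q [<- ->]]]; rewrite mulr1.
  have cw w : ccont (wact w g) := sw_ccont (sw_wact w sg).
  have B0 (k : nat) : 0 <= K * C ^+ k * fs s k by nneg.
  apply: le_trans (wigner_le z (cw p) (cw q) (b p) (b q) (B0 _) (B0 _)) _.
  have -> : 2 * (2 ^+ d * (K * C ^+ size p * fs s (size p) * (K * C ^+ size q * fs s (size q))) * japint d) =
     A * (C ^+ size p * C ^+ size q) * (fs s (size p) * fs s (size q)) by rewrite /A; ring.
  by rewrite -exprD; apply: ler_wpM2l; [nneg|exact: fsM_le].
have sE m F : E m F -> Cinf F.
  by move=> [p [q [_ ->]]]; apply: smooth_wigner; exact: sw_wact.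
have lE m F (l : letter (n := d + d)) : E m F -> predT l -> exists a1 a2 F1 F2,
    [/\ cmod a1 <= 2 * pi, cmod a2 <= 2 * pi, E m.+1 F1, E m.+1 F2 &
        lact l F = (fun y => a1 * F1 y + a2 * F2 y)].
  move=> [p [q [<- ->]]] _.
  have [a1 [a2 [l' [h1 h2 [_ h3]]]]] := wigner_lact l (sw_wact p sg) (sw_wact q sg).
  exists a1, a2, (wigner (wact (l' :: p) g) (wact q g)), (wigner (wact p g) (wact (l' :: q) g)).
  split; [exact: h1|exact: h2| | |exact: h3].
    by exists (l' :: p), q; split.
  by exists p, (l' :: q); split => //=; rewrite addnS.
have E0 : E 0%N (wigner g g) by exists [::], [::]; split.
have c0 : 0 <= 2 * pi :> R by lra.
apply: (rapid_of_word_bound hs (K := A) (C := 2 * (2 * pi) * C)).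
- by apply: smooth_wigner.
- exact: A0.
- by rewrite -[leLHS]mulr1; apply: ler_pM => //; lra.
move=> w z.
have := bound_family (b := fun m => A * C ^+ m * fs s m) (omega := fun=> 1) c0 sE bE lE (all_predT w) z E0.
rewrite add0n mulr1 => h; apply: le_trans h _.
by rewrite !exprMn; apply: eq_lerW; ring.
Qed.

End Wigner.

(** * Covariance and non-degeneracy of the Wigner distribution *)

Section DotProduct.
Context {R : realType}.

Lemma dotp_row m n (a : 'rV[R]_m) (b : 'rV[R]_n) (p : 'rV[R]_(m + n)) :
  dotp (row_mx a b) p = dotp a (lsubmx p) + dotp b (rsubmx p).
Proof.
rewrite /dotp big_split_ord /=; congr (_ + _); apply: eq_bigr => i _.
  by rewrite row_mxEl mxE.
by rewrite row_mxEr mxE.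
Qed.

Lemma dotpBr n (a x y : 'rV[R]_n) : dotp a (x - y) = dotp a x - dotp a y.
Proof. by rewrite dotpDr dotpNr. Qed.

Lemma dotpBl n (a x y : 'rV[R]_n) : dotp (x - y) a = dotp x a - dotp y a.
Proof. by rewrite dotpC dotpBr !(dotpC a). Qed.

Lemma dotpZl n c (a x : 'rV[R]_n) : dotp (c *: a) x = c * dotp a x.
Proof. by rewrite dotpC dotpZr dotpC. Qed.

Lemma dotpNl n (a x : 'rV[R]_n) : dotp (- a) x = - dotp a x.
Proof. by rewrite dotpC dotpNr dotpC. Qed.

(** The standard symplectic matrix: an isometry carrying the phase-space distance
    of two time-frequency shifts to a frequency variable. *)
Definition sympl d (z : 'rV[R]_(d + d)) : 'rV[R]_(d + d) := row_mx (rsubmx z) (- lsubmx z).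

Lemma symplK d (z : 'rV[R]_(d + d)) : sympl (- sympl z) = z.
Proof.
rewrite /sympl -scaleN1r linearZ /= linearZ /= row_mxKl row_mxKr.
by rewrite !scaleN1r !opprK hsubmxK.
Qed.

Lemma enorm_sympl d (z : 'rV[R]_(d + d)) : enorm (sympl z) = enorm z.
Proof.
rewrite /enorm -[z in RHS]hsubmxK !dotp_row /sympl !row_mxKl !row_mxKr dotpNl dotpNr opprK.
by rewrite addrC.
Qed.

End DotProduct.

Section Covariance.
Context {R : realType} {d : nat}.
Local Notation V := 'rV[R]_d.
Local Notation Z := 'rV[R]_(d + d).
Local Notation T n := (n.-tuple (measurableTypeR R)).
Implicit Types (g : V -> R[i]) (w z p u : Z).

(** Covariance: shifting the arguments by w and z moves W(g,g) to the midpoint and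
    multiplies it by a character of frequency sympl (w - z); substitute
    t + (x_w - x_z) for t. *)
Lemma wigner_tfshift g w z p : sw g ->
  wigner (tfshift w g) (tfshift z g) p =
  cis (2 * pi * (dotp (rsubmx w - rsubmx z) (lsubmx p) -
     dotp (lsubmx w - lsubmx z) (rsubmx p - 2^-1 *: (rsubmx w + rsubmx z)))) *
  wigner g g (p - 2^-1 *: (w + z)).
Proof.
move=> sg; set c := lsubmx w - lsubmx z; set u := 2^-1 *: (w + z).
rewrite !wignerE; set th := cis _.
have i0 := cintg_wint (p - u) sg sg.
have [i1 <-] := cint_aff (- c) (or_introl erefl) i0.
rewrite -(cintMl _ i1); apply: eq_cint => t; rewrite scale1r.
move: (vec t) => {}t; rewrite /wint /tfshift /th.
have Lu : lsubmx (p - u) = lsubmx p - 2^-1 *: (lsubmx w + lsubmx z) by rewrite /u !(linearB, linearZ, linearD).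
have Ru : rsubmx (p - u) = rsubmx p - 2^-1 *: (rsubmx w + rsubmx z) by rewrite /u !(linearB, linearZ, linearD).
rewrite Lu Ru /ker.
rewrite (_ : lsubmx p - 2^-1 *: (lsubmx w + lsubmx z) + 2^-1 *: (t - c) = lsubmx p + 2^-1 *: t - lsubmx w); last first.
  by apply/rowP => q; rewrite /c !mxE; field.
rewrite (_ : lsubmx p - 2^-1 *: (lsubmx w + lsubmx z) - 2^-1 *: (t - c) = lsubmx p - 2^-1 *: t - lsubmx z); last first.
  by apply/rowP => q; rewrite /c !mxE; field.
rewrite conjcM cisJ.
move: (g _) (conjc (g _)) => A B.
rewrite (_ : forall a b k : R[i], a * A * (b * B) * k = (a * b * k) * (A * B)); last by move=> *; ring.
have sw3 (x y k : R[i]) : x * (y * k) = (x * k) * y by ring.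
rewrite [RHS]sw3; congr (_ * _); rewrite -!cisD; congr cis.
rewrite !(dotpDr, dotpDl, dotpBr, dotpBl, dotpZr, dotpZl, dotpNr, dotpNl) /c.
rewrite !(dotpC (lsubmx _) (rsubmx _)).
by move: (pi : R) => q; field.
Qed.

(** The bridge between the two sides of the theorem: up to a phase, the matrix
    coefficient of the Weyl operator is a short-time Fourier transform at the
    midpoint, with frequency the rotated difference. *)
Lemma weyl_stft sigma g w z : sw g ->
  (forall u, cintg (Lb (d + d)) (fun t : T (d + d) => sigma (vec t) * conjc (wigner g g (vec t - u)))) ->
  cmod (weyl sigma (tfshift z g) (tfshift w g)) =
  cmod (stft (wigner g g) sigma (2^-1 *: (w + z)) (sympl (w - z))).
Proof.
move=> sg iu; rewrite /weyl /pairing /stft !cintegralE.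
set u := 2^-1 *: (w + z); set c := lsubmx w - lsubmx z; set v := sympl (w - z).
pose th := cis (- (2 * pi * dotp c (2^-1 *: (rsubmx w + rsubmx z)))).
have ik : cintg (Lb (d + d)) (fun t : T (d + d) => sigma (vec t) * conjc (wigner g g (vec t - u)) * ker v (vec t)).
  exact: (cintg_ker (H := fun x => sigma x * conjc (wigner g g (x - u))) v (iu u)).
have -> : cint (Lb (d + d)) ((fun x => sigma x * (wigner (tfshift w g) (tfshift z g) x)^* ) \o @vec R (d + d)) =
   th * cint (Lb (d + d)) (fun t : T (d + d) => sigma (vec t) * conjc (wigner g g (vec t - u)) * ker v (vec t)).
  rewrite -(cintMl _ ik); apply: eq_cint => t /=; rewrite conjcE wigner_tfshift//.
  move: (vec t) => p; rewrite -/u -/c.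
  rewrite conjcM cisJ /th /ker.
  have sw3 (x y k : R[i]) : x * (y * k) = (x * k) * y by ring.
  rewrite [RHS]sw3 mulrCA; congr (_ * _); rewrite -cisD; congr cis.
  have -> : dotp v p = dotp (rsubmx w - rsubmx z) (lsubmx p) - dotp c (rsubmx p).
    have -> : v = row_mx (rsubmx w - rsubmx z) (- c).
      by rewrite /v /sympl /c; congr row_mx; apply/rowP => q; rewrite !mxE.
    by rewrite dotp_row dotpNl.
  by rewrite dotpBr; move: (pi : R) => q; ring.
by rewrite cmodM cmod_cis mul1r.
Qed.

(** The Fourier transform of t |-> g(x + t/2) conj(g(x - t/2)) is W(g,g)(x, .);
    by inversion it determines the value |g(x)|^2 at t = 0. *)
Lemma wigner_neq0 g : sw g -> (exists x, g x <> 0) -> exists z, wigner g g z <> 0.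
Proof.
move=> sg [x gx]; apply: contrapT => /forallNP h0; apply: gx.
have W0 z : wigner g g z = 0 by apply: contrapT; exact: h0.
pose H t := g (x + 2^-1 *: t) * conjc (g (x - 2^-1 *: t)).
have HE (v t : V) : wint g g (row_mx x v) t = H t * ker v t by rewrite /wint row_mxKl row_mxKr.
have H0 : wint g g (row_mx x 0) = H by apply/funext => t; rewrite HE kerC ker0 mulr1.
have cH : ccont H by rewrite -H0; apply: ccont_wint; exact: sw_ccont.
have iH : cintg (Lb d) (fun t : T d => H (vec t)) by rewrite -H0; exact: cintg_wint.
have fH (v : V) : fourier H v = 0.
  by rewrite -(W0 (row_mx x v)) wignerE; apply: eq_cint => t; rewrite HE.
have := fourier_inversion 0 cH iH (lexx 0).
rewrite (eq_cint _ (G := fun=> 0)); last by move=> t; rewrite fH mulr0.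
rewrite cint0 /H !scaler0 addr0 subr0 cmod_sqr => h.
have : (0 : R[i]) = (cmod (g x) ^+ 2)%:C.
  by apply: h; apply/aeW => v; rewrite fH cmod0 mul0r.
move=> /(congr1 (@complex.Re R)) /= /esym /eqP; rewrite sqrf_eq0 => /eqP; exact: cmod_eq0.
Qed.

End Covariance.

Section SquareIntegral.
Context {R : realType} {n : nat}.
Local Notation V := 'rV[R]_n.
Local Notation T := (n.-tuple (measurableTypeR R)).

(** If the integral vanishes then Phi = 0 almost everywhere, hence its Fourier
    transform vanishes identically, hence Phi = 0 by inversion. *)
Lemma cint_sqr_neq0 (Phi : V -> R[i]) : sw Phi -> (exists z, Phi z <> 0) ->
  cint (Lb n) (fun t : T => Phi (vec t) * conjc (Phi (vec t))) <> 0.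
Proof.
move=> sP [z Pz] I0; apply: Pz.
have cP := sw_ccont sP; have [c c0 bP] := sw_le sP.
have iP : cintg (Lb n) (fun t : T => Phi (vec t)) by exact: cintg_jap bP.
have m2 : measurable_fun setT (fun t : T => cmod (Phi (vec t)) ^+ 2).
  by apply: measurable_funX; apply: cmeas_cmod; exact: ccont_cmeas.
have i2 : (Lb n).-integrable setT (EFin \o (fun t : T => cmod (Phi (vec t)) ^+ 2)).
  apply: le_integrableR (integrable_scale (c * c) (integrable_japV n)) => //.
  move=> t; rewrite ger0_norm ?sqr_ge0// expr2.
  have b1 := bP (vec t).
  apply: le_trans (ler_pM (cmod_ge0 _) (cmod_ge0 _) b1 b1) _.
  rewrite mulrACA; apply: ler_wpM2l; first exact: mulr_ge0.
  by apply: ler_piMr; [rewrite invr_ge0 ltW// jap_gt0|exact: japV_le1].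
have I2 : \int[Lb n]_t (cmod (Phi (vec t)) ^+ 2) = 0.
  move: I0 => /(congr1 (@complex.Re R)) /= <-.
  by apply: eq_Rintegral => t _; rewrite cmod_sqr.
have ae0 : {ae Lb n, forall t : T, cmod (Phi (vec t)) = 0}.
  have : {ae Lb n, forall t : T, ((cmod (Phi (vec t)) ^+ 2)%:E = 0)%E}.
    apply: (ge0_integral_eq0_ae (f := fun t : T => (cmod (Phi (vec t)) ^+ 2)%:E)).
    - exact/measurable_EFinP.
    - by move=> t; rewrite lee_fin sqr_ge0.
    - rewrite -[LHS]fineK; last exact: integrable_fin_num i2.
      by congr (_%:E); exact: I2.
  apply: filterS => t [] /eqP; rewrite sqrf_eq0 => /eqP //.
have F0 v : fourier Phi v = 0.
  have i0 : (Lb n).-integrable setT (EFin \o (fun t : T => 0 : R)) by exact: integrable0.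
  have := cint_le_ae (cintg_ker v iP) (fun=> lexx _) i0.
  rewrite Rintegral_cst// mul0r mulr0 => h.
  apply: cmod_eq0; apply/eqP; rewrite eq_le cmod_ge0 andbT; apply: h.
  by apply: filterS ae0 => t ht; rewrite cmod_mul_ker ht.
have := fourier_inversion z cP iP (lexx 0).
rewrite (eq_cint _ (G := fun=> 0)); last by move=> t; rewrite F0 mulr0.
rewrite cint0 => h; apply/esym; apply: h.
by apply/aeW => v; rewrite F0 cmod0 mul0r.
Qed.

End SquareIntegral.

(** * Derivatives of products and decay of Fourier transforms *)

Section DerivativeWords.
Context {R : realType} {n : nat}.
Variable s : R.
Hypothesis hs : 2^-1 <= s.
Local Notation V := 'rV[R]_n.
Local Notation T := (n.-tuple (measurableTypeR R)).
Implicit Types (f h F Phi Psi sigma : V -> R[i]) (x v t u : V) (i : 'I_n) (D : seq 'I_n).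

Lemma foldr_pderivD f h D : Cinf f -> Cinf h ->
  foldr pderiv (fun x => f x + h x) D = (fun x => foldr pderiv f D x + foldr pderiv h D x).
Proof.
move=> sf sh; have := wact_comb (map inr D) 1 1 sf sh; rewrite !wact_inr.
rewrite (_ : (fun x => 1 * f x + 1 * h x) = (fun x => f x + h x)); last first.
  by apply/funext => x; rewrite !mul1r.
by move=> ->; apply/funext => x; rewrite !mul1r.
Qed.

Lemma foldr_pderivJ f D : Cinf f ->
  foldr pderiv (fun x => conjc (f x)) D = (fun x => conjc (foldr pderiv f D x)).
Proof.
move=> sf; elim: D => [|i D IH] //=.
by rewrite IH pderivJ//; exact: smooth_foldr.
Qed.

Lemma foldr_pderiv_shift f u D : Cinf f ->
  foldr pderiv (fun x => f (x - u)) D = (fun x => foldr pderiv f D (x - u)).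
Proof.
move=> sf; elim: D => [|i D IH] //=.
by rewrite IH pderiv_shift//; exact: smooth_foldr.
Qed.

(** The Leibniz rule, in the form of a bound: the product of two functions with
    factorial growth of derivatives has factorial growth of derivatives. *)
Lemma foldr_pderivM_le f h (A Cf B Ch : R) (omega : V -> R) : Cinf f -> Cinf h ->
  0 <= A -> 0 <= B -> 1 <= Cf -> 1 <= Ch -> (forall x, 0 <= omega x) ->
  (forall D x, cmod (foldr pderiv f D x) <= A * Cf ^+ size D * fs s (size D)) ->
  (forall D x, cmod (foldr pderiv h D x) <= B * Ch ^+ size D * fs s (size D) * omega x) ->
  forall D x, cmod (foldr pderiv (fun y => f y * h y) D x) <=
    A * B * (2 * (Cf * Ch)) ^+ size D * fs s (size D) * omega x.
Proof.
move=> sf sh A0 B0 Cf1 Ch1 om0 bf bh D x.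
have Cf0 := le_trans ler01 Cf1; have Ch0 := le_trans ler01 Ch1.
pose E m : set (V -> R[i]) := [set F | exists D1 D2, (size D1 + size D2)%N = m /\
   F = (fun y => foldr pderiv f D1 y * foldr pderiv h D2 y)].
pose b m := A * B * (Cf * Ch) ^+ m * fs s m.
have c0 : 0 <= 1 :> R by [].
have sE m F : E m F -> Cinf F.
  by move=> [D1 [D2 [_ ->]]]; apply: smoothM; exact: smooth_foldr.
have bE m F y : E m F -> cmod (F y) <= b m * omega y.
  move=> [D1 [D2 [<- ->]]]; rewrite cmodM.
  apply: le_trans (ler_pM (cmod_ge0 _) (cmod_ge0 _) (bf D1 y) (bh D2 y)) _.
  have -> : A * Cf ^+ size D1 * fs s (size D1) * (B * Ch ^+ size D2 * fs s (size D2) * omega y) =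
    A * B * (Cf ^+ size D1 * Ch ^+ size D2) * (fs s (size D1) * fs s (size D2)) * omega y by ring.
  apply: ler_wpM2r; first exact: om0.
  rewrite /b; apply: ler_pM; [by nneg|by nneg| |exact: fsM_le].
  apply: ler_wpM2l; first exact: mulr_ge0.
  rewrite exprMn; apply: ler_pM; [by nneg|by nneg| |].
    by apply: ler_weXn2l => //; exact: leq_addr.
  by apply: ler_weXn2l => //; exact: leq_addl.
pose L : pred (letter (n := n)) := fun l => if l is inr _ then true else false.
have lE m F (l : letter (n := n)) : E m F -> L l -> exists a1 a2 F1 F2,
    [/\ cmod a1 <= 1, cmod a2 <= 1, E m.+1 F1, E m.+1 F2 &
        lact l F = (fun y => a1 * F1 y + a2 * F2 y)].
  move=> [D1 [D2 [<- ->]]]; case: l => // i _.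
  have c1 : cmod (1 : R[i]) <= 1 by rewrite -cis0 cmod_cis.
  exists 1, 1, (fun y => foldr pderiv f (i :: D1) y * foldr pderiv h D2 y),
    (fun y => foldr pderiv f D1 y * foldr pderiv h (i :: D2) y); split; [exact: c1|exact: c1| | |].
  - by exists (i :: D1), D2; split.
  - by exists D1, (i :: D2); split => //=; rewrite addnS.
  rewrite [LHS]/= pderivM; [|exact: smooth_foldr|exact: smooth_foldr].
  by apply/funext => y; rewrite !mul1r.
have aL : all L (map inr D) by elim: (D).
have E0 : E 0%N (fun y => f y * h y) by exists [::], [::]; split.
have := bound_family c0 sE bE lE aL x E0.
rewrite wact_inr size_map add0n mulr1 => hh; apply: le_trans hh _.
by rewrite /b [(2 * _) ^+ _]exprMn; apply: eq_lerW; ring.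
Qed.

Lemma rapid_deriv_le Phi : rapid s Phi -> exists K C, [/\ 0 <= K, 1 <= C &
  forall D x, cmod (foldr pderiv Phi D x) <= K * C ^+ size D * fs s (size D) * (jap x)^-1].
Proof.
move=> [_ [K [C [K0 C1 b]]]]; exists K, C; split => // D x.
by have := b (map inr D) x; rewrite wact_inr size_map.
Qed.

(** A derivative of F on the side of t is a monomial on the side of v. *)
Lemma fourier_deriv F D v : Cinf F ->
  (forall D', exists2 c, 0 <= c & forall x, cmod (foldr pderiv F D' x) <= c * (jap x)^-1) ->
  fourier (foldr pderiv F D) v = ('i * (2 * pi)%:C) ^+ size D * (prodx D v)%:C * fourier F v.
Proof.
move=> sF bF; elim: D => [|i D IH].
  by rewrite expr0 /prodx big_nil !mul1r.
set G := foldr pderiv F D; have sG : Cinf G := smooth_foldr D sF.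
have [a a0 ba] := bF D; have [b b0 bb] := bF (i :: D).
have iG := cintg_jap (smooth_ccont sG) ba.
have iG' : cintg (Lb n) (fun t : T => pderiv i G (vec t)) := cintg_jap (smooth_ccont (smooth_pderiv i sG)) bb.
pose k : R[i] := 'i * (- (2 * pi) * v 0 i)%:C.
have z0 : cint (Lb n) (fun t : T => pderiv i G (vec t) * ker v (vec t) + k * (G (vec t) * ker v (vec t))) = 0.
  apply: (cint_pderiv0 (F := fun x => G x * ker v x) (i := i) (c := b + cmod k * a)
    (DF := fun x => pderiv i G x * ker v x + k * (G x * ker v x))).
  - exact: cintg_ker iG.
  - move=> x; rewrite [k * _]mulrCA.
    exact: has_pdM (smooth_has_pd i x sG) (has_pd_ker v x i).
  - by nneg.
  - move=> x; apply: le_trans (le_normcD _ _) _; rewrite mulrDl; apply: lerD.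
      by rewrite cmod_mul_ker; exact: bb.
    rewrite cmodM cmod_mul_ker -mulrA; apply: ler_wpM2l; [exact: cmod_ge0|exact: ba].
move: z0; rewrite (cintD (cintg_ker v iG') (cintgMl _ (cintg_ker v iG))) (cintMl _ (cintg_ker v iG)).
rewrite -/(fourier (pderiv i G) v) -/(fourier G v) => /eqP; rewrite addr_eq0 => /eqP E.
rewrite [foldr _ _ _]/= -/G E IH /prodx big_cons /= exprS /k !rmorphM /= !rmorphN /= !rmorphM /=; ring.
Qed.

(** Sum the exponential series against a geometric one. *)
Lemma expR_le_of_terms (x b : R) : 0 <= b ->
  (forall N, x ^+ N / N`!%:R * b <= 2^-1 ^+ N) -> expR x * b <= 2.
Proof.
move=> b0 h; have [->|bn] := eqVneq b 0; first by rewrite mulr0.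
have bp : 0 < b by rewrite lt_def bn.
rewrite -ler_pdivlMr// /expR; apply: limr_le; first exact: is_cvg_series_exp_coeff.
apply: nearW => N; rewrite ler_pdivlMr//.
have : \sum_(0 <= k < N) (2^-1 : R) ^+ k <= 2.
  suff -> : \sum_(0 <= k < N) (2^-1 : R) ^+ k = 2 - 2 * 2^-1 ^+ N.
    by rewrite gerDl oppr_le0 mulr_ge0// exprn_ge0// invr_ge0.
  elim: N => [|N IH]; first by rewrite big_nil expr0; ring.
  by rewrite big_nat_recr//= IH exprS; field.
apply: le_trans; rewrite /series /= mulr_suml; apply: ler_sum => k _.
exact: h.
Qed.

(** If the moments of a at v grow like powers of the factorial, then a is
    exponentially small: the bounds sum up to an exponential series, after
    passage to the power 1/s. *)
Lemma decay_of_moments (A B : R) : 0 <= A -> 1 <= B -> exists eps M, [/\ 0 < eps, 0 <= M &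
  forall v (a : R), 0 <= a -> a <= A ->
   (forall i N, `|v 0 i| ^+ N * a <= A * B ^+ N * fs s N) ->
   a <= M * expR (- (eps * enorm v `^ s^-1))].
Proof.
move=> A0 B1; have s0 := half_gt0 hs; have B0 := le_trans ler01 B1.
have si0 : 0 <= s^-1 by rewrite invr_ge0 ltW.
pose A1 := A + 1; have A10 : 0 < A1 by rewrite /A1; lra.
(* The summands 1 in A1 and L only make these constants positive. *)
pose L := n%:R * B + 1; have L0 : 0 < L by rewrite ltr_wpDl// mulr_ge0.
pose rho := L `^ s^-1; have r0 : 0 < rho by exact: powR_gt0.
exists (s / (2 * rho)), (A1 * 2 `^ s); split.
- by rewrite divr_gt0// mulr_gt0.
- by rewrite mulr_ge0 ?powR_ge0// ltW.
move=> v a a0 aA h; set y := enorm v; have y0 : 0 <= y := enorm_ge0 v.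
have ky N : y ^+ N * a <= A1 * L ^+ N * fs s N.
  have [n0|n0] := posnP n.
    have -> : y = 0.
      by rewrite /y /enorm /dotp big1 ?sqrtr0// => i; have := ltn_ord i; rewrite {2}n0.
    have R0 : 0 <= A1 * L ^+ N * fs s N by rewrite !mulr_ge0 ?exprn_ge0 ?(ltW A10) ?(ltW L0)// ltW// fs_gt0.
    case: N R0 => [|N] R0; last by rewrite expr0n mul0r.
    rewrite !expr0 mul1r mulr1 /fs fact0 powR1 mulr1; apply: le_trans aA _; rewrite /A1; lra.
(* The largest coordinate controls the norm up to the factor n. *)
  have [i _ hi] := @arg_maxP _ _ _ (Ordinal n0) predT (fun i => `|v 0 i|) isT.
  have yi : y <= n%:R * `|v 0 i|.
    rewrite -[leRHS]ger0_norm ?mulr_ge0// -sqrtr_sqr ler_wsqrtr// /dotp.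
    apply: le_trans (_ : \sum_(j < n) `|v 0 i| ^+ 2 <= _).
      apply: ler_sum => j _; rewrite -expr2 -[leLHS]real_normK ?num_real//.
      by apply: lerXn2r; rewrite ?nnegrE//; exact: hi.
    rewrite sumr_const card_ord exprMn -[_ *+ n]mulr_natl; apply: ler_wpM2r; first exact: sqr_ge0.
    by rewrite expr2 ler_peMr// ler1n.
  apply: le_trans (_ : n%:R ^+ N * (`|v 0 i| ^+ N * a) <= _).
    rewrite mulrA -exprMn; apply: ler_wpM2r => //.
    by apply: lerXn2r; rewrite ?nnegrE ?mulr_ge0.
  apply: le_trans (ler_wpM2l _ (h i N)) _; first exact: exprn_ge0.
  rewrite (_ : n%:R ^+ N * (A * B ^+ N * fs s N) = A * (n%:R * B) ^+ N * fs s N); last by rewrite exprMn; ring.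
  apply: ler_wpM2r; first by apply: ltW; exact: fs_gt0.
  apply: ler_pM => //; [by rewrite exprn_ge0// mulr_ge0|by rewrite /A1; lra|].
  by apply: lerXn2r; rewrite ?nnegrE ?mulr_ge0 ?(ltW L0)// /L lerDl.
set w := y `^ s^-1; have w0 : 0 <= w := powR_ge0 _ _.
pose q := a / A1; have q0 : 0 <= q by rewrite divr_ge0// ltW.
(* The power 1/s turns (N!)^s into N!, the coefficient of the exponential series. *)
have kw N : w ^+ N * q `^ s^-1 <= rho ^+ N * N`!%:R.
  have hy : y ^+ N * q <= L ^+ N * fs s N.
    by rewrite /q mulrA ler_pdivrMr// (_ : L ^+ N * _ * A1 = A1 * L ^+ N * fs s N) ?ky//; ring.
  have := ge0_ler_powR si0 _ _ hy; rewrite !nnegrE => /(_ _ _)/wrap[].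
    by rewrite mulr_ge0// exprn_ge0.
    by rewrite mulr_ge0 ?exprn_ge0 ?(ltW L0)// ltW// fs_gt0.
  rewrite powRM ?exprn_ge0// powRM ?exprn_ge0 ?(ltW L0)//; last by rewrite ltW// fs_gt0.
  rewrite -(powR_mulrn N y0) powRAC powR_mulrn ?powR_ge0//.
  rewrite -(powR_mulrn N (ltW L0)) powRAC powR_mulrn ?powR_ge0// -/w -/rho.
  by rewrite /fs -powRrM mulfV ?gt_eqF// powRr1.
have : expR (w / (2 * rho)) * q `^ s^-1 <= 2.
  apply: expR_le_of_terms; first exact: powR_ge0.
  move=> N; have f0 : 0 < N`!%:R :> R by rewrite ltr0n fact_gt0.
  rewrite (_ : _ * _ = w ^+ N * q `^ s^-1 / (rho ^+ N * N`!%:R) * 2^-1 ^+ N); last first.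
    rewrite (invfM 2 rho) !exprMn !exprVn.
    have r1 : rho ^+ N != 0 by rewrite gt_eqF// exprn_gt0.
    have r2 : 2 ^+ N != 0 :> R by rewrite gt_eqF// exprn_gt0.
    by field; rewrite r1 r2 gt_eqF.
  apply: ler_piMl; first by rewrite exprn_ge0// invr_ge0.
  by rewrite ler_pdivrMr ?mulr_gt0 ?exprn_gt0// mul1r.
move=> hE.
have := ge0_ler_powR (ltW s0) _ _ hE; rewrite !nnegrE => /(_ _ _)/wrap[] //.
  by rewrite mulr_ge0 ?expR_ge0 ?powR_ge0.
rewrite powRM ?expR_ge0 ?powR_ge0// -powRrM mulVf ?gt_eqF// powRr1// -expRM.
rewrite (_ : w / (2 * rho) * s = s / (2 * rho) * w); last by ring.
rewrite /q mulrA ler_pdivrMr// => h2.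
by rewrite expRN ler_pdivlMr ?expR_gt0// mulrC [A1 * _]mulrC.
Qed.

End DerivativeWords.

(** * The symbol and its short-time Fourier transform *)

Section Symbol.
Context {R : realType} {n : nat}.
Variable s : R.
Hypothesis hs : 2^-1 <= s.
Local Notation V := 'rV[R]_n.
Local Notation T := (n.-tuple (measurableTypeR R)).
Implicit Types (f h F Phi Psi sigma : V -> R[i]) (x v t u : V) (i : 'I_n) (D : seq 'I_n).

(** The part of the Schwartz condition that involves derivatives only. *)
Definition tame F := Cinf F /\
  forall D, exists2 c, 0 <= c & forall x, cmod (foldr pderiv F D x) <= c * (jap x)^-1.

Lemma tame_pderiv F i : tame F -> tame (pderiv i F).
Proof.
move=> [sF b]; split; first exact: smooth_pderiv.
by move=> D; have := b (rcons D i); rewrite foldr_rcons.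
Qed.

Lemma cintg_tame F : tame F -> cintg (Lb n) (fun t : T => F (vec t)).
Proof. by move=> [sF /(_ [::]) [c c0 b]]; exact: cintg_jap (smooth_ccont sF) b. Qed.

Lemma cint_tame_pderiv F i : tame F -> cint (Lb n) (fun t : T => pderiv i F (vec t)) = 0.
Proof.
move=> tF; have [sF b] := tF; have [c c0 bc] := b [:: i].
apply: (cint_pderiv0 (F := F) (c := c) (i := i)) => //; first exact: cintg_tame.
by move=> x; exact: smooth_has_pd sF.
Qed.

(** Averaging D(sigma Psi(. - u)) over u: in the Leibniz expansion every term with a
    derivative on Psi integrates to zero. *)
Lemma cint_deriv_translates sigma Psi D t : Cinf sigma -> tame Psi ->
  cintg (Lb n) (fun u : T => foldr pderiv (fun x => sigma x * Psi (x - vec u)) D t) /\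
  cint (Lb n) (fun u : T => foldr pderiv (fun x => sigma x * Psi (x - vec u)) D t) =
    foldr pderiv sigma D t * cint (Lb n) (fun u : T => Psi (vec u)).
Proof.
(* The innermost derivative is split off, so that the induction hypothesis covers
   the two products of the Leibniz rule. *)
elim/last_ind: D sigma Psi => [|D i IH] sigma Psi ss tP.
  have [i1 e1] := cint_aff t (or_intror (erefl (-1 : R))) (cintg_tame tP).
  have E : (fun u : T => sigma t * Psi (t - vec u)) = (fun u : T => sigma t * Psi (-1 *: vec u + t)).
    by apply/funext => u; rewrite scaleN1r addrC.
  rewrite /= E; split; first exact: cintgMl.
  by rewrite (cintMl _ i1) e1.
have E : (fun u : T => foldr pderiv (fun x => sigma x * Psi (x - vec u)) (rcons D i) t) =
  (fun u : T => foldr pderiv (fun x => pderiv i sigma x * Psi (x - vec u)) D t +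
     foldr pderiv (fun x => sigma x * pderiv i Psi (x - vec u)) D t).
  apply/funext => u; rewrite foldr_rcons.
  have sP := smooth_shift (vec u) tP.1.
  have sP' := smooth_shift (vec u) (smooth_pderiv i tP.1).
  rewrite pderivM// pderiv_shift; last exact: tP.1.
  rewrite foldr_pderivD; [reflexivity| |].
    exact: smoothM (smooth_pderiv i ss) sP.
  exact: smoothM ss sP'.
have [i1 e1] := IH _ _ (smooth_pderiv i ss) tP.
have [i2 e2] := IH _ _ ss (tame_pderiv i tP).
rewrite E; split; first exact: cintgD.
rewrite (cintD i1 i2) e1 e2 (cint_tame_pderiv _ tP) mulr0 addr0.
by rewrite foldr_rcons.
Qed.

Lemma stftE Phi sigma u v : stft Phi sigma u v = fourier (fun t => sigma t * conjc (Phi (t - u))) v.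
Proof. by rewrite /stft cintegralE; apply: eq_cint => t /=; rewrite conjcE. Qed.

Lemma conj_shift_deriv Phi u D : Cinf Phi ->
  foldr pderiv (fun x => conjc (Phi (x - u))) D = (fun x => conjc (foldr pderiv Phi D (x - u))).
Proof.
move=> sP; rewrite (foldr_pderivJ (f := fun x => Phi (x - u))); last exact: smooth_shift.
by rewrite foldr_pderiv_shift.
Qed.

Lemma japV_shift_int (u : V) :
  (Lb n).-integrable setT (EFin \o (fun t : T => (jap (vec t - u))^-1)) /\
  \int[Lb n]_t (jap (vec t - u))^-1 = japint n.
Proof.
have [h1 h2] := japV_aff (- u) (or_introl (erefl (1 : R))).
have E : (fun t : T => (jap (1 *: vec t - u))^-1) = (fun t : T => (jap (vec t - u))^-1).
  by apply/funext => t; rewrite scale1r.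
by rewrite -h2 -E; split; [exact: h1|reflexivity].
Qed.

(** Integration by parts: the moments of V_Phi sigma(u, .) are Fourier transforms of
    derivatives of sigma conj(Phi(. - u)). *)
Lemma stft_decay Phi sigma A C : rapid s Phi -> Cinf sigma -> 0 <= A -> 1 <= C ->
  (forall D t, cmod (foldr pderiv sigma D t) <= A * C ^+ size D * fs s (size D)) ->
  exists eps M, [/\ 0 < eps, 0 <= M & forall u v,
    cmod (stft Phi sigma u v) <= M * expR (- (eps * enorm v `^ s^-1))].
Proof.
move=> rP ss A0 C1 bs; have C0 := le_trans ler01 C1.
have [K [Cp [K0 Cp1 bP]]] := rapid_deriv_le rP; have Cp0 := le_trans ler01 Cp1.
have ji0 := japint_ge0 (R := R) n.
have sP := rapid_smooth rP.
have p2 : 2 <= pi :> R := @pi_ge2 R.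
pose B : R := 2 * (A * K * japint n); pose L : R := 2 * (C * Cp).
have L1 : 1 <= L.
  have : 1 <= C * Cp by rewrite -[leLHS]mulr1; apply: ler_pM.
  by rewrite /L; lra.
have L0 := le_trans ler01 L1.
have B0 : 0 <= B by rewrite /B; nneg.
have [eps [M [e0 M0 hM]]] := decay_of_moments (n := n) hs B0 L1.
exists eps, M; split => // u v.
pose H x := sigma x * conjc (Phi (x - u)).
have sPu : Cinf (fun x => conjc (Phi (x - u))) := smoothJ (smooth_shift u sP).
have bH D x : cmod (foldr pderiv H D x) <= A * K * L ^+ size D * fs s (size D) * (jap (x - u))^-1.
  apply: (foldr_pderivM_le hs (omega := fun x => (jap (x - u))^-1) ss sPu A0 K0 C1 Cp1 _ bs).
    by move=> y; rewrite invr_ge0 ltW// jap_gt0.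
  by move=> D' y; rewrite conj_shift_deriv// cmodJ; exact: bP.
have sH : Cinf H := smoothM ss sPu.
have tH D : exists2 c, 0 <= c & forall x, cmod (foldr pderiv H D x) <= c * (jap x)^-1.
  exists (A * K * L ^+ size D * fs s (size D) * (2 ^+ n * jap (- u))).
    have j0 := jap_gt0 (- u); nneg.
  move=> x; apply: le_trans (bH D x) _; rewrite -[leRHS]mulrA.
  apply: ler_wpM2l; first by nneg.
  by rewrite addrC; exact: japV_shift.
have fD D : `|prodx D v| * cmod (fourier H v) <= B * L ^+ size D * fs s (size D).
  have [ij ej] := japV_shift_int u.
  have [c c0 bc] := tH D.
  have iD := cintg_jap (smooth_ccont (smooth_foldr D sH)) bc.
  have b2 : cmod (fourier (foldr pderiv H D) v) <= 2 * (A * K * L ^+ size D * fs s (size D) * japint n).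
    rewrite -ej -RintegralZl//.
    apply: cint_le; [exact: cintg_meas (cintg_ker v iD)| |exact: integrable_scale ij].
    by move=> t; rewrite cmod_mul_ker; exact: bH.
  move: b2; rewrite fourier_deriv// cmodM cmodM cmod_ipow cmod_real => b2.
  apply: le_trans (_ : (2 * pi) ^+ size D * `|prodx D v| * cmod (fourier H v) <= _).
    rewrite -mulrA; apply: ler_peMl; first by apply: mulr_ge0 => //; exact: cmod_ge0.
    by apply: exprn_ege1; lra.
  by apply: le_trans b2 _; rewrite /B; apply: eq_lerW; ring.
rewrite stftE -/H; apply: hM; first exact: cmod_ge0.
  by have := fD [::]; rewrite /prodx big_nil normr1 mul1r expr0 /fs fact0 powR1 !mulr1.
move=> i N; have := fD (nseq N i); rewrite size_nseq.
suff -> : prodx (nseq N i) v = v 0 i ^+ N by rewrite normrX.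
by elim: N => [|N IH]; rewrite /prodx ?big_nil// big_cons exprS -IH.
Qed.

(** For almost every u, Fourier inversion recovers sigma conj(Phi(. - u)) from its
    rapidly decreasing transform; multiplying by Phi(. - u) and averaging over u
    then isolates sigma. *)
Lemma deriv_of_stft_decay Phi sigma eps M : rapid s Phi -> (exists z, Phi z <> 0) ->
  Cinf sigma -> (forall u, cintg (Lb n) (fun t : T => sigma (vec t) * conjc (Phi (vec t - u)))) ->
  0 < eps -> 0 <= M ->
  {ae Lb n, forall u : T, {ae Lb n, forall v : T,
    cmod (stft Phi sigma (vec u) (vec v)) <= M * expR (- (eps * enorm (vec v) `^ s^-1))}} ->
  exists A C, [/\ 0 <= A, 1 <= C &
    forall D t, cmod (foldr pderiv sigma D t) <= A * C ^+ size D * fs s (size D)].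
Proof.
move=> rP nP ss iu e0 M0 ha.
have sP := rapid_smooth rP; have wP := rapid_sw hs rP.
have [K [C [K0 C1 bP]]] := rapid_deriv_le rP; have C0 := le_trans ler01 C1.
have [K1 [L [K10 L1 hinv]]] := deriv_inverse_fourier (n := n) hs e0; have L0 := le_trans ler01 L1.
have [K2 [L2 [K20 _ hmom]]] := moment_bound (n := n) hs e0.
have ji0 := japint_ge0 (R := R) n.
pose Psi x := Phi x * conjc (Phi x).
have j0 x : 0 <= (jap x)^-1 :> R by rewrite invr_ge0 ltW// jap_gt0.
have tP : tame Psi.
  split; first exact: smoothM sP (smoothJ sP).
  move=> D; exists (K * K * (2 * (C * C)) ^+ size D * fs s (size D)); first by nneg.
  apply: (foldr_pderivM_le hs (omega := fun x => (jap x)^-1) sP (smoothJ sP) K0 K0 C1 C1 j0).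
    move=> D' x; apply: le_trans (bP D' x) _; apply: ler_piMr; last exact: japV_le1.
    by nneg.
  by move=> D' x; rewrite foldr_pderivJ// cmodJ; exact: bP.
pose I := cint (Lb n) (fun t : T => Psi (vec t)).
have I0 : 0 < cmod I.
  rewrite lt_def cmod_ge0 andbT; apply/eqP => /cmod_eq0; exact: cint_sqr_neq0 wP nP.
pose B D := M * K1 * K * (2 * (L * C)) ^+ size D * fs s (size D).
have B0 D : 0 <= B D by rewrite /B; nneg.
have key D t : {ae Lb n, forall u : T,
    cmod (foldr pderiv (fun x => sigma x * Psi (x - vec u)) D t) <= B D * (jap (t - vec u))^-1}.
  apply: filterS ha => u hu.
  pose H x := sigma x * conjc (Phi (x - vec u)).
  have cH : ccont H := ccontM (smooth_ccont ss) (smooth_ccont (smoothJ (smooth_shift (vec u) sP))).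
  have sH : Cinf H := smoothM ss (smoothJ (smooth_shift (vec u) sP)).
  have iH : cintg (Lb n) (fun t : T => H (vec t)) := iu (vec u).
  have hu' : {ae Lb n, forall v : T, cmod (fourier H (vec v)) <= M * expR (- (eps * enorm (vec v) `^ s^-1))}.
    by apply: filterS hu => v; rewrite stftE.
  have hj : {ae Lb n, forall v : T, cmod (fourier H (vec v)) <= M * (K2 * fs s 0) * (jap (vec v))^-1 ^+ 2}.
    apply: filterS hu' => v hv; apply: le_trans hv _; rewrite -mulrA; apply: ler_wpM2l => //.
    by have := hmom [::] (vec v); rewrite /prodx big_nil normr1 mul1r expr0 mulr1.
  have M2 : 0 <= M * (K2 * fs s 0) by nneg.
  have EH : H = (fun y => cint (Lb n) (fun v : T => fourier H (vec v) * ker (- y) (vec v))).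
    apply/funext => y; rewrite -(fourier_inversion y cH iH M2 hj).
    by apply: eq_cint => v; rewrite mulrC ker_negC.
  have bH D' y : cmod (foldr pderiv H D' y) <= M * K1 * L ^+ size D' * fs s (size D').
    by rewrite EH; exact: (hinv M _ M0 (cmeas_fourier cH iH) hu').
  have -> : (fun x => sigma x * Psi (x - vec u)) = (fun x => H x * Phi (x - vec u)).
    by apply/funext => x; rewrite /H /Psi; ring.
  have MK : 0 <= M * K1 by nneg.
  apply: (foldr_pderivM_le hs (omega := fun x => (jap (x - vec u))^-1) sH (smooth_shift (vec u) sP) MK K0 L1 C1 _ bH).
    by move=> x; exact: j0.
  by move=> D' x; rewrite foldr_pderiv_shift//; exact: bP.
exists (2 * (M * K1 * K * japint n) / cmod I), (2 * (L * C)); split.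
- by apply: mulr_ge0; [nneg|rewrite invr_ge0; exact: cmod_ge0].
- have : 1 <= L * C by rewrite -[leLHS]mulr1; apply: ler_pM.
  by lra.
move=> D t; have [i1 e1] := cint_deriv_translates D t ss tP.
have [ij ej] := japV_aff t (or_intror (erefl (-1 : R))).
have E : (fun u : T => (jap (-1 *: vec u + t))^-1) = (fun u : T => (jap (t - vec u))^-1).
  by apply/funext => u; rewrite scaleN1r addrC.
have {}ij : (Lb n).-integrable setT (EFin \o (fun u : T => (jap (t - vec u))^-1)) by rewrite -E.
have {}ej : \int[Lb n]_u (jap (t - vec u))^-1 = japint n by rewrite -ej E.
have jB u : 0 <= B D * (jap (t - u))^-1 by apply: mulr_ge0.
have := cint_le_ae i1 (fun u : T => jB (vec u)) (integrable_scale (B D) ij) (key D t).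
rewrite e1 RintegralZl// ej cmodM -/I => h.
rewrite [leRHS](_ : _ = 2 * (B D * japint n) / cmod I); last by rewrite /B; ring.
by rewrite ler_pdivlMr.
Qed.

End Symbol.

(** * Multi-indices and bounded symbols as functionals *)

Section MultiIndices.
Context {R : realType} {n : nat}.
Variable s : R.
Hypothesis hs : 2^-1 <= s.
Local Notation V := 'rV[R]_n.
Local Notation T := (n.-tuple (measurableTypeR R)).
Implicit Types (sigma phi h : V -> R[i]) (x : V) (D : seq 'I_n).

(** Partial derivatives commute, so a word of derivatives only depends on the number
    of occurrences of each letter. *)
Lemma word_of_mderiv_bound sigma C A : Cinf sigma -> 0 <= A -> 0 <= C ->
  (forall x (a : 'I_n -> nat), cmod (mderiv a sigma x) <= A * C ^+ mlen a * mfact a `^ s) ->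
  forall D x, cmod (foldr pderiv sigma D x) <= A * C ^+ size D * fs s (size D).
Proof.
move=> ss A0 C0 b D x; pose a i := count_mem i D.
have := b x a; rewrite mderivE (perm_pderiv ss (perm_mword D)) mlen_count => /le_trans; apply.
apply: ler_wpM2l; first by nneg.
apply: (powR_le hs); first exact: ler0n.
by rewrite ler_nat -[in leqRHS](mlen_count D); exact: prod_fact_le.
Qed.

Lemma mderiv_of_word_bound sigma C A : 0 <= A -> 0 <= C ->
  (forall D x, cmod (foldr pderiv sigma D x) <= A * C ^+ size D * fs s (size D)) ->
  forall x (a : 'I_n -> nat), cmod (mderiv a sigma x) <= A * (C * n%:R `^ s) ^+ mlen a * mfact a `^ s.
Proof.
move=> A0 C0 b x a; rewrite mderivE; apply: le_trans (b _ x) _; rewrite size_mword.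
rewrite exprMn -!mulrA; apply: ler_wpM2l => //; apply: ler_wpM2l; first exact: exprn_ge0.
exact: fs_mlen_le.
Qed.

End MultiIndices.

Section TestFunctions.
Context {R : realType} {n : nat}.
Local Notation V := 'rV[R]_n.
Local Notation T := (n.-tuple (measurableTypeR R)).
Implicit Types (sigma phi h : V -> R[i]) (x : V) (D : seq 'I_n).

(** The weight is a sum of 2^n squares of monomials. *)
Lemma le_japV_of_moments x (a B : R) : 0 <= a ->
  (forall D, (size D <= 2 * n)%N -> `|prodx D x| * a <= B) -> a <= 2 ^+ n * B * (jap x)^-1.
Proof.
move=> a0 b.
have key (L D : seq 'I_n) : (size D + 2 * size L <= 2 * n)%N ->
    \prod_(i <- L) (1 + x 0 i ^+ 2) * (`|prodx D x| * a) <= 2 ^+ size L * B.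
  elim: L D => [|i L IH] D; first by rewrite muln0 addn0 big_nil expr0 !mul1r; exact: b.
  move=> /= hD; rewrite big_cons; set P := \prod_(j <- L) _.
  have h1 := IH D ltac:(lia); have := IH (i :: i :: D) ltac:(rewrite /=; lia).
  rewrite /prodx !big_cons -/(prodx D x) !normrM -/P [2 ^+ _.+1]exprS => h2.
  rewrite -[x 0 i ^+ 2]real_normK ?num_real//.
  rewrite -/P in h1; move: h1 h2; set p := `|prodx D x|; set q := `|x 0 i| => h1 h2.
  have -> : (1 + q ^+ 2) * P * (p * a) = P * (p * a) + P * (q * (q * p) * a) by ring.
  by lra.
rewrite ler_pdivlMr ?jap_gt0// mulrC.
have := key (enum 'I_n) [::]; rewrite size_enum_ord add0n => /(_ (leqnn _)).
by rewrite big_enum /= /prodx big_nil normr1 mul1r.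
Qed.

Lemma gs_bound_le r phi : Cinf phi -> 0 <= r -> gs_bound 1 1 1 r phi ->
  forall x, cmod (phi x) <= 2 ^+ n * (r * (2 * n)`!%:R) * (jap x)^-1.
Proof.
move=> sphi r0 b x; apply: le_japV_of_moments; first exact: cmod_ge0.
move=> D hD; have := b x (fun i => count_mem i D) (fun=> 0%N).
rewrite mpowE mderivE prodx_mword.
have -> : mword (fun=> 0%N) = [::] :> seq 'I_n.
  by apply/nilP; rewrite /nilp size_mword /mlen big1.
rewrite /= !expr1n !mulr1 cmodM cmod_real => /le_trans; apply.
have -> : mfact (fun _ : 'I_n => 0%N) = 1 :> R by rewrite /mfact big1.
rewrite powRr1 ?ler0n// powR1 mulr1; apply: ler_wpM2l => //.
rewrite ler_nat; apply: leq_trans (prod_fact_le _ _) _; rewrite -/(mlen _) mlen_count.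
exact: leq_fact.
Qed.

Lemma GSigma_sw phi : GSigma phi -> sw phi.
Proof.
move=> [sp b]; have h1 : 2^-1 <= 1 :> R by lra.
apply: (rapid_sw h1); apply: (GS_rapid h1); split => //.
by have [K K0 bK] := b 1 1 ltr01 ltr01; exists 1, 1, K; split.
Qed.

Lemma cintg_bounded_sw sigma phi B : ccont sigma -> 0 <= B -> (forall x, cmod (sigma x) <= B) ->
  sw phi -> cintg (Lb n) (fun t : T => sigma (vec t) * conjc (phi (vec t))).
Proof.
move=> cs B0 bs sp; have [c c0 bc] := sw_le sp.
apply: (cintg_jap (F := fun x => sigma x * conjc (phi x)) (c := B * c)).
  exact: ccontM cs (ccontJ (sw_ccont sp)).
move=> x; rewrite cmodM cmodJ -mulrA.
by apply: ler_pM; [exact: cmod_ge0|exact: cmod_ge0|exact: bs|exact: bc].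
Qed.

(** A bounded symbol is continuous already for one of the seminorms that define the
    topology, since that seminorm controls an integrable weight. *)
Lemma defines_GSigma_bounded sigma B : ccont sigma -> 0 <= B -> (forall x, cmod (sigma x) <= B) ->
  defines_GSigma_dual sigma.
Proof.
move=> cs B0 bs.
have ig phi : GSigma phi -> cintg (Lb n) (fun t : T => sigma (vec t) * conjc (phi (vec t))).
  by move=> /GSigma_sw; exact: cintg_bounded_sw cs B0 bs.
have pE phi : pairing sigma phi = cint (Lb n) (fun t : T => sigma (vec t) * conjc (phi (vec t))).
  by rewrite /pairing cintegralE.
have lin : conj_linear_on (@GSigma R n) (pairing sigma).
  move=> f g a b Gf Gg; rewrite !pE !conjcE.
  rewrite -(cintMl _ (ig f Gf)) -(cintMl _ (ig g Gg)) -(cintD (cintgMl _ (ig f Gf)) (cintgMl _ (ig g Gg))).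
  by apply: eq_cint => t; rewrite /fcomb conjcD !conjcM; ring.
split => //.
move=> f Gf e e0.
pose K : R := 2 ^+ n * (2 * n)`!%:R.
have K0 : 0 <= K by rewrite /K; nneg.
have ji0 := japint_ge0 (R := R) n.
(* The summand 1 keeps the divisor Q positive. *)
pose Q : R := 2 * (B * K * japint n) + 1; have Q0 : 0 < Q.
  by rewrite ltr_wpDl//; nneg.
have r0 : 0 < e / (2 * Q) by rewrite divr_gt0// mulr_gt0.
exists [set h | GSigma h /\ gs_bound 1 1 1 (e / (2 * Q)) h].
  by exists 1, 1, (e / (2 * Q)); split.
move=> g Gg [Gh bh].
set h := fcomb 1 (-1) g f in Gh bh.
have bhx x : cmod (sigma x * conjc (h x)) <= B * (K * (e / (2 * Q))) * (jap x)^-1.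
  rewrite cmodM cmodJ -mulrA; apply: ler_pM; [exact: cmod_ge0|exact: cmod_ge0|exact: bs|].
  apply: le_trans (gs_bound_le (GSigma_sw Gh).1 (ltW r0) bh x) _.
  by rewrite /K; apply: eq_lerW; ring.
have -> : pairing sigma g - pairing sigma f = pairing sigma h.
  by rewrite (lin g f 1 (-1) Gg Gf) !conjcE !(rmorph1, rmorphN1) mul1r mulN1r.
have ch : ccont (fun x => sigma x * conjc (h x)) := ccontM cs (ccontJ (sw_ccont (GSigma_sw Gh))).
rewrite pE; apply: le_lt_trans (cint_jap ch bhx) _.
have qQ : e / (2 * Q) * Q < e.
  rewrite (_ : e / (2 * Q) * Q = e / 2); first by lra.
  by field; rewrite gt_eqF.
apply: le_lt_trans qQ; move: (e / (2 * Q)) r0 => q q0.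
rewrite (_ : 2 * (B * (K * q) * japint n) = q * (2 * (B * K * japint n))); last by ring.
by apply: ler_wpM2l; [exact: ltW|rewrite /Q; lra].
Qed.

End TestFunctions.

(** * Weights and essential suprema *)

Section EssentialSupremum.
Context {R : realType} {n : nat}.
Variable s : R.
Local Notation T m := (m.-tuple (measurableTypeR R)).
Implicit Types (Phi sigma : 'rV[R]_n -> R[i]).

Lemma modulation_ae eps Phi sigma : modulation_infty s eps Phi sigma ->
  exists2 M, 0 <= M & {ae Lb n, forall u : T n, {ae Lb n, forall v : T n,
    cmod (stft Phi sigma (vec u) (vec v)) <= M * expR (- (eps * enorm (vec v) `^ s^-1))}}.
Proof.
move=> [_]; set f := fun p => _; set S := ess_sup _ _ => S1.
have hS : {ae Lb (n + n), forall p, (f p <= S)%E} by rewrite /S ess_sup_Lb; exact: ess_sup_ge.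
pose M := Num.max 0 (fine S).
have SM : (S <= M%:E)%E.
  rewrite /M; case: (S) S1 => [r| |] //= _; last by rewrite leNye.
  by rewrite lee_fin le_max lexx orbT.
exists M; first by rewrite le_max lexx.
have hM : {ae Lb (n + n), forall p, (f p <= M%:E)%E}.
  by apply: filterS hS => p /le_trans; apply.
have := ae_section hM; apply: filterS => u; apply: filterS => v.
rewrite /f vec_tcat row_mxKl row_mxKr lee_fin /expweight => h.
by rewrite expRN ler_pdivlMr ?expR_gt0.
Qed.

Lemma modulation_of_decay eps M Phi sigma : defines_GSigma_dual sigma ->
  (forall u v, cmod (stft Phi sigma u v) <= M * expR (- (eps * enorm v `^ s^-1))) ->
  modulation_infty s eps Phi sigma.
Proof.
move=> ds h; split => //; apply: le_lt_trans (ltry M).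
apply/ess_supP; apply: nearW => p /=.
rewrite lee_fin /expweight -ler_pdivlMr ?expR_gt0// -expRN; exact: h.
Qed.

End EssentialSupremum.

Theorem theorem3p4 (R : realType) (d : nat) (s : R) (hs : 2^-1 <= s)
  (g : 'rV[R]_d -> R[i]) (hg : GS s g) (g_neq0 : exists x, g x <> 0)
  (sigma : 'rV[R]_(d + d) -> R[i]) (sigma_smooth : smooth sigma)
  (sigma_dual : defines_GS_dual s sigma) :
  [<->
    (* (i) *)
    exists2 eps : R, 0 < eps & modulation_infty s eps (wigner g g) sigma;
    (* (ii) *)
    exists C C' : R, [/\ 0 < C, 0 < C' &
      forall (z : 'rV[R]_(d + d)) (a : 'I_(d + d) -> nat),
        cmod (mderiv a sigma z) <= C' * C ^+ mlen a * mfact a `^ s];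
    (* (iii) *)
    exists eps C'' : R, [/\ 0 < eps, 0 < C'' &
      forall z w : 'rV[R]_(d + d),
        cmod (weyl sigma (tfshift z g) (tfshift w g)) <=
          C'' * expR (- (eps * enorm (w - z) `^ s^-1))]].
Proof.
have rg := GS_rapid hs hg; have sg := rapid_sw hs rg.
have rP := wigner_rapid hs rg; have nP := wigner_neq0 sg g_neq0.
have ss : Cinf sigma := (CinfE sigma).2 sigma_smooth.
have iu (u : 'rV[R]_(d + d)) : cintg (Lb (d + d))
    (fun t : (d + d).-tuple (measurableTypeR R) => sigma (vec t) * conjc (wigner g g (vec t - u))).
  have [h _ _] := sigma_dual.
  by have := h _ (rapid_GS hs (rapid_translate hs u rP)); rewrite cintegrableE.
tfae.
- move=> [eps e0 /modulation_ae [M M0 hM]].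
  have [A [C [A0 C1 b]]] := deriv_of_stft_decay hs rP nP ss iu e0 M0 hM.
  have C0 := le_trans ler01 C1.
  have h0 : 0 <= C * (d + d)%:R `^ s by nneg.
  exists (C * (d + d)%:R `^ s + 1), (A + 1); split; [by lra|by lra|].
  move=> z a; apply: le_trans (mderiv_of_word_bound hs A0 C0 b z a) _.
  apply: ler_wpM2r; first exact: powR_ge0.
  apply: ler_pM; [exact: A0|exact: exprn_ge0|by lra|].
  by apply: lerXn2r; rewrite ?nnegrE//; lra.
- move=> [C [C' [C0 C'0 b]]].
  have bw := word_of_mderiv_bound hs ss (ltW C'0) (ltW C0) b.
  have C1 : 1 <= C + 1 by lra.
  have bw1 D t : cmod (foldr pderiv sigma D t) <= C' * (C + 1) ^+ size D * fs s (size D).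
    apply: le_trans (bw D t) _; apply: ler_wpM2r; first by apply: ltW; exact: fs_gt0.
    apply: ler_wpM2l; first exact: ltW.
    by apply: lerXn2r; rewrite ?nnegrE//; lra.
  have [eps [M [e0 M0 h]]] := stft_decay hs rP ss (ltW C'0) C1 bw1.
  exists eps, (M + 1); split; [exact: e0|by lra|].
  move=> z w; rewrite (weyl_stft _ _ sg iu) -enorm_sympl.
  apply: le_trans (h _ _) _; apply: ler_wpM2r; [exact: expR_ge0|by lra].
- move=> [eps [M [e0 M0 h]]]; exists eps => //.
  have hV (u v : 'rV[R]_(d + d)) : cmod (stft (wigner g g) sigma u v) <= M * expR (- (eps * enorm v `^ s^-1)).
    pose del := - sympl v; have dv : sympl del = v := symplK v.
    have := h (u - 2^-1 *: del) (u + 2^-1 *: del); rewrite (weyl_stft _ _ sg iu).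
    have -> : u + 2^-1 *: del - (u - 2^-1 *: del) = del by apply/rowP => q; rewrite !mxE; field.
    have -> : 2^-1 *: (u + 2^-1 *: del + (u - 2^-1 *: del)) = u by apply/rowP => q; rewrite !mxE; field.
    by rewrite -enorm_sympl dv.
  have [A [C [A0 C1 b]]] : exists A C, [/\ 0 <= A, 1 <= C &
      forall D t, cmod (foldr pderiv sigma D t) <= A * C ^+ size D * fs s (size D)].
    apply: (deriv_of_stft_decay hs rP nP ss iu e0 (ltW M0)).
    by apply/aeW => u; apply/aeW => v; exact: hV.
  apply: modulation_of_decay hV.
  apply: (defines_GSigma_bounded (smooth_ccont ss) A0) => x.
  by have := b [::] x; rewrite expr0 /fs fact0 powR1 !mulr1.
Qed.
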